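(* Let $1<p<\infty$ with conjugate exponent $p'$, $\varsigma\in M^1(\mathbb{Z}^n\times\mathbb{T}^n)$, $g_1\in M^{p'}(\mathbb{Z}^n)$ and $g_2\in M^p(\mathbb{Z}^n)$. Then the localization operator $\mathfrak{L}^{g_1,g_2}_\varsigma:M^p(\mathbb{Z}^n)\to M^p(\mathbb{Z}^n)$ is compact.
   Context: $\mathbb{T}^n$ is the torus with normalized Haar measure $dw$; $\mathbb{Z}^n\times\mathbb{T}^n$ carries the product of counting measure and $dw$. $T_mf(k)=f(k-m)$, $M_wf(k)=e^{2\pi i w\cdot k}f(k)$, and the short-time Fourier transform is $V_gf(m,w)=\langle f,M_wT_mg\rangle=\sum_{k\in\mathbb{Z}^n}f(k)\overline{g(k-m)}e^{-2\pi i w\cdot k}$ (the pairing $\langle\cdot,\cdot\rangle$ being the sesquilinear duality extending the $\ell^2(\mathbb{Z}^n)$ inner product, in particular that between $M^p(\mathbb{Z}^n)$ and $M^{p'}(\mathbb{Z}^n)$). $\mathcal{S}(\mathbb{Z}^n)$ is the space of rapidly decreasing functions on $\mathbb{Z}^n$, $\mathcal{S}'(\mathbb{Z}^n)$ its dual (tempered distributions); $\mathcal{S}(\mathbb{Z}^n\times\mathbb{T}^n)$ and $\mathcal{S}'(\mathbb{Z}^n\times\mathbb{T}^n)$ are the Schwartz functions and tempered distributions on the group $\mathbb{Z}^n\times\mathbb{T}^n$. Modulation spaces: fix a non-zero window $g\in\mathcal{S}(\mathbb{Z}^n)$; for $1\le p\le\infty$, $M^p(\mathbb{Z}^n)=\{f\in\mathcal{S}'(\mathbb{Z}^n):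 V_gf\in L^p(\mathbb{Z}^n\times\mathbb{T}^n)\}$ with $\|f\|_{M^p(\mathbb{Z}^n)}=\|V_gf\|_{L^p}$. Similarly, fix a non-zero $g\in\mathcal{S}(\mathbb{Z}^n\times\mathbb{T}^n)$ and set $$V_gF(m,\omega,\xi,k)=\sum_{j\in\mathbb{Z}^n}\int_{\mathbb{T}^n}e^{-2\pi i j\xi}e^{-2\pi i\eta k}F(j,\eta)\overline{g(j-m,\eta-\omega)}\,d\eta,\quad m,k\in\mathbb{Z}^n,\ \omega,\xi\in\mathbb{T}^n;$$ $M^p(\mathbb{Z}^n\times\mathbb{T}^n)$ is the space of $F\in\mathcal{S}'(\mathbb{Z}^n\times\mathbb{T}^n)$ with $\|F\|_{M^p(\mathbb{Z}^n\times\mathbb{T}^n)}=\|V_gF\|_{L^p((\mathbb{Z}^n\times\mathbb{T}^n)\times(\mathbb{T}^n\times\mathbb{Z}^n))}<\infty$. Different windows give equivalent norms. Localization operator: $\mathfrak{L}^{g_1,g_2}_\varsigma f(k)=\sum_{m\in\mathbb{Z}^n}\int_{\mathbb{T}^n}\varsigma(m,w)V_{g_1}f(m,w)\,M_wT_mg_2(k)\,dw$, or in the weak sense $$\langle\mathfrak{L}^{g_1,g_2}_\varsigma f,h\rangle=\sum_{m\in\mathbb{Z}^n}\int_{\mathbb{T}^n}\varsigma(m,w)\,V_{g_1}f(m,w)\,\overline{V_{g_2}h(m,w)}\,dw,\qquad f\in M^p(\mathbb{Z}^n),\ h\in M^{p'}(\mathbb{Z}^n).$$ *)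

(* Defs.v *)
From HB Require Import structures.
From mathcomp Require Import all_boot all_order all_algebra.
From mathcomp Require Import all_classical all_reals all_analysis.
From mathcomp Require Import complex.

Set Implicit Arguments.
Unset Strict Implicit.
Unset Printing Implicit Defensive.

Import Order.TTheory GRing.Theory Num.Theory.
Import numFieldNormedType.Exports.
Import Normc.

Local Open Scope classical_set_scope.
Local Open Scope ring_scope.
Local Open Scope complex_scope.

Definition Zn (n : nat) : Type := 'rV[int]_n.

HB.instance Definition _ n := GRing.Zmodule.copy (Zn n) 'rV[int]_n.
HB.instance Definition _ n := Countable.copy (Zn n) 'rV[int]_n.
HB.instance Definition _ n := isPointed.Build (Zn n) 0.
HB.instance Definition _ n := @isMeasurable.Build default_measure_display
  (Zn n) discrete_measurable discrete_measurable0
  discrete_measurableC discrete_measurableU.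

(* A constant distinct from [counting], on which the library already keys a   *)
(* sigma-finite instance, for the carrier nat.                                *)
Definition countZ (R : realType) (n : nat) : set (Zn n) -> \bar R := counting.
Arguments countZ : clear implicits.

Section countZ_measure.
Variables (R : realType) (n : nat).

HB.instance Definition _ := Measure.copy (countZ R n) (@counting (Zn n) R).

Let sigma_finite_countZ : sigma_finite [set: Zn n] (countZ R n).
Proof.
exists (fun N => [set k : Zn n | (pickle k < N.+1)%N]).
  by apply/seteqP; split=> // k _; exists (pickle k) => /=.
move=> N; split=> //; rewrite /countZ /counting/= asboolT ?ltry//.
apply: (@finite_preimage _ _ `I_N.+1 pickle); last exact: finite_II.
by apply: in2W; exact: (pcan_inj (@pickleK _)).
Qed.

HB.instance Definition _ :=
  Measure_isSigmaFinite.Build _ _ _ (countZ R n) sigma_finite_countZ.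

End countZ_measure.

(* T^n = R^n / Z^n: its points are represented by vectors of R^n, functions   *)
(* on it by Z^n-periodic functions on R^n, and its normalized Haar measure by *)
(* Lebesgue measure on the fundamental domain [0, 1]^n.                       *)
Definition Tn (R : realType) (n : nat) : Type := 'rV[R]_n.

HB.instance Definition _ (R : realType) n :=
  NormedModule.copy (Tn R n) 'rV[R]_n.

Section Tn_measurable.
Variables (R : realType) (n : nat).

Definition Tn_coord (i : 'I_n) (w : Tn R n) : R := w ord0 i.

Let Tn_set0 : g_sigma_preimage Tn_coord set0.
Proof. exact: sigma_algebra0. Qed.

Let Tn_setC A : g_sigma_preimage Tn_coord A -> g_sigma_preimage Tn_coord (~` A).
Proof. exact: sigma_algebraC. Qed.

Let Tn_bigcup (F : _^nat) : (forall i, g_sigma_preimage Tn_coord (F i)) ->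
  g_sigma_preimage Tn_coord (\bigcup_i (F i)).
Proof. exact: sigma_algebra_bigcup. Qed.

HB.instance Definition _ := @isMeasurable.Build default_measure_display
  (Tn R n) (g_sigma_preimage Tn_coord) Tn_set0 Tn_setC Tn_bigcup.

Lemma measurable_Tn_coord i : measurable_fun [set: Tn R n] (Tn_coord i).
Proof.
move=> _ Y mY; rewrite setTI; apply: sub_sigma_algebra => /=.
rewrite -bigcup_seq/=; exists i => /=; first by rewrite mem_index_enum.
by exists Y => //; rewrite setTI.
Qed.

Lemma measurable_fun_Tn d (T : measurableType d) (f : T -> Tn R n) :
  (forall i, measurable_fun [set: T] (Tn_coord i \o f)) ->
  measurable_fun [set: T] f.
Proof.
move=> mf _ Y mY; rewrite setTI.
suff : g_sigma_preimage Tn_coord `<=` [set A | measurable (f @^-1` A)].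
  exact.
apply: smallest_sub.
  split=> /=.
  - by rewrite preimage_set0.
  - by move=> A mA; rewrite setTD preimage_setC; exact: measurableC.
  - by move=> F mF; rewrite preimage_bigcup; exact: bigcup_measurable.
rewrite -bigcup_seq; apply: bigcup_sub => i _ A [B mB <-].
by rewrite /= setTI -comp_preimage -[X in measurable X]setTI; exact: mf.
Qed.

Definition Tn_cons (x : measurableTypeR R * Tn R n) : Tn R n.+1 :=
  row_mx (x.1 : R)%:M x.2.

End Tn_measurable.

Section haar.
Variable R : realType.

Let measurable_Tn_cons n : measurable_fun setT (@Tn_cons R n).
Proof.
apply: measurable_fun_Tn => i; have [j ji|j ji] := split_ordP (i : 'I_(1 + n)).
  rewrite (_ : _ \o _ = fst) //; apply/funext => x /=.
  rewrite /Tn_coord ji [LHS](row_mxEl (x.1 : R)%:M x.2 ord0 j).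
  by rewrite !ord1 mxE eqxx mulr1n.
rewrite (_ : _ \o _ = Tn_coord j \o snd).
  by apply: measurableT_comp => //; exact: measurable_Tn_coord.
apply/funext => x /=.
by rewrite /Tn_coord ji [LHS](row_mxEr (x.1 : R)%:M x.2 ord0 j).
Qed.

HB.instance Definition _ n :=
  isMeasurableFun.Build _ _ _ _ (@Tn_cons R n) (@measurable_Tn_cons n).

Fixpoint haar (n : nat) : probability (Tn R n) R :=
  match n with
  | 0%N => \d_(0 : Tn R 0)
  | m.+1 => distribution (uniform_prob (@ltr01 R) \x haar m)%E (@Tn_cons R m)
  end.

End haar.

(* The library registers the sigma-finiteness of a product measure only for   *)
(* products of (sub)probability measures.                                     *)
Lemma product_sigma_finite d1 d2 (T1 : measurableType d1)
    (T2 : measurableType d2) (R : realType)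
    (m1 : {sigma_finite_measure set T1 -> \bar R})
    (m2 : {sigma_finite_measure set T2 -> \bar R}) :
  sigma_finite setT (m1 \x m2)%E.
Proof.
have /sigma_finiteP[F [TF ndF Foo]] := sigma_finiteT m1.
have /sigma_finiteP[G [TG ndG Goo]] := sigma_finiteT m2.
exists (fun n => F n `*` G n).
  rewrite -setXTT TF TG predeqE => -[x y]; split.
    move=> [/= [n _ Fnx] [k _ Gky]]; exists (maxn n k) => //; split.
    - by move: x Fnx; exact/subsetPset/ndF/leq_maxl.
    - by move: y Gky; exact/subsetPset/ndG/leq_maxr.
  by move=> [n _ []/= ? ?]; split; exists n.
move=> k; have [? ?] := Foo k; have [? ?] := Goo k.
split; first exact: measurableX.
by rewrite product_measure1E// lte_mul_pinfty// ge0_fin_numE.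
Qed.

Definition muZT (R : realType) (n : nat) : set (Zn n * Tn R n) -> \bar R :=
  (countZ R n \x haar R n)%E.

Definition muTZ (R : realType) (n : nat) : set (Tn R n * Zn n) -> \bar R :=
  (haar R n \x countZ R n)%E.

Section product_measures.
Variables (R : realType) (n : nat).

HB.instance Definition _ :=
  Measure.copy (@muZT R n) (countZ R n \x haar R n)%E.
HB.instance Definition _ := Measure_isSigmaFinite.Build _ _ _ (@muZT R n)
  (product_sigma_finite (countZ R n) (haar R n)).

HB.instance Definition _ :=
  Measure.copy (@muTZ R n) (haar R n \x countZ R n)%E.
HB.instance Definition _ := Measure_isSigmaFinite.Build _ _ _ (@muTZ R n)
  (product_sigma_finite (haar R n) (countZ R n)).

End product_measures.
Arguments muZT : clear implicits.
Arguments muTZ : clear implicits.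

(* [Num.Theory] shadows the projections of R[i]. *)
Local Notation Re := complex.Re.
Local Notation Im := complex.Im.

Section complex_integration.
Context d (X : measurableType d) (R : realType).
Variable mu : {measure set X -> \bar R}.
Implicit Type f : X -> R[i].

Definition cmeasurable f :=
  measurable_fun setT (fun x => Re (f x)) /\
  measurable_fun setT (fun x => Im (f x)).

Definition cintegrable f :=
  mu.-integrable setT (fun x => (Re (f x))%:E) /\
  mu.-integrable setT (fun x => (Im (f x))%:E).

Definition cintegral f : R[i] :=
  (\int[mu]_x Re (f x)) +i* (\int[mu]_x Im (f x)).

Definition Lp_norm (p : \bar R) f : \bar R :=
  Lnorm mu p (fun x => (normc (f x))%:E).

Definition in_Lp (p : \bar R) f := cmeasurable f /\ (Lp_norm p f < +oo)%E.

End complex_integration.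

Section torus_lattice.
Variables (R : realType) (n : nat).
Local Notation C := R[i].
Local Notation ZT := (Zn n * Tn R n)%type.

Definition dot (w : Tn R n) (k : Zn n) : R :=
  \sum_(i < n) w ord0 i * (k ord0 i)%:~R.

Definition e2pi (t : R) : C := cos (2 * pi * t) +i* sin (2 * pi * t).

(* Schwartz functions.  The numbers B for which [Zbound N phi B] holds (resp. *)
(* [ZTbound N phi B]) are the upper bounds of the N-th seminorm of phi; these *)
(* seminorms increase with N and define the Frechet topology of S(Z^n) (resp. *)
(* S(Z^n x T^n)).                                                             *)

Definition weight (N : nat) (k : Zn n) : R :=
  (1 + \sum_(i < n) `|(k ord0 i)%:~R|) ^+ N.

Definition Zbound (N : nat) (phi : Zn n -> C) (B : R) :=
  forall k, weight N k * normc (phi k) <= B.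

Definition Zschwartz (phi : Zn n -> C) := forall N, exists B, Zbound N phi B.

Definition partial (i : 'I_n) (f : Tn R n -> C) (w : Tn R n) : C :=
  let e_i : Tn R n := delta_mx ord0 i in
  ('D_e_i (fun v => Re (f v)) w) +i* ('D_e_i (fun v => Im (f v)) w).

Definition partials (s : seq 'I_n) (f : Tn R n -> C) : Tn R n -> C :=
  foldr partial f s.

Definition Tsmooth (f : Tn R n -> C) :=
  forall (s : seq 'I_n) (w : Tn R n),
    differentiable (fun v => Re (partials s f v)) w /\
    differentiable (fun v => Im (partials s f v)) w.

Definition Tperiodic (f : Tn R n -> C) :=
  forall (w : Tn R n) (k : Zn n), f (w + map_mx intr k) = f w.

Definition ZTbound (N : nat) (phi : ZT -> C) (B : R) :=
  forall (s : seq 'I_n) k w, (size s <= N)%N ->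
    weight N k * normc (partials s (fun v => phi (k, v)) w) <= B.

Definition ZTschwartz (phi : ZT -> C) :=
  [/\ forall k, Tperiodic (fun v => phi (k, v)),
      forall k, Tsmooth (fun v => phi (k, v)) &
      forall N, exists B, ZTbound N phi B].

(* A tempered distribution u on the discrete group Z^n is identified with the *)
(* function f : k |-> u(delta_k), which determines it: u is then the          *)
(* functional phi |-> \sum_k f k * phi k.                                     *)
Definition Ztempered (f : Zn n -> C) :=
  (forall phi, Zschwartz phi ->
    cintegrable (countZ R n) (fun k => f k * phi k)) /\
  exists A N, forall phi B, Zschwartz phi -> Zbound N phi B ->
    normc (cintegral (countZ R n) (fun k => f k * phi k)) <= A * B.

(* Tempered distributions on Z^n x T^n are the continuous linear functionals  *)
(* on the Schwartz functions (the values of u elsewhere are irrelevant).      *)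
Definition ZTtempered (u : (ZT -> C) -> C) :=
  (forall a phi psi, ZTschwartz phi -> ZTschwartz psi ->
    u (fun z => a * phi z + psi z) = a * u phi + u psi) /\
  exists A N, forall phi B, ZTschwartz phi -> ZTbound N phi B ->
    normc (u phi) <= A * B.

(* u is the distribution phi |-> \int sigma * phi; this determines sigma      *)
(* almost everywhere.                                                         *)
Definition represents (sigma : ZT -> C) (u : (ZT -> C) -> C) :=
  cmeasurable sigma /\
  forall phi, ZTschwartz phi ->
    cintegrable (muZT R n) (fun z => sigma z * phi z) /\
    u phi = cintegral (muZT R n) (fun z => sigma z * phi z).

Definition pairing (f h : Zn n -> C) : C :=
  cintegral (countZ R n) (fun k => f k * (h k)^*).

(* M_w T_m g *)
Definition tfshift (m : Zn n) (w : Tn R n) (g : Zn n -> C) (k : Zn n) : C :=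
  e2pi (dot w k) * g (k - m).

Definition stft (g f : Zn n -> C) (z : ZT) : C := pairing f (tfshift z.1 z.2 g).

Definition modZ_norm (g : Zn n -> C) (p : \bar R) (f : Zn n -> C) : \bar R :=
  Lp_norm (muZT R n) p (stft g f).

Definition modZ (g : Zn n -> C) (p : \bar R) (f : Zn n -> C) :=
  Ztempered f /\ in_Lp (muZT R n) p (stft g f).

(* For u = (phi |-> \int F * phi), this is the integral over (j, eta) of      *)
(* e^(-2 pi i j xi) e^(-2 pi i eta k) F(j, eta) (g(j - m, eta - w))^*         *)
(* at the point ((m, w), (xi, k)).                                            *)
Definition stftZT (g : ZT -> C) (u : (ZT -> C) -> C)
    (y : ZT * (Tn R n * Zn n)) : C :=
  let: ((m, w), (xi, k)) := y in
  u (fun z => e2pi (- dot xi z.1) * e2pi (- dot z.2 k) *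
              (g (z.1 - m, z.2 - w))^*).

Definition modZT (g : ZT -> C) (p : \bar R) (u : (ZT -> C) -> C) :=
  ZTtempered u /\ in_Lp (muZT R n \x muTZ R n)%E p (stftZT g u).

Definition locop (sigma : ZT -> C) (g1 g2 f : Zn n -> C) (k : Zn n) : C :=
  cintegral (muZT R n) (fun z => sigma z * stft g1 f z * tfshift z.1 z.2 g2 k).

(* The integrals defining [locop sigma g1 g2] converge absolutely for f in M, *)
(* and this operator satisfies the weak identity against all h in M'.         *)
Definition locop_well_defined (sigma : ZT -> C) (g1 g2 : Zn n -> C)
    (M M' : set (Zn n -> C)) :=
  forall f, M f ->
    (forall k, cintegrable (muZT R n)
       (fun z => sigma z * stft g1 f z * tfshift z.1 z.2 g2 k)) /\
    forall h, M' h ->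
      [/\ cintegrable (countZ R n) (fun k => locop sigma g1 g2 f k * (h k)^*),
          cintegrable (muZT R n)
            (fun z => sigma z * stft g1 f z * (stft g2 h z)^*) &
          pairing (locop sigma g1 g2 f) h =
          cintegral (muZT R n)
            (fun z => sigma z * stft g1 f z * (stft g2 h z)^*)].

(* L is a linear operator M -> M mapping bounded sequences to sequences with  *)
(* a convergent subsequence, for the norm [nrm] of the space M.               *)
Definition compact_operator (M : set (Zn n -> C))
    (nrm : (Zn n -> C) -> \bar R) (L : (Zn n -> C) -> (Zn n -> C)) :=
  [/\ forall f, M f -> M (L f),
      forall a f h, M f -> M h ->
        L (fun k => a * f k + h k) = (fun k => a * L f k + L h k) &
      forall u : nat -> Zn n -> C, (forall i, M (u i)) ->
        (exists B : R, forall i, (nrm (u i) <= B%:E)%E) ->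
        exists s : nat -> nat, {homo s : i j / (i < j)%N} /\
          exists2 h, M h &
            (fun i => nrm (fun k => L (u (s i)) k - h k)) @ \oo --> 0%E].

End torus_lattice.

(* Main.v *)
Require Import Defs.
From HB Require Import structures.
From mathcomp Require Import all_boot all_order all_algebra.
From mathcomp Require Import all_classical all_reals all_analysis.
From mathcomp Require Import complex.
From mathcomp Require Import measurable_realfun.
From mathcomp Require Import ring lra zify.

(** Write l^p for the lattice sequence space and let 1 < p < oo.

    Two facts reduce everything to integrals.  First, M^p(Z^n) = l^p(Z^n) with
    equivalent norms: V_g f(m, .) is the Fourier series with coefficients
    f(k) g(k - m)^*, so Young's inequality bounds |V_g f|_p by |g|_1 |f|_p,
    and integrating V_g f(m, .) against a character recovers
    f(k0 + m) g(k0)^*, so |g(k0)| |f|_p <= |V_g f|_p.  Second, an element u of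
    M^1(Z^n x T^n) is an integrable function: integrating V_G u over (w, xi)
    against a character recovers the product of a Fourier coefficient of the
    window G and a coefficient c(j, k) = u(delta_j (x) e_(-k)); hence c is
    absolutely summable and sigma(j, w) = sum_k c(j, k) e_k(w) is in L^1.
    That sigma represents u follows by density of trigonometric polynomials in
    S(Z^n x T^n), which comes from Fejer means: these commute with
    derivatives and converge uniformly at a rate depending only on a Lipschitz
    constant.

    For sigma in L^1, g1 in l^p' and g2 in l^p, Jensen's inequality gives
    |L f|_p <= |g2|_p * int |sigma V_g1 f|.  From a bounded sequence in l^p
    extract a subsequence converging pointwise; its limit f is in l^p by Fatou,
    and the differences v_i -> 0 pointwise and boundedly in l^p, so
    V_g1 v_i -> 0 pointwise and boundedly, and the integral
    int |sigma V_g1 v_i| tends to 0 by dominated convergence. *)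

Set Implicit Arguments.
Unset Strict Implicit.
Unset Printing Implicit Defensive.

Import Order.TTheory GRing.Theory Num.Theory.
Import numFieldNormedType.Exports.
Import Normc.

Local Open Scope classical_set_scope.
Local Open Scope complex_scope.
Local Open Scope ring_scope.

Local Notation Re := complex.Re.
Local Notation Im := complex.Im.

(** * Complex-valued integration *)

(** Two obstacles shape the argument. The symbol is known only through its values on test functions,
    so a torus integral over the window parameters cannot be exchanged with it directly. For a
    window that is a finite sum of tensors delta_j (x) e_l, linearity turns the transform into an
    explicit trigonometric polynomial in (w, xi). Both facts about u, the bound on its coefficients
    and its representation by a function, are settled there first and then carried over by
    continuity; this succeeds under the integrals because the continuity constants do not depend on
    w and xi. The second obstacle is that a sequence bounded in l^p and converging pointwise has no
    common majorant in l^p. Dominated convergence therefore does not apply to the products g1 v_i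
    themselves. Young's inequality with a small parameter splits each product into a part that is
    small by boundedness in l^p and a part dominated by a multiple of |g1|^p', which is summable
    since p' is finite. Hoelder products are replaced throughout by sums of p-th powers: boundedness
    and convergence to 0 are all that compactness asks for. *)

Section complex_norm.
Variable R : realType.
Implicit Types x y z : R[i].

Lemma normc_ReIm z : normc z = Num.sqrt (Re z ^+ 2 + Im z ^+ 2).
Proof. by case: z. Qed.

Lemma normc_ge0 z : 0 <= normc z.
Proof. by rewrite normc_ReIm sqrtr_ge0. Qed.

Lemma normc_sq z : normc z ^+ 2 = Re z ^+ 2 + Im z ^+ 2.
Proof. by rewrite normc_ReIm sqr_sqrtr// addr_ge0// sqr_ge0. Qed.

Lemma Re_le_normc z : `|Re z| <= normc z.
Proof.
rewrite -(@ler_pXn2r _ 2)// ?nnegrE ?normc_ge0// normc_sq real_normK ?num_real//.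
by rewrite lerDl sqr_ge0.
Qed.

Lemma Im_le_normc z : `|Im z| <= normc z.
Proof.
rewrite -(@ler_pXn2r _ 2)// ?nnegrE ?normc_ge0// normc_sq real_normK ?num_real//.
by rewrite lerDr sqr_ge0.
Qed.

Lemma normc_le_ReIm z : normc z <= `|Re z| + `|Im z|.
Proof.
rewrite -(@ler_pXn2r _ 2)// ?nnegrE ?normc_ge0// ?addr_ge0//.
rewrite normc_sq sqrrD !real_normK ?num_real// -addrA lerD2l lerDr.
by rewrite mulrn_wge0// mulr_ge0.
Qed.

Lemma normc_conjc z : normc z^* = normc z.
Proof. by rewrite !normc_ReIm; case: z => a b /=; rewrite sqrrN. Qed.

Lemma normcR (a : R) : normc a%:C = `|a|.
Proof. by rewrite normc_ReIm/= expr0n addr0 sqrtr_sqr. Qed.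

Lemma cReM x y : Re (x * y) = Re x * Re y - Im x * Im y.
Proof. by case: x y => [a b] [c e]. Qed.

Lemma cImM x y : Im (x * y) = Re x * Im y + Im x * Re y.
Proof. by case: x y => [a b] [c e]. Qed.

Lemma cReD x y : Re (x + y) = Re x + Re y.
Proof. by case: x y => [a b] [c e]. Qed.

Lemma cImD x y : Im (x + y) = Im x + Im y.
Proof. by case: x y => [a b] [c e]. Qed.

Lemma cReJ z : Re z^* = Re z.
Proof. by case: z. Qed.

Lemma cImJ z : Im z^* = - Im z.
Proof. by case: z. Qed.

Lemma complexP z w : Re z = Re w -> Im z = Im w -> z = w.
Proof. by case: z w => [a b] [c e] /= -> ->. Qed.

Lemma normc_eq0 z : (normc z == 0) = (z == 0).
Proof.
by apply/eqP/eqP => [/eq0_normc//|->]; rewrite normc_ReIm /= expr0n addr0 sqrtr0.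
Qed.

Lemma normc_gt0 z : (0 < normc z) = (z != 0).
Proof. by rewrite lt_def normc_eq0 normc_ge0 andbT. Qed.

Lemma normc_sum (I : Type) (r : seq I) (P : pred I) (F : I -> R[i]) :
  normc (\sum_(i <- r | P i) F i) <= \sum_(i <- r | P i) normc (F i).
Proof.
elim/big_ind2 : _ => //.
- by rewrite normc0.
- by move=> a b c e ab ce; rewrite (le_trans (le_normcD _ _))// lerD.
Qed.

End complex_norm.

Section complex_measurable.
Context d (X : measurableType d) (R : realType).
Implicit Types f g : X -> R[i].

Lemma cmeasurable_cst (c : R[i]) : cmeasurable (fun _ : X => c).
Proof. by split; exact: measurable_cst. Qed.

Lemma cmeasurableD f g : cmeasurable f -> cmeasurable g ->
  cmeasurable (fun x => f x + g x).
Proof.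
move=> [f1 f2] [g1 g2]; split.
  by under eq_fun do rewrite cReD; exact: measurable_funD.
by under eq_fun do rewrite cImD; exact: measurable_funD.
Qed.

Lemma cmeasurableM f g : cmeasurable f -> cmeasurable g ->
  cmeasurable (fun x => f x * g x).
Proof.
move=> [f1 f2] [g1 g2]; split.
  by under eq_fun do rewrite cReM; apply: measurable_funB; exact: measurable_funM.
by under eq_fun do rewrite cImM; apply: measurable_funD; exact: measurable_funM.
Qed.

Lemma cmeasurableJ f : cmeasurable f -> cmeasurable (fun x => (f x)^*).
Proof.
move=> [f1 f2]; split.
  by under eq_fun do rewrite cReJ.
by under eq_fun do rewrite cImJ; exact: measurableT_comp.
Qed.

Lemma cmeasurable_normc f : cmeasurable f ->
  measurable_fun setT (fun x => normc (f x)).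
Proof.
move=> [f1 f2]; under eq_fun do rewrite normc_ReIm.
apply: (@measurableT_comp _ _ _ _ _ _ (@Num.sqrt R)) => //.
  by apply: continuous_measurable_fun; exact: sqrt_continuous.
by apply: measurable_funD; exact: measurable_funX.
Qed.

Lemma cmeasurable_normcE f : cmeasurable f ->
  measurable_fun setT (fun x => (normc (f x))%:E).
Proof. by move=> /cmeasurable_normc mf; exact/measurable_EFinP. Qed.

Lemma cmeasurable_sum (I : Type) (r : seq I) (P : pred I) (F : I -> X -> R[i]) :
  (forall i, P i -> cmeasurable (F i)) ->
  cmeasurable (fun x => \sum_(i <- r | P i) F i x).
Proof.
move=> mF; elim: r => [|a r IH].
  by under eq_fun do rewrite big_nil; exact: cmeasurable_cst.
under eq_fun do rewrite big_cons.
by case: (boolP (P a)) => // Pa; apply: cmeasurableD => //; exact: mF.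
Qed.

Lemma cmeasurable_comp d' (Y : measurableType d') (h : Y -> X) f :
  measurable_fun setT h -> cmeasurable f -> cmeasurable (fun y => f (h y)).
Proof.
by move=> mh [f1 f2]; split; [exact: (measurableT_comp f1 mh)|
  exact: (measurableT_comp f2 mh)].
Qed.

End complex_measurable.

Section complex_integral.
Context d (X : measurableType d) (R : realType).
Variable mu : {measure set X -> \bar R}.
Implicit Types f g : X -> R[i].

Lemma cintegrableP f : cintegrable mu f <->
  cmeasurable f /\ (\int[mu]_x (normc (f x))%:E < +oo)%E.
Proof.
split=> [[/integrableP[/measurable_EFinP m1 i1] /integrableP[/measurable_EFinP m2 i2]]|].
  split=> //.
  apply: (@le_lt_trans _ _ (\int[mu]_x (`|(Re (f x))%:E| + `|(Im (f x))%:E|))%E).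
    apply: ge0_le_integral => //.
    - by move=> x _; rewrite lee_fin normc_ge0.
    - exact: cmeasurable_normcE.
    - apply: emeasurable_funD; apply: measurableT_comp => //;
      exact/measurable_EFinP.
    - by move=> x _; rewrite /= -EFinD lee_fin normc_le_ReIm.
  rewrite ge0_integralD//; first exact: lte_add_pinfty.
  - by apply: measurableT_comp => //; exact/measurable_EFinP.
  - by apply: measurableT_comp => //; exact/measurable_EFinP.
move=> [[m1 m2] i]; split; apply/integrableP; split; try exact/measurable_EFinP.
  apply: le_lt_trans i; apply: ge0_le_integral => //.
  - by apply: measurableT_comp => //; exact/measurable_EFinP.
  - by apply: cmeasurable_normcE.
  - by move=> x _; rewrite /= lee_fin Re_le_normc.
apply: le_lt_trans i; apply: ge0_le_integral => //.
- by apply: measurableT_comp => //; exact/measurable_EFinP.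
- by apply: cmeasurable_normcE.
- by move=> x _; rewrite /= lee_fin Im_le_normc.
Qed.

Lemma cintegrable_meas f : cintegrable mu f -> cmeasurable f.
Proof. by move=> /cintegrableP[]. Qed.

Lemma cintegrableD f g : cintegrable mu f -> cintegrable mu g ->
  cintegrable mu (fun x => f x + g x).
Proof.
move=> [f1 f2] [g1 g2]; split.
  by under eq_fun do rewrite cReD EFinD; exact: integrableD.
by under eq_fun do rewrite cImD EFinD; exact: integrableD.
Qed.

Lemma cintegrableZ (c : R[i]) f : cintegrable mu f ->
  cintegrable mu (fun x => c * f x).
Proof.
move=> [f1 f2]; split.
  under eq_fun do rewrite cReM EFinB !EFinM.
  by apply: integrableB => //; exact: integrableZl.
under eq_fun do rewrite cImM EFinD !EFinM.
by apply: integrableD => //; exact: integrableZl.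
Qed.

Lemma cintegrableJ f : cintegrable mu f -> cintegrable mu (fun x => (f x)^*).
Proof.
move=> [f1 f2]; split.
  by under eq_fun do rewrite cReJ.
under eq_fun do rewrite cImJ EFinN.
by exact: integrableN.
Qed.

Lemma integrableEZl (a : R) (h : X -> R) : mu.-integrable setT (EFin \o h) ->
  mu.-integrable setT (EFin \o (fun x => a * h x)).
Proof.
move=> ih; rewrite (_ : EFin \o _ = (fun x => a%:E * (h x)%:E)%E)//.
exact: integrableZl.
Qed.

Lemma cintegralD f g : cintegrable mu f -> cintegrable mu g ->
  cintegral mu (fun x => f x + g x) = cintegral mu f + cintegral mu g.
Proof.
move=> [f1 f2] [g1 g2]; rewrite /cintegral.
under eq_Rintegral do rewrite cReD.
under [X in _ +i* X]eq_Rintegral do rewrite cImD.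
by rewrite !RintegralD.
Qed.

Lemma cintegralZ (c : R[i]) f : cintegrable mu f ->
  cintegral mu (fun x => c * f x) = c * cintegral mu f.
Proof.
move=> [f1 f2]; rewrite /cintegral.
under eq_Rintegral do rewrite cReM.
under [X in _ +i* X]eq_Rintegral do rewrite cImM.
rewrite RintegralB//; [|exact: integrableEZl..].
rewrite RintegralD//; [|exact: integrableEZl..].
by rewrite !RintegralZl//; case: c.
Qed.

Lemma cintegralJ f : cintegrable mu f ->
  cintegral mu (fun x => (f x)^*) = (cintegral mu f)^*.
Proof.
move=> [f1 f2]; rewrite /cintegral.
under eq_Rintegral do rewrite cReJ.
under [X in _ +i* X]eq_Rintegral do rewrite cImJ -mulN1r.
by rewrite RintegralZl// mulN1r.
Qed.

Lemma eq_cintegral f g : (forall x, f x = g x) -> cintegral mu f = cintegral mu g.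
Proof. by move=> fg; congr cintegral; exact/funext. Qed.

Lemma eq_cintegrable f g : (forall x, f x = g x) -> cintegrable mu f -> cintegrable mu g.
Proof. by move=> /funext ->. Qed.

Lemma cintegrable0 : cintegrable mu (fun _ : X => 0 : R[i]).
Proof. by split; exact: integrable0. Qed.

Lemma cintegral0 : cintegral mu (fun _ : X => 0 : R[i]) = 0.
Proof. by rewrite /cintegral /Rintegral/= !integral0. Qed.

Lemma cintegrable_sum (I : Type) (r : seq I) (P : pred I) (F : I -> X -> R[i]) :
  (forall i, P i -> cintegrable mu (F i)) ->
  cintegrable mu (fun x => \sum_(i <- r | P i) F i x).
Proof.
move=> iF; elim: r => [|a r IH].
  by under eq_fun do rewrite big_nil; exact: cintegrable0.
under eq_fun do rewrite big_cons.
by case: (boolP (P a)) => // Pa; apply: cintegrableD => //; exact: iF.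
Qed.

Lemma cintegral_sum (I : Type) (r : seq I) (P : pred I) (F : I -> X -> R[i]) :
  (forall i, P i -> cintegrable mu (F i)) ->
  cintegral mu (fun x => \sum_(i <- r | P i) F i x) =
  \sum_(i <- r | P i) cintegral mu (F i).
Proof.
move=> iF; elim: r => [|a r IH].
  by under eq_fun do rewrite big_nil; rewrite cintegral0 big_nil.
under eq_fun do rewrite big_cons.
rewrite big_cons; case: ifPn => // Pa; rewrite cintegralD ?IH//; first exact: iF.
exact: cintegrable_sum.
Qed.

(** With I the integral, |I|^2 is the integral of Re(I^* f), which is at most |I| times the integral
    of |f|. Dividing by |I| forces the separate case I = 0. *)
Lemma normc_cintegral f : cintegrable mu f ->
  ((normc (cintegral mu f))%:E <= \int[mu]_x (normc (f x))%:E)%E.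
Proof.
move=> intf; have [i1 i2] := intf; have [mf fi] := (cintegrableP f).1 intf.
set I := cintegral mu f.
have Nint : mu.-integrable setT (fun x => (normc (f x))%:E).
  apply/integrableP; split; first exact: cmeasurable_normcE.
  by under eq_integral do rewrite /= ger0_norm ?normc_ge0//.
have Nfin : (\int[mu]_x (normc (f x))%:E)%E \is a fin_num.
  exact: integrable_fin_num.
have [I0|I0] := eqVneq (normc I) 0.
  by rewrite I0; apply: integral_ge0 => x _; rewrite lee_fin normc_ge0.
rewrite -(fineK Nfin) lee_fin.
have Ip : 0 < normc I by rewrite lt_def I0 normc_ge0.
rewrite -(ler_pM2l Ip) -expr2 normc_sq.
rewrite -[X in normc I * X]/(\int[mu]_x (normc (f x))) -RintegralZl//.
rewrite [leLHS](_ : _ = \int[mu]_x (Re I * Re (f x) + Im I * Im (f x))); last first.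
  rewrite RintegralD//; [|exact: integrableEZl..].
  by rewrite !RintegralZl// !expr2.
apply: le_Rintegral => //.
- rewrite (_ : EFin \o _ = (fun x => (Re I)%:E * (Re (f x))%:E + (Im I)%:E * (Im (f x))%:E)%E)//.
  by apply: integrableD => //; exact: integrableZl.
- exact: integrableEZl.
- move=> x _; rewrite -normc_conjc -normcM; apply: le_trans (Re_le_normc _).
  by apply: le_trans (ler_norm _); rewrite cReM cReJ cImJ mulNr opprK.
Qed.

End complex_integral.

Section jensen.
Context d (X : measurableType d) (R : realType).
Variable mu : {measure set X -> \bar R}.
Local Open Scope ereal_scope.

(** Jensen's inequality for the measure a mu, which is not normalised; this is the origin of the
    factor (int a)^(p - 1). It is Hoelder's inequality for a^(1/q) and a^(1/p) b, with q the
    exponent conjugate to p, raised to the power p. *)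
Lemma integral_mul_powR_le (p : R) (a b : X -> R) : (1 < p)%R ->
  measurable_fun setT a -> measurable_fun setT b ->
  (forall x, 0 <= a x)%R -> (forall x, 0 <= b x)%R ->
  \int[mu]_x (a x)%:E < +oo ->
  (\int[mu]_x (a x * b x)%:E) `^ p <=
  (\int[mu]_x (a x)%:E) `^ (p - 1) * \int[mu]_x (a x * b x `^ p)%:E.
Proof.
move=> p1 ma mb a0 b0 afin.
have p0 : (0 < p)%R by rewrite (lt_trans ltr01).
pose q := (1 - p^-1)^-1%R.
have ip1 : (p^-1 < 1)%R by rewrite invf_lt1.
have iq0 : (0 < 1 - p^-1)%R by rewrite subr_gt0.
have q0 : (0 < q)%R by rewrite /q invr_gt0.
have pq : (q^-1 + p^-1 = 1)%R by rewrite /q invrK subrK.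
pose f x := (a x `^ q^-1)%R; pose g x := (a x `^ p^-1 * b x)%R.
have mf : measurable_fun setT f.
  exact: (measurableT_comp (measurable_powR q^-1)).
have mg : measurable_fun setT g.
  apply: measurable_funM => //.
  exact: (measurableT_comp (measurable_powR p^-1)).
have fg x : (f x * g x = a x * b x)%R.
  rewrite /f /g mulrA -powRD; first by rewrite pq powRr1.
  by rewrite pq oner_eq0.
have := @hoelder _ X R mu f g q p mf mg q0 p0 pq.
have -> : 'N[mu]_1[EFin \o (f \* g)%R] = \int[mu]_x (a x * b x)%:E.
  rewrite Lnorm1; apply: eq_integral => x _ /=.
  by rewrite fg ger0_norm// mulr_ge0.
have -> : 'N[mu]_q%:E[EFin \o f] = (\int[mu]_x (a x)%:E) `^ q^-1.
  rewrite unlock /=; congr (_ `^ _); apply: eq_integral => x _ /=.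
  rewrite ger0_norm ?powR_ge0// /f -powRrM mulVf ?gt_eqF//.
  by rewrite powRr1.
have -> : 'N[mu]_p%:E[EFin \o g] = (\int[mu]_x (a x * b x `^ p)%:E) `^ p^-1.
  rewrite unlock /=; congr (_ `^ _); apply: eq_integral => x _ /=.
  rewrite ger0_norm ?mulr_ge0 ?powR_ge0// /g powRM ?powR_ge0//.
  by rewrite -powRrM mulVf ?gt_eqF// powRr1.
have I0 : 0 <= \int[mu]_x (a x * b x)%:E.
  by apply: integral_ge0 => x _; rewrite lee_fin mulr_ge0.
have A0 : 0 <= \int[mu]_x (a x)%:E.
  by apply: integral_ge0 => x _; rewrite lee_fin.
have B0 : 0 <= \int[mu]_x (a x * b x `^ p)%:E.
  by apply: integral_ge0 => x _; rewrite lee_fin mulr_ge0// powR_ge0.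
move=> H.
have := gt0_ler_poweR (ltW p0) _ _ H.
rewrite !in_itv/= !leey I0 mule_ge0 ?poweR_ge0// => /(_ erefl erefl).
rewrite poweRM ?poweR_ge0// -!poweRrM mulVf ?gt_eqF// poweRe1//.
suff -> : (q^-1 * p = p - 1)%R by [].
by rewrite /q invrK mulrBl mul1r mulVf ?gt_eqF.
Qed.

End jensen.

(** * Parameter integrals and Fubini for complex integrands *)

Section param_integral.
Context d1 d2 (X : measurableType d1) (Y : measurableType d2) (R : realType).

(** The inner integral is [fine] of a difference of two Tonelli integrals, each measurable in the
    parameter. Since no convergence is involved, every [stft] is measurable outright. *)
Lemma measurable_Rintegral_param (m2 : {sigma_finite_measure set Y -> \bar R})
    (f : X * Y -> R) : measurable_fun setT f ->
  measurable_fun setT (fun x => \int[m2]_y f (x, y)).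
Proof.
move=> mf; rewrite /Rintegral.
have mF : measurable_fun setT (EFin \o f) by exact/measurable_EFinP.
apply: (measurableT_comp (@fine_measurable R setT measurableT)).
rewrite (_ : (fun x => _) = (fun x => (\int[m2]_y (EFin \o f)^\+ (x, y)) -
    (\int[m2]_y (EFin \o f)^\- (x, y)))%E); last first.
  apply/funext => x; rewrite integralE; congr (_ - _)%E.
    by apply: eq_integral => y _; rewrite !funeposE.
  by apply: eq_integral => y _; rewrite !funenegE.
apply: emeasurable_funB.
  apply: (measurable_fun_fubini_tonelli_F (EFin \o f)^\+%E) => //.
  exact: measurable_funepos.
apply: (measurable_fun_fubini_tonelli_F (EFin \o f)^\-%E) => //.
exact: measurable_funeneg.
Qed.

Lemma cmeasurable_param (m2 : {sigma_finite_measure set Y -> \bar R})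
    (f : X * Y -> R[i]) : cmeasurable f ->
  cmeasurable (fun x => cintegral m2 (fun y => f (x, y))).
Proof.
move=> [f1 f2]; split.
  exact: (@measurable_Rintegral_param m2 (fun z => Re (f z))).
exact: (@measurable_Rintegral_param m2 (fun z => Im (f z))).
Qed.

End param_integral.

Section fubini.
Context d1 d2 (X : measurableType d1) (Y : measurableType d2) (R : realType).

Lemma cmeasurable_swap (f : X * Y -> R[i]) : cmeasurable f ->
  cmeasurable (fun z : Y * X => f (z.2, z.1)).
Proof.
apply: (@cmeasurable_comp _ _ _ _ _ (fun z : Y * X => (z.2, z.1))).
exact: measurable_fun_pair.
Qed.

Lemma cmeasurable_pair1 (f : X * Y -> R[i]) x : cmeasurable f ->
  cmeasurable (fun y => f (x, y)).
Proof.
by apply: (@cmeasurable_comp _ _ _ _ _ (fun y : Y => (x, y))); exact: measurable_fun_pair.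
Qed.

Variables (m1 : {sigma_finite_measure set X -> \bar R})
          (m2 : {sigma_finite_measure set Y -> \bar R}).

Lemma Rintegral12 (f : X * Y -> R) :
  (m1 \x m2)%E.-integrable setT (EFin \o f) ->
  m1.-integrable setT (EFin \o (fun x => \int[m2]_y f (x, y))) /\
  \int[m1]_x (\int[m2]_y f (x, y)) = \int[(m1 \x m2)%E]_z f z.
Proof.
move=> fi.
have iF := integrable_fubini_F fi.
(* [fine] replaces an infinite inner integral by 0, so the real-valued and the extended inner
   integrals agree only where the section is integrable, that is almost everywhere. *)
have ae : {ae m1, forall x, setT x ->
    (\int[m2]_y f (x, y))%:E = fubini_F m2 (EFin \o f) x}.
  have := ae_integrable1 fi; apply: filterS => x ix _.
  by rewrite /Rintegral fineK//; exact: integrable_fin_num.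
have mF : measurable_fun setT (fun x => (\int[m2]_y f (x, y))%:E).
  apply/measurable_EFinP; apply: measurable_Rintegral_param.
  by have /integrableP[/measurable_EFinP] := fi.
have iF' : m1.-integrable setT (EFin \o (fun x => \int[m2]_y f (x, y))).
  apply/integrableP; split=> //.
  have /integrableP[m i] := iF.
  rewrite (ae_eq_integral (fun x => `|fubini_F m2 (EFin \o f) x|)%E)//.
  - exact: measurableT_comp.
  - exact: measurableT_comp.
  - by move: ae; apply: filterS => x /(_ I) + _ => <-.
split=> //.
rewrite {1}/Rintegral.
rewrite (ae_eq_integral (fubini_F m2 (EFin \o f)))//; last by have /integrableP[] := iF.
by rewrite integral12_prod_meas1.
Qed.

Lemma Rintegral21 (f : X * Y -> R) :
  (m1 \x m2)%E.-integrable setT (EFin \o f) ->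
  \int[m2]_y (\int[m1]_x f (x, y)) = \int[(m1 \x m2)%E]_z f z.
Proof.
move=> fi.
have ae : {ae m2, forall y, setT y ->
    (\int[m1]_x f (x, y))%:E = fubini_G m1 (EFin \o f) y}.
  have := ae_integrable2 fi; apply: filterS => y iy _.
  by rewrite /Rintegral fineK//; exact: integrable_fin_num.
have mf : measurable_fun setT f by have /integrableP[/measurable_EFinP] := fi.
rewrite {1}/Rintegral.
rewrite (ae_eq_integral (fubini_G m1 (EFin \o f)))//.
- by rewrite integral21_prod_meas1.
- apply/measurable_EFinP.
  apply: (@measurable_Rintegral_param _ _ Y X R m1 (fun z => f (z.2, z.1))).
  by apply: (measurableT_comp mf); exact: measurable_fun_pair.
- exact: measurable_fubini_G fi.
Qed.

Lemma cfubini (f : X * Y -> R[i]) : cintegrable (m1 \x m2)%E f ->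
  [/\ cintegrable m1 (fun x => cintegral m2 (fun y => f (x, y))),
     cintegral m1 (fun x => cintegral m2 (fun y => f (x, y))) =
       cintegral (m1 \x m2)%E f &
     cintegral m2 (fun y => cintegral m1 (fun x => f (x, y))) =
       cintegral (m1 \x m2)%E f].
Proof.
move=> [f1 f2].
have [i1 e1] := Rintegral12 f1; have [i2 e2] := Rintegral12 f2.
by split=> //; rewrite /cintegral/= ?e1 ?e2 ?(Rintegral21 f1) ?(Rintegral21 f2).
Qed.

Lemma cintegrable12 (f : X * Y -> R[i]) : cmeasurable f ->
  (\int[m1]_x \int[m2]_y (normc (f (x, y)))%:E < +oo)%E ->
  cintegrable (m1 \x m2)%E f.
Proof.
move=> mf fi; apply/cintegrableP; split=> //.
rewrite (fubini_tonelli1 (fun z => (normc (f z))%:E))//.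
  exact: cmeasurable_normcE.
by move=> z; rewrite lee_fin normc_ge0.
Qed.

Lemma cintegrable21 (f : X * Y -> R[i]) : cmeasurable f ->
  (\int[m2]_y \int[m1]_x (normc (f (x, y)))%:E < +oo)%E ->
  cintegrable (m1 \x m2)%E f.
Proof.
move=> mf fi; apply/cintegrableP; split=> //.
rewrite (fubini_tonelli2 (fun z => (normc (f z))%:E))//.
  exact: cmeasurable_normcE.
by move=> z; rewrite lee_fin normc_ge0.
Qed.

End fubini.

(** * The lattice and the torus *)

Section lattice.
Context (R : realType) (n : nat).
Local Notation Z := (Zn n).

Lemma measurable_fun_Zn d (Y : measurableType d) (D : set Z) (f : Z -> Y) :
  measurable_fun D f.
Proof. by move=> _ A mA. Qed.

Lemma cmeasurable_Zn (f : Z -> R[i]) : cmeasurable f.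
Proof. by split; exact: measurable_fun_Zn. Qed.

(** Each preimage is a countable union of slices over the points of the lattice, so measurability in
    the second variable is enough. *)
Lemma measurable_fun_ZnX d (X : measurableType d) d' (Y : measurableType d')
    (f : Z * X -> Y) :
  (forall k, measurable_fun setT (fun x => f (k, x))) -> measurable_fun setT f.
Proof.
move=> mf _ A mA; rewrite setTI.
rewrite (_ : f @^-1` A = \bigcup_(k : Z)
    ([set k] `*` ((fun x => f (k, x)) @^-1` A))); last first.
  apply/seteqP; split=> [[k x] /= fA|[k x] /= [j _ /= [-> ]]//].
  by exists k.
apply: countable_bigcupT_measurable => [|k]; first exact: countableP.
by apply: measurableX => //; rewrite -[X in measurable X]setTI; exact: mf.
Qed.

Lemma cmeasurable_ZnX d (X : measurableType d) (f : Z * X -> R[i]) :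
  (forall k, cmeasurable (fun x => f (k, x))) -> cmeasurable f.
Proof. by move=> mf; split; apply: measurable_fun_ZnX => k; case: (mf k). Qed.

(** [pickle] cuts Z^n into countably many fibres of at most one point, and the integral is additive
    over this partition. The [esum] form gives access to reindexing by bijections and to suprema of
    finite sums. *)
Lemma integral_countZ (f : Z -> \bar R) : (forall k, 0 <= f k)%E ->
  (\int[countZ R n]_k f k = \esum_(k in [set: Z]) f k)%E.
Proof.
move=> f0; pose F N := [set k : Z | pickle k = N].
have FT : \bigcup_N F N = [set: Z].
  by apply/seteqP; split=> // k _; exists (pickle k).
have tF : trivIset setT F by move=> i j _ _ [k [/= <- <-]].
rewrite -FT esum_bigcupT// ge0_integral_bigcup//.
rewrite nneseries_esumT; last by move=> N; exact: integral_ge0.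
apply: eq_esum => N _.
have [[k Fk]|nF] := pselect (exists k, F N k).
  have -> : F N = [set k].
    apply/seteqP; split=> [j Fj|_ ->//].
    by apply: (pcan_inj (@pickleK _)); rewrite Fj Fk.
  rewrite esum_set1// (eq_integral (cst (f k))); last first.
    by move=> x; rewrite inE => ->.
  by rewrite integral_cst//= /countZ /counting asboolT//= fset_set1 finmap.cardfs1 mule1.
have -> : F N = set0.
  by rewrite -subset0 => k Fk; apply: nF; exists k.
by rewrite esum_set0 integral_set0.
Qed.

Lemma le_integral_countZ (f : Z -> \bar R) k : (forall k, 0 <= f k)%E ->
  (f k <= \int[countZ R n]_k f k)%E.
Proof.
move=> f0; rewrite integral_countZ//; apply: esum_ge.
by exists [set k]; [split|rewrite fsbig_set1].
Qed.

Lemma integral_countZ_bij (e : Z -> Z) (f : Z -> \bar R) :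
  (forall k, 0 <= f k)%E -> bijective e ->
  (\int[countZ R n]_k f (e k) = \int[countZ R n]_k f k)%E.
Proof.
move=> f0 [e' eK e'K]; rewrite !integral_countZ//.
apply/esym/(@reindex_esum _ _ _ _ _ e); split=> //.
- by move=> x y _ _; exact: (can_inj eK).
- by move=> y _; exists (e' y).
Qed.

Lemma integral_countZ_shift (m : Z) (f : Z -> \bar R) : (forall k, 0 <= f k)%E ->
  (\int[countZ R n]_k f (k - m)%R = \int[countZ R n]_k f k)%E.
Proof.
move=> f0; apply: (@integral_countZ_bij (fun k => k - m)) => //.
by exists (fun k => k + m) => k; [exact: subrK|exact: addrK].
Qed.

Lemma integral_countZ_shift' (m : Z) (f : Z -> \bar R) : (forall k, 0 <= f k)%E ->
  (\int[countZ R n]_k f (m + k)%R = \int[countZ R n]_k f k)%E.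
Proof.
move=> f0; apply: (@integral_countZ_bij (fun k => m + k)) => //.
Qed.

Lemma Rintegral_countZ_single (k0 : Z) (a : R) :
  \int[countZ R n]_k (if k == k0 then a else 0) = a.
Proof.
rewrite (_ : (fun k => _) = (cst a) \_ [set k0]); last first.
  apply/funext => k; rewrite patchE; case: eqVneq => [->|kk0].
    by rewrite mem_set.
  by rewrite memNset// => /= /eqP; rewrite (negbTE kk0).
rewrite -Rintegral_mkcond Rintegral_cst//=.
by rewrite /countZ /counting asboolT//= fset_set1 finmap.cardfs1 mulr1.
Qed.

Lemma cintegral_countZ_single (k0 : Z) (f : Z -> R[i]) :
  (forall k, k != k0 -> f k = 0) -> cintegral (countZ R n) f = f k0.
Proof.
move=> f0; rewrite /cintegral.
have fE k : f k = if k == k0 then f k0 else 0.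
  by case: eqVneq => [->//|/f0].
under eq_Rintegral do rewrite fE (fun_if (@complex.Re R))/=.
under [X in _ +i* X]eq_Rintegral do rewrite fE (fun_if (@complex.Im R))/=.
by rewrite !Rintegral_countZ_single; case: (f k0).
Qed.

Lemma weight_ge1 N (k : Z) : 1 <= weight R N k.
Proof. by rewrite /weight exprn_ege1// lerDl sumr_ge0. Qed.

Lemma weight_gt0 N (k : Z) : 0 < weight R N k.
Proof. by rewrite (lt_le_trans ltr01)// weight_ge1. Qed.

(** From 1 + |j + k| <= (1 + |j|)(1 + |k|). This moves a weight across a lattice translation at the
    price of a constant depending on the shift. *)
Lemma weightD N (j k : Z) : weight R N (j + k) <= weight R N j * weight R N k.
Proof.
rewrite /weight -exprMn lerXn2r ?nnegrE ?mulr_ge0 ?addr_ge0 ?sumr_ge0//.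
rewrite mulrDl mulrDr mulrDr !mul1r !mulr1 -addrA lerD2l.
apply: (@le_trans _ _ (\sum_(i < n) `|(k ord0 i)%:~R : R| + \sum_(i < n) `|(j ord0 i)%:~R : R|)).
  rewrite -big_split/=; apply: ler_sum => i _.
  by rewrite mxE rmorphD/= addrC ler_normD.
by rewrite lerD2l lerDl mulr_ge0// sumr_ge0.
Qed.

Lemma weight_le N M (k : Z) : (N <= M)%N -> weight R N k <= weight R M k.
Proof. by move=> NM; rewrite /weight ler_weXn2l// lerDl sumr_ge0. Qed.

Let h (t : nat) : R := ((1 + t%:R) ^+ 2)^-1.

(** The sum runs over the integers of [-r, r]. The term 2 / (r + 1) strengthens the bound by 4 so
    that induction closes: the two new terms add 2 / (r + 2)^2, at most 2 / (r + 1) - 2 / (r +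
    2). *)
Let sum_h (r : nat) :
  \sum_(j < r.*2.+1) h `|(j : int) - (r : int)|%N <= 4 - 2 / (r%:R + 1).
Proof.
elim: r => [|r IH].
  rewrite big_ord1/= addn0 /h addr0 expr1n invr1 add0r divr1; lra.
rewrite doubleS big_ord_recl big_ord_recr.
rewrite (eq_bigr (fun j : 'I_r.*2.+1 => h `|(j : int) - (r : int)|%N)); last first.
  by move=> j _; congr (h _); rewrite lift0 /=; lia.
rewrite (_ : `|(@ord0 r.*2.+2 : int) - (r.+1 : int)|%N = r.+1); last by rewrite /=; lia.
rewrite (_ : `|(lift ord0 ord_max : 'I_r.*2.+3) - (r.+1 : int)|%N = r.+1); last first.
  by rewrite lift0/=; lia.
rewrite /=.
have : 2 * h r.+1 <= 2 / (r%:R + 1) - 2 / (r.+1%:R + 1).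
  rewrite /h -[r.+1%:R]natr1.
  have r0 : 0 <= r%:R :> R by [].
  set x : R := r%:R in r0 *.
  rewrite (_ : 2 / (x + 1) - 2 / (x + 1 + 1) = 2 * ((x + 1) * (x + 2))^-1); last first.
    by field; apply/andP; split; lra.
  rewrite ler_pM2l// lef_pV2 ?posrE; nra.
by move: IH; lra.
Qed.

(** The exponent 2n leaves two powers for each coordinate: (1 + sum |k_i|)^(2n) dominates the
    product of the (1 + |k_i|)^2. Sums over a cube then factor into n one-dimensional sums, each at
    most 4. *)
Lemma weight_summable : exists C : R,
  (\int[countZ R n]_k ((weight R n.*2 k)^-1)%:E <= C%:E)%E.
Proof.
exists (4 ^+ n); rewrite integral_countZ; last first.
  by move=> k; rewrite lee_fin invr_ge0 ltW// weight_gt0.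
apply: ge_ereal_sup => _ [A [finA _] <-].
rewrite fsbig_finite//=; set S : seq Z := finmap.enum_fset (fset_set A); rewrite sumEFin lee_fin.
(* The finite set S lies in the cube [-r, r]^n, whose points are coded by functions into
   ['I_r.*2.+1] through a translation by r; over these the sum of products distributes. *)
pose r := (\max_(k <- S) \max_(i < n) `|k ord0 i|%N)%N.
pose psi (f : {ffun 'I_n -> 'I_r.*2.+1}) : Z := \row_i ((f i : int) - (r : int)).
pose theta (k : Z) : {ffun 'I_n -> 'I_r.*2.+1} :=
  [ffun i => inord (absz (k ord0 i + (r : int)))].
have thetaK k : k \in S -> psi (theta k) = k.
  move=> kS; apply/rowP => i; rewrite mxE ffunE.
  have kr : (`|k ord0 i| <= r)%N.
    apply: leq_trans (leq_bigmax_seq _ kS _) => //.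
    exact: (leq_bigmax i).
  rewrite inordK; last by rewrite ltnS -addnn; lia.
  by move: kr; rewrite -[RHS]/(k ord0 i); move: (k ord0 i) => t; lia.
rewrite (eq_big_seq (fun k => (weight R n.*2 (psi (theta k)))^-1)); last first.
  by move=> k kS; rewrite thetaK.
rewrite -(big_map theta xpredT (fun f => (weight R n.*2 (psi f))^-1)).
have uS : uniq (map theta S).
  rewrite map_inj_in_uniq ?finmap.fset_uniq// => x y xS yS xy.
  by rewrite -(thetaK x xS) xy thetaK.
rewrite big_uniq//=.
apply: (@le_trans _ _ (\sum_(f : {ffun 'I_n -> 'I_r.*2.+1})
    \prod_(i < n) h `|(f i : int) - (r : int)|%N)).
  rewrite big_mkcond/=; apply: ler_sum => f _.
  have p0 : 0 <= \prod_(i < n) h `|(f i : int) - (r : int)|%N.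
    by apply: prodr_ge0 => i _; rewrite invr_ge0 sqr_ge0.
  case: ifPn => // _; rewrite -muln2 /weight mulnC exprM /h prodfV.
  rewrite lef_pV2 ?posrE//; last 2 first.
  - by rewrite exprn_gt0// exprn_gt0// ltr_wpDr// sumr_ge0.
  - by apply: prodr_gt0 => i _; rewrite exprn_gt0// ltr_wpDr.
  rewrite -[X in _ <= _ ^+ X]card_ord -prodr_const.
  apply: ler_prod => i _; rewrite sqr_ge0/= lerXn2r ?nnegrE ?addr_ge0 ?sumr_ge0//.
  rewrite lerD2l (bigD1 i)//= mxE.
  rewrite -(intr_norm R) -abszE lerDl sumr_ge0//.
rewrite -(bigA_distr_bigA (fun (i : 'I_n) (j : 'I_r.*2.+1) => h `|(j : int) - (r : int)|%N)).
rewrite prodr_const card_ord lerXn2r ?nnegrE ?sumr_ge0//.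
- by move=> i _; rewrite invr_ge0 sqr_ge0.
- apply: (le_trans (sum_h r)); rewrite gerBl divr_ge0// addr_ge0//.
Qed.

End lattice.

Section finite_integrable.
Context d (X : measurableType d) (R : realType) (P : probability X R).

Lemma integral_probability_cst (r : \bar R) : (\int[P]_x r = r)%E.
Proof.
have PT : (P [set: X] = 1)%E by exact: probability_setT.
have E : (r * P [set: X] = r)%E by rewrite PT mule1.
by rewrite -[RHS]E; exact: integral_cst.
Qed.

Lemma integrable_bounded (f : X -> R) B : measurable_fun setT f ->
  (forall x, `|f x| <= B) -> P.-integrable setT (EFin \o f).
Proof.
move=> mf fB; apply/integrableP; split; first exact/measurable_EFinP.
apply: (@le_lt_trans _ _ (\int[P]_x B%:E)%E).
  apply: ge0_le_integral => //.
  - by apply: measurableT_comp => //; exact/measurable_EFinP.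
  - by move=> x _; rewrite /= lee_fin.
by rewrite integral_probability_cst ltry.
Qed.

Lemma cintegrable_bounded (f : X -> R[i]) B : cmeasurable f ->
  (forall x, normc (f x) <= B) -> cintegrable P f.
Proof.
move=> [m1 m2] fB; split.
  by apply: (@integrable_bounded _ B m1) => x; rewrite (le_trans (Re_le_normc _)).
by apply: (@integrable_bounded _ B m2) => x; rewrite (le_trans (Im_le_normc _)).
Qed.

Lemma cintegral_cst (c : R[i]) : cintegral P (fun _ => c) = c.
Proof.
have PT : (P [set: X] = 1)%E by exact: probability_setT.
have h r : r * fine (P [set: X]) = r by rewrite PT mulr1.
by rewrite /cintegral !Rintegral_cst// [X in X +i* _]h [X in _ +i* X]h; case: c.
Qed.

End finite_integrable.

(** * Haar measure: coordinatewise integration and orthogonality of characters *)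

Section haar_integral.
Context (R : realType).

Lemma Rintegral_uniform01 (f : R -> R) :
  measurable_fun [set: measurableTypeR R] f ->
  \int[uniform_prob (@ltr01 R)]_t f t = \int[lebesgue_measure]_(t in `[0, 1]) f t.
Proof.
move=> mf; rewrite /Rintegral; congr fine.
rewrite integralE [in RHS]integralE.
have mF : measurable_fun [set: measurableTypeR R] (EFin \o f) by exact/measurable_EFinP.
by rewrite !integral_uniform ?subr0 ?invr1 ?mul1e//;
  [exact: measurable_funeneg|exact: measurable_funepos].
Qed.

Lemma haarS (n : nat) (f : Tn R n.+1 -> R) B : measurable_fun setT f ->
  (forall w, `|f w| <= B) ->
  (uniform_prob (@ltr01 R) \x haar R n)%E.-integrable setT
     (EFin \o (f \o @Tn_cons R n)) /\
  \int[haar R n.+1]_w f w =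
  \int[(uniform_prob (@ltr01 R) \x haar R n)%E]_z f (Tn_cons z).
Proof.
move=> mf fB.
have fi : (uniform_prob (@ltr01 R) \x haar R n)%E.-integrable setT
     (EFin \o (f \o @Tn_cons R n)).
  apply: (@integrable_bounded _ _ _ _ _ B) => [|x]; last exact: fB.
  by apply: (measurableT_comp mf); exact: measurable_funPT.
split=> //.
rewrite /Rintegral /=; congr fine.
by rewrite integral_distribution//; exact/measurable_EFinP.
Qed.

Definition ebase n (i : 'I_n) : Tn R n := delta_mx ord0 i.

Lemma Tn_cons0 n t (w : Tn R n) :
  Tn_cons (t, w) = Tn_cons (0, w) + t *: ebase ord0.
Proof.
apply/rowP => i; rewrite !mxE.
case: splitP => j /= ij; rewrite ?mxE.
  rewrite !ord1 eqxx mulr1n mul0rn add0r.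
  suff -> : i == ord0 by rewrite mulr1.
  by apply/eqP/val_inj; rewrite /= ij ord1.
suff -> : (i == ord0) = false by rewrite mulr0 addr0.
by apply/eqP => i0; move: ij; rewrite i0.
Qed.

Lemma Tn_cons_lift n t (w : Tn R n) s (i : 'I_n) :
  Tn_cons (t, w + s *: ebase i) =
  Tn_cons (t, w) + s *: ebase (lift ord0 i).
Proof.
apply/rowP => j; rewrite !mxE.
case: splitP => k /= jk; rewrite ?mxE.
  suff -> : (j == lift ord0 i) = false by rewrite mulr0 addr0.
  by apply/eqP => /(congr1 val)/=; rewrite jk ord1.
suff -> : (j == lift ord0 i) = (k == i) by rewrite eqxx.
by rewrite -!val_eqE /= jk /bump/= add1n eqSS.
Qed.

(** The fundamental theorem of calculus along one circle. The hypotheses concern only lines in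
    direction i, so they survive freezing another coordinate, and the induction can follow the
    recursive construction of [haar]. *)
Lemma haar_partial0 n (i : 'I_n) (G g : Tn R n -> R) (B : R) :
  (forall (w : Tn R n) (t : R), is_derive t 1
     (fun s : R => G (w + s *: ebase i)) (g (w + t *: ebase i))) ->
  (forall w : Tn R n, continuous (fun s : R => g (w + s *: ebase i))) ->
  (forall w : Tn R n, G (w + ebase i) = G w) ->
  measurable_fun setT g -> (forall w, `|g w| <= B) ->
  \int[haar R n]_w g w = 0.
Proof.
elim: n i G g B => [[]//|n IH] i G g B dG cg pG mg gB.
have [gi ->] := haarS mg gB.
have mgc t : measurable_fun setT (fun w => g (Tn_cons (t, w))).
  have mc : measurable_fun setT (@Tn_cons R n) by exact: measurable_funPT.
  apply: (measurableT_comp mg).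
  by apply: (measurableT_comp mc); exact: measurable_fun_pair.
have mgc' w : measurable_fun [set: measurableTypeR R] (fun t => g (Tn_cons (t, w))).
  have mc : measurable_fun setT (@Tn_cons R n) by exact: measurable_funPT.
  apply: (measurableT_comp mg).
  by apply: (measurableT_comp mc); exact: measurable_fun_pair.
(* When i is not the first coordinate, the first one is frozen and the induction hypothesis kills
   the inner integral. Otherwise the order of integration is swapped and the first coordinate is
   integrated over [0, 1]. *)
have [j ij|i0] := unliftP ord0 i.
  have [_ <-] := Rintegral12 gi.
  rewrite (@eq_Rintegral _ _ _ _ _ (cst 0)); first by rewrite Rintegral_cst// mul0r.
  move=> t _ /=.
  apply: (IH j (fun w => G (Tn_cons (t, w))) _ B) => //.
  - move=> w s; rewrite Tn_cons_lift -ij.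
    rewrite (_ : (fun s => _) = (fun s => G (Tn_cons (t, w) + s *: ebase i))).
      exact: dG.
    by apply/funext => s'; rewrite Tn_cons_lift ij.
  - move=> w.
    rewrite (_ : (fun s => _) = (fun s => g (Tn_cons (t, w) + s *: ebase i))).
      exact: cg.
    by apply/funext => s'; rewrite Tn_cons_lift ij.
  - move=> w; rewrite -[ebase _]scale1r Tn_cons_lift scale1r -ij.
    exact: pG.
have <- := Rintegral21 gi.
rewrite (@eq_Rintegral _ _ _ _ _ (cst 0)); first by rewrite Rintegral_cst// mul0r.
move=> w _ /=; rewrite Rintegral_uniform01//.
pose w0 := Tn_cons (0, w).
have dG0 := dG w0; have cg0 := cg w0.
rewrite i0 in dG0 cg0.
have -> : (fun t => g (Tn_cons (t, w))) = (fun t => g (w0 + t *: ebase ord0)).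
  by apply/funext => t; rewrite Tn_cons0.
(* The integral is the difference of the values of G at the two ends of the segment, which agree by
   periodicity. *)
rewrite /Rintegral (@continuous_FTC2 _ _ (fun t => G (w0 + t *: ebase ord0)))//.
- by rewrite scale0r addr0 scale1r -i0 pG subee.
- exact: continuous_subspaceT.
- split=> [t _||].
  + by apply: ex_derive.
  + apply: cvg_at_right_filter; apply: differentiable_continuous.
    by apply/derivable1_diffP; exact: ex_derive.
  + apply: cvg_at_left_filter; apply: differentiable_continuous.
    by apply/derivable1_diffP; exact: ex_derive.
- move=> t _; rewrite derive1E; exact: derive_val.
Qed.

Definition cdiff n (f : Tn R n -> R[i]) (w : Tn R n) :=
  differentiable (fun v => Re (f v)) w /\ differentiable (fun v => Im (f v)) w.

Lemma is_derive_line n (f : Tn R n -> R) (w v : Tn R n) (t : R) :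
  derivable f (w + t *: v) v ->
  is_derive t 1 (fun s : R => f (w + s *: v)) ('D_v f (w + t *: v)).
Proof.
move=> df.
have E : (fun h : R => h^-1 *: (((fun s : R => f (w + s *: v)) \o shift t) (h *: (1 : R)) -
           f (w + t *: v))) =
   (fun h : R => h^-1 *: ((f \o shift (w + t *: v)) (h *: v) - f (w + t *: v))).
  apply/funext => h /=; congr (_ *: (f _ - _)).
  by rewrite [h *: 1]mulr1 scalerDl addrCA.
split; first by rewrite /derivable E; exact: df.
by rewrite /derive E.
Qed.

Lemma e2piD (s t : R) : e2pi (s + t) = e2pi s * e2pi t.
Proof.
rewrite /e2pi mulrDr cosD sinD; apply: complexP; rewrite ?cReM ?cImM//=.
by rewrite addrC.
Qed.

Lemma e2pi0 : e2pi (0 : R) = 1.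
Proof. by rewrite /e2pi mulr0 cos0 sin0. Qed.

Lemma normc_e2pi (t : R) : normc (e2pi t) = 1.
Proof. by rewrite normc_ReIm/= cos2Dsin2 sqrtr1. Qed.

Lemma e2piN (t : R) : e2pi (- t) = (e2pi t)^*.
Proof. by rewrite /e2pi mulrN cosN sinN. Qed.

Lemma e2pi_int (z : int) : e2pi (z%:~R : R) = 1.
Proof.
have nat_case (m : nat) : e2pi (m%:R : R) = 1.
  elim: m => [|m IH]; first exact: e2pi0.
  rewrite -natr1 e2piD IH mul1r /e2pi mulr1 mulr_natl cos2pi.
  by rewrite -[pi *+ 2]add0r sinD2pi sin0.
case: z => m; first exact: nat_case.
rewrite NegzE mulrNz e2piN nat_case.
by apply: complexP => //=; rewrite oppr0.
Qed.

Lemma measurable_dot n (k : Zn n) :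
  measurable_fun [set: Tn R n] (fun w => dot w k).
Proof.
apply: measurable_sum => i; apply: measurable_funM => //.
exact: measurable_Tn_coord.
Qed.

Lemma cmeasurable_e2pi d (X : measurableType d) (f : X -> R) :
  measurable_fun setT f -> cmeasurable (fun x => e2pi (f x)).
Proof.
move=> mf; split=> /=.
  apply: (@measurableT_comp _ _ _ _ _ _ (@cos R)).
    by apply: continuous_measurable_fun; exact: continuous_cos.
  exact: measurable_funM.
apply: (@measurableT_comp _ _ _ _ _ _ (@sin R)).
  by apply: continuous_measurable_fun; exact: continuous_sin.
exact: measurable_funM.
Qed.

Lemma cmeasurable_echar n (k : Zn n) :
  cmeasurable (fun w : Tn R n => e2pi (dot w k)).
Proof. by apply: cmeasurable_e2pi; exact: measurable_dot. Qed.

Lemma dotDl n (w v : Tn R n) (k : Zn n) : dot (w + v) k = dot w k + dot v k.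
Proof. by rewrite /dot -big_split; apply: eq_bigr => i _; rewrite mxE mulrDl. Qed.

Lemma dotDr n (w : Tn R n) (k l : Zn n) : dot w (k + l) = dot w k + dot w l.
Proof.
by rewrite /dot -big_split; apply: eq_bigr => i _; rewrite mxE rmorphD mulrDr.
Qed.

Lemma dotNr n (w : Tn R n) (k : Zn n) : dot w (- k) = - dot w k.
Proof.
rewrite /dot -sumrN; apply: eq_bigr => i _.
by rewrite mxE rmorphN mulrN.
Qed.

Lemma dotNl n (w : Tn R n) (k : Zn n) : dot (- w) k = - dot w k.
Proof. by rewrite /dot -sumrN; apply: eq_bigr => i _; rewrite mxE mulNr. Qed.

Lemma dotZl n (t : R) (w : Tn R n) (k : Zn n) : dot (t *: w) k = t * dot w k.
Proof. by rewrite /dot mulr_sumr; apply: eq_bigr => i _; rewrite mxE mulrA. Qed.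

Lemma dot0r n (w : Tn R n) : dot w 0 = 0.
Proof. by rewrite /dot big1// => i _; rewrite mxE mulr0. Qed.

Lemma dot_ebase n (i : 'I_n) (k : Zn n) : dot (ebase i) k = (k ord0 i)%:~R.
Proof.
rewrite /dot (bigD1 i)//= big1 ?addr0; first by rewrite mxE !eqxx mul1r.
by move=> j ji; rewrite mxE (negbTE ji) andbF mul0r.
Qed.

Lemma dot_int n (j k : Zn n) : dot (map_mx intr j : Tn R n) k =
  (\sum_(i < n) j ord0 i * k ord0 i)%:~R.
Proof.
rewrite /dot rmorph_sum/=; apply: eq_bigr => i _.
by rewrite mxE rmorphM.
Qed.

Lemma ebase_int n (i : 'I_n) :
  ebase i = map_mx intr (delta_mx ord0 i : 'rV[int]_n) :> Tn R n.
Proof. by apply/rowP => j; rewrite !mxE; case: (_ && _). Qed.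

Lemma is_derive_char (a b t : R) :
  is_derive t 1 (fun s : R => cos (2 * pi * (a + s * b))) (- (2 * pi * b) * sin (2 * pi * (a + t * b))) /\
  is_derive t 1 (fun s : R => sin (2 * pi * (a + s * b))) ((2 * pi * b) * cos (2 * pi * (a + t * b))).
Proof.
have dl : is_derive t 1 (fun s : R => 2 * pi * (a + s * b)) (2 * pi * b).
  rewrite (_ : (fun s : R => _) = (2 * pi : R) \*: (cst a + b \*: id)); last first.
    apply/funext => s; rewrite /= ?fctE /=.
    by rewrite [b *: s]mulrC.
  apply: is_derive_eq.
  by rewrite add0r /GRing.scale /= mulr1.
split.
  apply: (is_derive_eq (@is_derive1_comp R cos _ t _ _ (is_derive_cos _) dl)).
  rewrite /GRing.scale /=; ring.
apply: (is_derive_eq (@is_derive1_comp R sin _ t _ _ (is_derive_sin _) dl)).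
rewrite /GRing.scale /=; ring.
Qed.

(** For k <> 0 choose i with k_i <> 0 and put c = 2 pi k_i. Then Re e_k and Im e_k are the i-th
    derivatives of the periodic functions Im e_k / c and - Re e_k / c, so their integrals vanish. *)
Lemma haar_char n (k : Zn n) :
  cintegral (haar R n) (fun w => e2pi (dot w k)) = if k == 0 then 1 else 0.
Proof.
case: eqVneq => [->|k0].
  under eq_cintegral do rewrite dot0r e2pi0.
  exact: cintegral_cst.
have [i ki] : exists i, k ord0 i != 0.
  apply/existsP; apply: contraNT k0; rewrite negb_exists => /forallP ki.
  by apply/eqP/rowP => i; rewrite mxE; apply/eqP; move: (ki i); rewrite negbK.
pose c : R := 2 * pi * (k ord0 i)%:~R.
have c0 : c != 0 by rewrite /c mulf_neq0 ?intr_eq0// mulf_neq0// gt_eqF ?pi_gt0.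
have [m1 m2] := cmeasurable_echar k.
have lineE (w : Tn R n) (s : R) : dot (w + s *: ebase i) k = dot w k + s * (k ord0 i)%:~R.
  by rewrite dotDl dotZl dot_ebase.
have per (w : Tn R n) : e2pi (dot (w + ebase i) k) = e2pi (dot w k).
  by rewrite dotDl dot_ebase e2piD e2pi_int mulr1.
apply: complexP.
  apply: (@haar_partial0 n i (fun w => c^-1 * Im (e2pi (dot w k)) ) _ 1) => //.
  - move=> w t; under eq_fun do rewrite lineE.
    rewrite lineE.
    have [_ ds] := is_derive_char (dot w k) (k ord0 i)%:~R t.
    have -> : Re (e2pi (dot w k + t * (k ord0 i)%:~R)) =
        c^-1 *: (c * cos (2 * pi * (dot w k + t * (k ord0 i)%:~R))).
      by rewrite /GRing.scale /= mulrA mulVf// mul1r.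
    exact: is_deriveZ.
  - move=> w t; apply: differentiable_continuous; apply/derivable1_diffP.
    under eq_fun do rewrite lineE.
    by have [ds _] := is_derive_char (dot w k) (k ord0 i)%:~R t; exact: ex_derive.
  - by move=> w; rewrite per.
  - by move=> w; rewrite (le_trans (Re_le_normc _))// normc_e2pi.
apply: (@haar_partial0 n i (fun w => - c^-1 * Re (e2pi (dot w k)) ) _ 1) => //.
- move=> w t; under eq_fun do rewrite lineE.
  rewrite lineE.
  have [ds _] := is_derive_char (dot w k) (k ord0 i)%:~R t.
  have -> : Im (e2pi (dot w k + t * (k ord0 i)%:~R)) =
      (- c^-1) *: (- c * sin (2 * pi * (dot w k + t * (k ord0 i)%:~R))).
    by rewrite /GRing.scale /= mulrA mulrNN mulVf// mul1r.
  exact: is_deriveZ.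
- move=> w t; apply: differentiable_continuous; apply/derivable1_diffP.
  under eq_fun do rewrite lineE.
  by have [_ ds] := is_derive_char (dot w k) (k ord0 i)%:~R t; exact: ex_derive.
- by move=> w; rewrite per.
- by move=> w; rewrite (le_trans (Im_le_normc _))// normc_e2pi.
Qed.

End haar_integral.

(** * Smooth functions on the torus *)

Section torus_calculus.
Context (R : realType) (n : nat).
Local Notation T := (Tn R n).
Local Notation C := R[i].
Implicit Types f g : T -> C.

Definition echar (k : Zn n) (w : T) : C := e2pi (dot w k).

Lemma cdiff_cst (c : C) (w : T) : cdiff (fun _ => c) w.
Proof. by split; exact: differentiable_cst. Qed.

Lemma cdiffD f g w : cdiff f w -> cdiff g w -> cdiff (fun v => f v + g v) w.
Proof.
move=> [f1 f2] [g1 g2]; split.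
  by under eq_fun do rewrite cReD; exact: differentiableD.
by under eq_fun do rewrite cImD; exact: differentiableD.
Qed.

Lemma cdiffM f g w : cdiff f w -> cdiff g w -> cdiff (fun v => f v * g v) w.
Proof.
move=> [f1 f2] [g1 g2]; split.
  under eq_fun do rewrite cReM; apply: differentiableB; exact: differentiableM.
under eq_fun do rewrite cImM; apply: differentiableD; exact: differentiableM.
Qed.

Lemma cdiffJ f w : cdiff f w -> cdiff (fun v => (f v)^*) w.
Proof.
move=> [f1 f2]; split.
  by under eq_fun do rewrite cReJ.
by under eq_fun do rewrite cImJ; exact: differentiableN.
Qed.

Lemma cdiff_shift f (a w : T) : cdiff f (w - a) -> cdiff (fun v => f (v - a)) w.
Proof.
move=> [f1 f2].
have ds : differentiable (fun v : T => v - a) w.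
  by apply: differentiableB => //; exact: differentiable_cst.
by split; [exact: (differentiable_comp ds f1)|exact: (differentiable_comp ds f2)].
Qed.

Lemma partialD (i : 'I_n) f g w : cdiff f w -> cdiff g w ->
  partial i (fun v => f v + g v) w = partial i f w + partial i g w.
Proof.
move=> [f1 f2] [g1 g2]; rewrite /partial.
under eq_fun do rewrite cReD.
under [X in _ +i* ('D__ X _)]eq_fun do rewrite cImD.
by rewrite !deriveD//; exact: diff_derivable.
Qed.

Lemma partialM (i : 'I_n) f g w : cdiff f w -> cdiff g w ->
  partial i (fun v => f v * g v) w = partial i f w * g w + f w * partial i g w.
Proof.
move=> [f1 f2] [g1 g2]; rewrite /partial.
under eq_fun do rewrite cReM.
under [X in _ +i* ('D__ X _)]eq_fun do rewrite cImM.
have d (h : T -> R) : differentiable h w -> derivable h w (ebase R i).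
  exact: diff_derivable.
rewrite deriveB; [|by apply: derivableM; exact: d..].
rewrite deriveD; [|by apply: derivableM; exact: d..].
rewrite !deriveM; try exact: d.
set a := 'D__ (fun v => Re (f v)) w; set b := 'D__ (fun v => Im (f v)) w.
set a' := 'D__ (fun v => Re (g v)) w; set b' := 'D__ (fun v => Im (g v)) w.
move: a b a' b' => a b a' b'; move: (f w) (g w) => [x y] [x' y'].
by apply: complexP; rewrite /= /GRing.scale/=; ring.
Qed.

Lemma partial_cst (i : 'I_n) (c : C) (w : T) : partial i (fun _ => c) w = 0.
Proof. by rewrite /partial !derive_cst. Qed.

Lemma partialJ (i : 'I_n) f w : cdiff f w ->
  partial i (fun v => (f v)^*) w = (partial i f w)^*.
Proof.
move=> [f1 f2]; rewrite /partial.
under eq_fun do rewrite cReJ.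
under [X in _ +i* ('D__ X _)]eq_fun do rewrite cImJ.
by rewrite deriveN//; exact: diff_derivable.
Qed.

Lemma partial_shift (i : 'I_n) f (a w : T) :
  partial i (fun v => f (v - a)) w = partial i f (w - a).
Proof.
have E (h : T -> R) (e : T) : 'D_e (fun v => h (v - a)) w = 'D_e h (w - a).
  have E' : (fun t : R => t^-1 *: (((fun v => h (v - a)) \o shift w) (t *: e) - h (w - a))) =
      (fun t : R => t^-1 *: ((h \o shift (w - a)) (t *: e) - h (w - a))).
    by apply/funext => t /=; rewrite addrA.
  by rewrite /derive E'.
by rewrite /partial (E (fun v => Re (f v))) (E (fun v => Im (f v))).
Qed.

Lemma differentiable_dot (k : Zn n) w : differentiable (fun v : T => dot v k) w.
Proof.
rewrite (_ : (fun v : T => _) = \sum_(i < n) (fun v : T => v ord0 i * (k ord0 i)%:~R)).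
  apply: differentiable_sum => i; apply: differentiableM.
    exact: differentiable_coord.
  exact: differentiable_cst.
by apply/funext => v; rewrite fct_sumE.
Qed.

Lemma cdiff_echar k w : cdiff (echar k) w.
Proof.
have d2 : differentiable (fun v : T => 2 * pi * dot v k) w.
  apply: differentiableM; first exact: differentiable_cst.
  exact: differentiable_dot.
split.
  apply: (differentiable_comp (g := @cos R) d2).
  by apply/derivable1_diffP; exact: derivable_cos.
apply: (differentiable_comp (g := @sin R) d2).
by apply/derivable1_diffP; exact: derivable_sin.
Qed.

Definition freq (k : Zn n) (i : 'I_n) : C := 0 +i* (2 * pi * (k ord0 i)%:~R).

Lemma partial_echar (i : 'I_n) k w : partial i (echar k) w = freq k i * echar k w.
Proof.
have [d1 d2] := cdiff_echar k w.
have lineE (s : R) : dot (w + s *: ebase R i) k = dot w k + s * (k ord0 i)%:~R.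
  by rewrite dotDl dotZl dot_ebase.
have [c1 c2] := is_derive_char (dot w k) (k ord0 i)%:~R 0.
have w0 : w = w + 0 *: ebase R i by rewrite scale0r addr0.
rewrite /partial -/(ebase R i).
have := @is_derive_line R n (fun v => Re (echar k v)) w (ebase R i) 0.
have := @is_derive_line R n (fun v => Im (echar k v)) w (ebase R i) 0.
rewrite -!w0 => /(_ (diff_derivable d2)) e2 /(_ (diff_derivable d1)) e1.
have E1 := derive_val (is_derive := e1); have E2 := derive_val (is_derive := e2).
rewrite -E1 -E2.
under eq_fun do rewrite /echar lineE /=.
under [X in _ +i* ('D__ X _)]eq_fun do rewrite /echar lineE /=.
rewrite (derive_val (is_derive := c1)) (derive_val (is_derive := c2)).
rewrite mul0r addr0.
by apply: complexP; rewrite ?cReM ?cImM /freq /echar /=; ring.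
Qed.

End torus_calculus.

(** * Iterated partial derivatives and seminorms on the torus *)

Section smooth.
Context (R : realType) (n : nat).
Local Notation T := (Tn R n).
Local Notation C := R[i].
Implicit Types (f g : T -> C) (s : seq 'I_n).

Definition Tbound (N : nat) f (B : R) :=
  forall s w, (size s <= N)%N -> normc (partials s f w) <= B.

Lemma smooth_cdiff f w : Tsmooth f -> cdiff f w.
Proof. by move=> sf; exact: (sf [::] w). Qed.

(** The last index of the list is the derivative applied first. Induction from that end lets the
    function change at each step. *)
Lemma partials_rcons s i f : partials (rcons s i) f = partials s (partial i f).
Proof. by rewrite /partials foldr_rcons. Qed.

Lemma Tsmooth_partial i f : Tsmooth f -> Tsmooth (partial i f).
Proof. by move=> sf s w; rewrite -partials_rcons; exact: sf. Qed.

Lemma Tsmooth_partials s f : Tsmooth f -> Tsmooth (partials s f).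
Proof. by move=> sf t w; have := sf (t ++ s) w; rewrite /partials foldr_cat. Qed.

Lemma partialsD s f g : Tsmooth f -> Tsmooth g ->
  partials s (fun v => f v + g v) = (fun v => partials s f v + partials s g v).
Proof.
move=> sf sg; elim: s => //= i s ->; apply/funext => w.
by rewrite partialD; [|exact: sf|exact: sg].
Qed.

Lemma TsmoothD f g : Tsmooth f -> Tsmooth g -> Tsmooth (fun v => f v + g v).
Proof.
by move=> sf sg s w; rewrite partialsD//; apply: cdiffD; [exact: sf|exact: sg].
Qed.

Lemma partialsZ s c f : Tsmooth f ->
  partials s (fun v => c * f v) = (fun v => c * partials s f v).
Proof.
move=> sf; elim: s => //= i s ->; apply/funext => w.
rewrite partialM; [|exact: cdiff_cst|exact: sf].
by rewrite partial_cst mul0r add0r.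
Qed.

Lemma TsmoothZ c f : Tsmooth f -> Tsmooth (fun v => c * f v).
Proof.
by move=> sf s w; rewrite partialsZ//; apply: cdiffM; [exact: cdiff_cst|exact: sf].
Qed.

Lemma partialsJ s f : Tsmooth f ->
  partials s (fun v => (f v)^*) = (fun v => (partials s f v)^*).
Proof.
move=> sf; elim: s => //= i s ->; apply/funext => w.
by rewrite partialJ//; exact: sf.
Qed.

Lemma TsmoothJ f : Tsmooth f -> Tsmooth (fun v => (f v)^*).
Proof. by move=> sf s w; rewrite partialsJ//; apply: cdiffJ; exact: sf. Qed.

Lemma partials_shift s f a :
  partials s (fun v => f (v - a)) = (fun v => partials s f (v - a)).
Proof.
elim: s => //= i s ->; apply/funext => w.
by rewrite (partial_shift _ (partials s f)).
Qed.

Lemma Tsmooth_shift f a : Tsmooth f -> Tsmooth (fun v => f (v - a)).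
Proof.
by move=> sf s w; rewrite partials_shift; apply: (@cdiff_shift _ _ (partials s f)); exact: sf.
Qed.

Lemma partials0 s : partials s (fun _ => 0 : C) = (fun _ : T => 0).
Proof. by elim: s => //= i s ->; apply/funext => w; rewrite partial_cst. Qed.

Lemma Tsmooth0 : Tsmooth (fun _ : T => 0 : C).
Proof. by move=> s w; rewrite partials0; exact: cdiff_cst. Qed.

Lemma Tsmooth_cst (c : C) : Tsmooth (fun _ : T => c).
Proof.
move=> s; elim/last_ind: s => [|s i _] w; first exact: cdiff_cst.
rewrite partials_rcons (_ : partial i _ = fun _ => 0); last first.
  by apply/funext => v; rewrite partial_cst.
exact: Tsmooth0.
Qed.

Lemma Tsmooth_sum (I : Type) (r : seq I) (P : pred I) (F : I -> T -> C) :
  (forall i, P i -> Tsmooth (F i)) ->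
  Tsmooth (fun v => \sum_(i <- r | P i) F i v).
Proof.
move=> sF; elim: r => [|a r IH].
  by under eq_fun do rewrite big_nil; exact: Tsmooth0.
under eq_fun do rewrite big_cons.
by case: (boolP (P a)) => // Pa; apply: TsmoothD => //; exact: sF.
Qed.

Lemma partials_sum (I : Type) (r : seq I) (P : pred I) (F : I -> T -> C) s :
  (forall i, P i -> Tsmooth (F i)) ->
  partials s (fun v => \sum_(i <- r | P i) F i v) =
  (fun v => \sum_(i <- r | P i) partials s (F i) v).
Proof.
move=> sF; elim: r => [|a r IH].
  by under eq_fun do rewrite big_nil; rewrite partials0; apply/funext => v; rewrite big_nil.
under eq_fun do rewrite big_cons.
under [RHS]eq_fun do rewrite big_cons.
case: (boolP (P a)) => // Pa; rewrite partialsD ?IH//; first exact: sF.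
exact: Tsmooth_sum.
Qed.

(** The derivative keeps the form e_k times a smooth function. Iterating this replaces the Leibniz
    formula of higher order. *)
Lemma partial_mul_echar i k f : Tsmooth f ->
  partial i (fun v => echar k v * f v) =
  (fun v => echar k v * (freq R k i * f v + partial i f v)).
Proof.
move=> sf; apply/funext => w.
rewrite partialM; [|exact: cdiff_echar|exact: smooth_cdiff].
by rewrite partial_echar mulrDr mulrCA !mulrA.
Qed.

Lemma Tsmooth_mul_echar k f : Tsmooth f -> Tsmooth (fun v => echar k v * f v).
Proof.
move=> + s; elim/last_ind: s f => [|s i IH] f sf w.
  by apply: cdiffM; [exact: cdiff_echar|exact: smooth_cdiff].
rewrite partials_rcons partial_mul_echar//; apply: IH.
by apply: TsmoothD; [exact: TsmoothZ|exact: Tsmooth_partial].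
Qed.

Lemma Tsmooth_echar k : Tsmooth (echar k : T -> C).
Proof.
have := Tsmooth_mul_echar k (Tsmooth_cst 1).
by under eq_fun do rewrite mulr1.
Qed.

Lemma partials_echar s k :
  partials s (echar k : T -> C) = (fun v => (\prod_(i <- s) freq R k i) * echar k v).
Proof.
elim: s => [|i s IH]; first by apply/funext => v; rewrite big_nil mul1r.
rewrite /= -/(partials s _) IH; apply/funext => w.
rewrite partialM; [|exact: cdiff_cst|exact: cdiff_echar].
by rewrite partial_cst mul0r add0r partial_echar big_cons mulrCA mulrA.
Qed.

Definition freq_bound (k : Zn n) : R := 1 + \sum_(i < n) normc (freq R k i).

Lemma freq_bound_ge1 k : 1 <= freq_bound k.
Proof. by rewrite lerDl sumr_ge0// => i _; exact: normc_ge0. Qed.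

Lemma TboundD N f g A B : Tsmooth f -> Tsmooth g -> Tbound N f A -> Tbound N g B ->
  Tbound N (fun v => f v + g v) (A + B).
Proof.
move=> sf sg fA gB s w sN; rewrite partialsD//.
by rewrite (le_trans (le_normcD _ _))// lerD; [|exact: fA|exact: gB].
Qed.

Lemma TboundZ N c f A : Tsmooth f -> Tbound N f A ->
  Tbound N (fun v => c * f v) (normc c * A).
Proof.
move=> sf fA s w sN; rewrite partialsZ// normcM ler_wpM2l ?normc_ge0//.
exact: fA.
Qed.

(** Differentiating once replaces f by [freq R k i * f + partial i f], whose seminorm of order one
    less is at most B times [freq_bound k]; N derivatives cost at most N such factors. *)
Lemma Tbound_mul_echar N k f B : Tsmooth f -> Tbound N f B ->
  Tbound N (fun v => echar k v * f v) (B * freq_bound k ^+ N).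
Proof.
elim: N f B => [|N IH] f B sf fB s w.
  rewrite leqn0 size_eq0 => /eqP ->/=; rewrite expr0 mulr1 normcM normc_e2pi mul1r.
  exact: (fB [::]).
have B0 : 0 <= B by rewrite (le_trans (normc_ge0 _) (fB [::] w _)).
have [->|[s' [i ->]]] : s = [::] \/ exists s' i, s = rcons s' i.
- by case/lastP: s => [|s i]; [left|right; exists s, i].
- move=> _ /=; rewrite normcM normc_e2pi mul1r (le_trans (fB [::] w _))//.
  by rewrite ler_peMr// exprn_ege1// freq_bound_ge1.
- rewrite size_rcons ltnS => sN; rewrite partials_rcons partial_mul_echar//.
  rewrite exprS mulrA; apply: IH => //.
    by apply: TsmoothD; [exact: TsmoothZ|exact: Tsmooth_partial].
  move=> t v tN; rewrite partialsD; [|exact: TsmoothZ|exact: Tsmooth_partial].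
  rewrite partialsZ// -partials_rcons (le_trans (le_normcD _ _))// normcM.
  rewrite /freq_bound mulrDr mulr1 addrC lerD//.
    by apply: fB; rewrite size_rcons.
  rewrite mulrC ler_pM ?normc_ge0//; first by apply: fB; rewrite leqW.
  by rewrite (bigD1 i)//= lerDl sumr_ge0// => j _; exact: normc_ge0.
Qed.

End smooth.

(** * Measurability, Lipschitz bounds and Fourier coefficients on the torus *)

Section torus_measure.
Context (R : realType) (n : nat).
Local Notation T := (Tn R n).
Local Notation C := R[i].
Implicit Types (f g : T -> C) (s : seq 'I_n).

(** With [Tgrid], this rounds a point down to the grid of mesh 1 / (N + 1), passing through the
    discrete space Z^n, on which every function is measurable. *)
Definition Tfloor (N : nat) (w : T) : Zn n :=
  \row_i Num.floor (N.+1%:R * w ord0 i).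

Definition Tgrid (N : nat) (k : Zn n) : T := \row_i ((k ord0 i)%:~R / N.+1%:R).

Lemma measurable_Tfloor N : measurable_fun setT (Tfloor N).
Proof.
move=> _ A mA; rewrite setTI.
rewrite (_ : Tfloor N @^-1` A = \bigcup_(k : Zn n)
   (Tfloor N @^-1` ([set k] `&` A))); last first.
  apply/seteqP; split=> [w Aw|w [k _ [/= wk Aw]]] //.
  by exists (Tfloor N w).
apply: countable_bigcupT_measurable => [|k]; first exact: countableP.
have [Ak|nAk] := pselect (A k); last first.
  rewrite (_ : _ `&` _ = set0) ?preimage_set0//.
  by apply/seteqP; split=> // x [-> ].
rewrite (_ : _ `&` _ = [set k]); last first.
  by apply/seteqP; split=> [x []//|x ->].
rewrite (_ : _ @^-1` _ = \bigcap_(i : 'I_n)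
   ((fun w : T => N.+1%:R * w ord0 i) @^-1` `[(k ord0 i)%:~R, (k ord0 i + 1)%:~R[)); last first.
  apply/seteqP; split=> [w /= <- i _ /=|w H].
    by rewrite in_itv/= !mxE floor_itv.
  apply/rowP => i; have := H i I; rewrite /= in_itv/= mxE -floor_eq => /eqP ->//.
apply: fin_bigcap_measurable; first exact: finite_finset.
move=> i _; rewrite -[X in measurable X]setTI.
have mi : measurable_fun setT (fun w : T => N.+1%:R * w ord0 i).
  by apply: measurable_funM => //; exact: measurable_Tn_coord.
by apply: mi => //; exact: measurable_itv.
Qed.

Lemma Tgrid_floor_cvg (w : T) : (fun N => Tgrid N (Tfloor N w)) @ \oo --> w.
Proof.
apply/cvgrPdist_lt => e e0.
near=> N.
have H (i : 'I_n) : `|w ord0 i - Tgrid N (Tfloor N w) ord0 i| <= N.+1%:R^-1.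
  rewrite !mxE; set x := N.+1%:R * w ord0 i.
  have /andP[f1 f2] := floor_itv x.
  rewrite (_ : w ord0 i = x / N.+1%:R); last by rewrite mulrAC mulfV ?mul1r ?gt_eqF.
  rewrite -mulrBl normrM [`|_^-1|]ger0_norm ?invr_ge0// ler_piMl ?invr_ge0//.
  rewrite ger0_norm ?subr_ge0// lerBlDl.
  by move: f2; rewrite intrD => /ltW; rewrite addrC.
apply: le_lt_trans (_ : N.+1%:R^-1 < e); last first.
  near: N; exact: near_infty_natSinv_lt (PosNum e0).
rewrite [X in X <= _]/Num.norm /= mx_normrE; apply: bigmax_le; first by rewrite invr_ge0.
by move=> [a i] _; rewrite ord1 /=; have := H i; rewrite !mxE.
Unshelve. all: by end_near.
Qed.

(** The sigma-algebra of [Tn] is generated by coordinates rather than by open sets. A continuous f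
    is the pointwise limit of its values at the rounded points, which depend measurably on the
    point. *)
Lemma continuous_measurable_Tn (f : T -> R) :
  continuous f -> measurable_fun setT f.
Proof.
move=> cf.
apply: (@measurable_fun_cvg _ _ _ _ (fun N => (f \o Tgrid N) \o Tfloor N)).
  move=> N; apply: measurableT_comp; last exact: measurable_Tfloor.
  exact: measurable_fun_Zn.
move=> w _; apply: (cvg_comp _ _ (@Tgrid_floor_cvg w)); exact: cf.
Qed.

Lemma Tsmooth_cmeasurable f : Tsmooth f -> cmeasurable f.
Proof.
move=> sf; split; apply: continuous_measurable_Tn => w;
  apply: differentiable_continuous; have [d1 d2] := smooth_cdiff w sf; assumption.
Qed.

(** The mean value theorem on the segment from w to w + v, with the differential expanded along the
    coordinate vectors. *)
Lemma lipschitz_real (h : T -> R) (B : R) :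
  (forall w, differentiable h w) ->
  (forall i w, `|'D_(ebase R i) h w| <= B) ->
  forall w v, `|h (w + v) - h w| <= B * \sum_(i < n) `|v ord0 i|.
Proof.
move=> dh hB w v.
have dl (t : R) : is_derive t 1 (fun s : R => h (w + s *: v)) ('D_v h (w + t *: v)).
  by apply: is_derive_line; exact: diff_derivable.
have cl : {within `[0, 1], continuous (fun s : R => h (w + s *: v))}.
  apply: continuous_subspaceT => t; apply: differentiable_continuous.
  by apply/derivable1_diffP; exact: ex_derive.
have [c _] := MVT ltr01 (fun x _ => dl x) cl.
rewrite scale1r scale0r addr0 subr0 mulr1 => ->.
set x := w + c *: v; rewrite deriveE//.
have vE : v = \sum_(i < n) v ord0 i *: ebase R i.
  apply/rowP => j; rewrite summxE (bigD1 j)//= big1 ?addr0; last first.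
    by move=> i ij; rewrite !mxE [j == i]eq_sym (negbTE ij) andbF mulr0.
  by rewrite !mxE !eqxx mulr1.
rewrite [X in 'd h x X]vE linear_sum/= mulr_sumr (le_trans (ler_norm_sum _ _ _))//.
apply: ler_sum => i _; rewrite linearZ/= -deriveE//.
by rewrite /GRing.scale/= normrM mulrC ler_wpM2r.
Qed.

(** The mean value theorem is real-valued; treating real and imaginary parts separately costs the
    factor 2. *)
Lemma lipschitz_smooth f (B : R) : Tsmooth f ->
  (forall i w, normc (partial i f w) <= B) ->
  forall w v, normc (f (w + v) - f w) <= 2 * B * \sum_(i < n) `|v ord0 i|.
Proof.
move=> sf fB w v; rewrite (le_trans (normc_le_ReIm _))// -mulrA mulr_natl mulr2n.
have ReB (x y : C) : Re (x - y) = Re x - Re y by case: x y => [a b] [c e].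
have ImB (x y : C) : Im (x - y) = Im x - Im y by case: x y => [a b] [c e].
rewrite ReB ImB lerD//.
  apply: (@lipschitz_real (fun v => Re (f v))) => [x|i x].
    by have [] := smooth_cdiff x sf.
  exact: le_trans (Re_le_normc _) (fB i x).
apply: (@lipschitz_real (fun v => Im (f v))) => [x|i x].
  by have [] := smooth_cdiff x sf.
exact: le_trans (Im_le_normc _) (fB i x).
Qed.

Lemma cintegral_partial0 i f (B : R) : Tsmooth f -> Tperiodic f ->
  (forall w, normc (partial i f w) <= B) ->
  cintegral (haar R n) (partial i f) = 0.
Proof.
move=> sf pf fB.
have sp := Tsmooth_partial i sf.
have [m1 m2] := Tsmooth_cmeasurable sp.
have cont_line (h : T -> R) (w : T) : (forall w, differentiable h w) ->
    continuous (fun s : R => h (w + s *: ebase R i)).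
  move=> dh t; apply: differentiable_continuous; apply/derivable1_diffP.
  have dd := @is_derive_line R n h w (ebase R i) t (diff_derivable (dh _)).
  exact: ex_derive.
apply: complexP.
  apply: (@haar_partial0 R n i (fun w => Re (f w)) _ B) => //.
  - move=> w t; apply: (@is_derive_line R n (fun v => Re (f v))).
    by apply: diff_derivable; have [] := smooth_cdiff (w + t *: ebase R i) sf.
  - move=> w; apply: (cont_line (fun v => Re (partial i f v))) => x.
    by have [] := smooth_cdiff x sp.
  - by move=> w; rewrite ebase_int pf.
  - by move=> w; exact: le_trans (Re_le_normc _) (fB w).
apply: (@haar_partial0 R n i (fun w => Im (f w)) _ B) => //.
- move=> w t; apply: (@is_derive_line R n (fun v => Im (f v))).
  by apply: diff_derivable; have [] := smooth_cdiff (w + t *: ebase R i) sf.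
- move=> w; apply: (cont_line (fun v => Im (partial i f v))) => x.
  by have [] := smooth_cdiff x sp.
- by move=> w; rewrite ebase_int pf.
- by move=> w; exact: le_trans (Im_le_normc _) (fB w).
Qed.

Lemma normc_echar k (w : T) : normc (echar k w) = 1.
Proof. exact: normc_e2pi. Qed.

Lemma echarD k l (w : T) : echar (k + l) w = echar k w * echar l w.
Proof. by rewrite /echar dotDr e2piD. Qed.

Lemma echarN k (w : T) : echar (- k) w = (echar k w)^*.
Proof. by rewrite /echar dotNr e2piN. Qed.

Lemma echar0 (w : T) : echar 0 w = 1.
Proof. by rewrite /echar dot0r e2pi0. Qed.

Lemma echarB k (w v : T) : echar k (w - v) = echar k w * echar (- k) v.
Proof. by rewrite /echar dotDl dotNl e2piD dotNr. Qed.

Lemma echar_periodic k : Tperiodic (echar k : T -> C).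
Proof. by move=> w j; rewrite /echar dotDl dot_int e2piD e2pi_int mulr1. Qed.

Lemma TperiodicM f g : Tperiodic f -> Tperiodic g -> Tperiodic (fun v => f v * g v).
Proof. by move=> pf pg w k; rewrite pf pg. Qed.

Definition coef f (l : Zn n) : C :=
  cintegral (haar R n) (fun w => f w * echar (- l) w).

Lemma cintegrable_coef f B l : cmeasurable f -> (forall w, normc (f w) <= B) ->
  cintegrable (haar R n) (fun w => f w * echar l w).
Proof.
move=> mf fB; apply: (@cintegrable_bounded _ _ _ _ _ B) => [|w].
  by apply: cmeasurableM => //; exact: cmeasurable_echar.
by rewrite normcM normc_echar mulr1.
Qed.

(** Integration by parts: the i-th derivative of e_(-l) f has integral 0. The bounds A and B make
    the two terms of the product rule integrable. *)
Lemma coef_partial i f l (A B : R) : Tsmooth f -> Tperiodic f ->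
  (forall w, normc (f w) <= A) ->
  (forall w, normc (partial i f w) <= B) ->
  coef (partial i f) l = freq R l i * coef f l.
Proof.
move=> sf pf fA fB.
have mf := Tsmooth_cmeasurable sf.
have mp := Tsmooth_cmeasurable (Tsmooth_partial i sf).
have i1 := @cintegrable_coef _ _ (- l) mf fA.
have i2 := @cintegrable_coef _ _ (- l) mp fB.
have sg := Tsmooth_mul_echar (- l) sf.
have := @cintegral_partial0 i (fun v => echar (- l) v * f v) (normc (freq R (- l) i) * A + B) sg.
move=> /(_ (TperiodicM (@echar_periodic _) pf)).
rewrite partial_mul_echar//.
have bnd w : normc (echar (- l) w * (freq R (- l) i * f w + partial i f w)) <=
   normc (freq R (- l) i) * A + B.
  rewrite normcM normc_echar mul1r (le_trans (le_normcD _ _))// lerD//.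
  by rewrite normcM ler_wpM2l ?normc_ge0.
move=> /(_ bnd).
under eq_cintegral do rewrite mulrDr mulrCA ![echar (- l) _ * _]mulrC.
rewrite cintegralD//; last exact: cintegrableZ.
rewrite cintegralZ// -/(coef f l) -/(coef _ l) => /eqP.
rewrite addrC addr_eq0 => /eqP ->.
by rewrite -mulNr; congr (_ * _); apply: complexP; rewrite /freq /= ?mxE ?oppr0// rmorphN/= mulrN opprK.
Qed.

Lemma coef_echar k l : coef (echar k) l = if k == l then 1 else 0.
Proof.
rewrite /coef; under eq_cintegral do rewrite -echarD.
by rewrite haar_char subr_eq0.
Qed.

Lemma normc_coef f l B : cmeasurable f -> (forall w, normc (f w) <= B) ->
  normc (coef f l) <= B.
Proof.
move=> mf fB; have fi := cintegrable_coef (- l) mf fB.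
rewrite -lee_fin (le_trans (normc_cintegral fi))//.
apply: (@le_trans _ _ (\int[haar R n]_x B%:E)%E).
  apply: ge0_le_integral => //.
  - by move=> x _; rewrite lee_fin normc_ge0.
  - by apply: cmeasurable_normcE; exact: cintegrable_meas fi.
  - by move=> x _; rewrite /= lee_fin normcM normc_echar mulr1.
by rewrite integral_probability_cst.
Qed.

End torus_measure.

(** * Fejer means *)

Section fejer.
Context (R : realType) (n : nat).
Local Notation T := (Tn R n).
Local Notation C := R[i].
Implicit Types (f g : T -> C) (s : seq 'I_n).

Local Notation box N := {ffun 'I_n -> 'I_N.+1}.

Definition box_pt N (a : box N) : Zn n := \row_i (a i : int).

Definition box_card N : R := (N.+1%:R ^+ n)%R.

Lemma box_card_gt0 N : 0 < box_card N.
Proof. by rewrite exprn_gt0. Qed.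

Lemma box_pt_inj N : injective (@box_pt N).
Proof.
move=> a b /rowP ab; apply/ffunP => i; apply/val_inj.
by have := ab i; rewrite !mxE => -[].
Qed.

(* Averaging the characters of frequency a - b over a, b in [0, N]^n amounts to
   convolving with |sum_a e_a|^2 / (N + 1)^n, which is nonnegative with
   integral 1. *)
Definition fejer N f (w : T) : C :=
  (box_card N)^-1%:C * \sum_(a : box N) \sum_(b : box N)
    coef f (box_pt a - box_pt b) * echar (box_pt a - box_pt b) w.

Definition fejer_ker N (w : T) : R :=
  (box_card N)^-1 * normc (\sum_(a : box N) echar (box_pt a) w) ^+ 2.

Lemma fejer_ker_ge0 N w : 0 <= fejer_ker N w.
Proof. by rewrite mulr_ge0 ?sqr_ge0// invr_ge0 ltW// box_card_gt0. Qed.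

Lemma fejer_kerE N (w : T) : (fejer_ker N w)%:C =
  (box_card N)^-1%:C * \sum_(a : box N) \sum_(b : box N)
    echar (box_pt a - box_pt b) w.
Proof.
rewrite /fejer_ker rmorphM/=; congr (_ * _).
have -> (z : C) : (normc z ^+ 2)%:C = z * z^*.
  by rewrite normc_sq; case: z => x y; apply: complexP => /=; ring.
rewrite rmorph_sum/= mulr_suml; apply: eq_bigr => a _.
rewrite mulr_sumr; apply: eq_bigr => b _.
by rewrite echarD echarN.
Qed.

Lemma dot_delta (w : T) (i : 'I_n) : dot w (delta_mx ord0 i) = w ord0 i.
Proof.
rewrite /dot (bigD1 i)//= big1 ?addr0; first by rewrite mxE !eqxx mulr1.
by move=> j ji; rewrite mxE (negbTE ji) andbF mulr0.
Qed.

Lemma echar_fejer_arg (l : Zn n) (w v : T) : echar l (w - v) = echar (- l) v * echar l w.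
Proof. by rewrite echarB mulrC. Qed.

Lemma cmeasurable_fejer_ker N (w : T) :
  cmeasurable (fun v : T => (fejer_ker N (w - v))%:C).
Proof.
under eq_fun do rewrite fejer_kerE.
apply: cmeasurableM; first exact: cmeasurable_cst.
apply: cmeasurable_sum => a _; apply: cmeasurable_sum => b _.
under eq_fun do rewrite echar_fejer_arg.
by apply: cmeasurableM; [exact: cmeasurable_echar|exact: cmeasurable_cst].
Qed.

Lemma fejer_ker_le N w : fejer_ker N w <= box_card N.
Proof.
rewrite /fejer_ker ler_pdivrMl ?box_card_gt0// -expr2.
rewrite lerXn2r ?nnegrE ?normc_ge0 ?(ltW (box_card_gt0 _))//.
rewrite (le_trans (normc_sum _ _ _))//.
under eq_bigr do rewrite normc_echar.
by rewrite sumr_const card_ffun !card_ord /box_card natrX.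
Qed.

Lemma fejer_conv N f (B : R) w : cmeasurable f -> (forall w, normc (f w) <= B) ->
  cintegrable (haar R n) (fun v => (fejer_ker N (w - v))%:C * f v) /\
  fejer N f w = cintegral (haar R n) (fun v => (fejer_ker N (w - v))%:C * f v).
Proof.
move=> mf fB.
have E v : (fejer_ker N (w - v))%:C * f v =
   (box_card N)^-1%:C * \sum_(a : box N) \sum_(b : box N)
     echar (box_pt a - box_pt b) w * (f v * echar (- (box_pt a - box_pt b)) v).
  rewrite fejer_kerE -mulrA; congr (_ * _); rewrite mulr_suml.
  apply: eq_bigr => a _; rewrite mulr_suml; apply: eq_bigr => b _.
  by rewrite echar_fejer_arg; ring.
have I (a b : box N) : cintegrable (haar R n) (fun v =>
     echar (box_pt a - box_pt b) w * (f v * echar (- (box_pt a - box_pt b)) v)).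
  by apply: cintegrableZ; exact: (cintegrable_coef _ mf fB).
have I2 : cintegrable (haar R n) (fun v => \sum_(a : box N) \sum_(b : box N)
     echar (box_pt a - box_pt b) w * (f v * echar (- (box_pt a - box_pt b)) v)).
  by apply: cintegrable_sum => a _; apply: cintegrable_sum => b _.
split.
  by apply: (eq_cintegrable (fun v => esym (E v))); exact: cintegrableZ.
rewrite (eq_cintegral _ E) cintegralZ//; congr (_ * _).
rewrite cintegral_sum; last by move=> a _; exact: cintegrable_sum.
apply: eq_bigr => a _; rewrite cintegral_sum//.
apply: eq_bigr => b _; rewrite cintegralZ; last exact: (cintegrable_coef _ mf fB).
by rewrite mulrC.
Qed.

(** The Fourier multiplier of the Fejer mean, classically the product of the triangular weights
    max(0, 1 - |l_i| / (N + 1)). Only its value at 0 and a lower bound at the points -e_i are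
    established. *)
Definition fejer_coef N (l : Zn n) : R :=
  (box_card N)^-1 * \sum_(a : box N) \sum_(b : box N) (box_pt a - box_pt b == l)%:R.

Lemma fejer_echar N l (w : T) : fejer N (echar l) w = (fejer_coef N l)%:C * echar l w.
Proof.
rewrite /fejer /fejer_coef rmorphM/= -mulrA; congr (_ * _).
rewrite rmorph_sum/= mulr_suml; apply: eq_bigr => a _.
rewrite rmorph_sum/= mulr_suml; apply: eq_bigr => b _.
rewrite coef_echar eq_sym; case: eqVneq => [->|_]; first by rewrite !mul1r.
by rewrite !mul0r.
Qed.

Lemma fejer_coef0 N : fejer_coef N 0 = 1.
Proof.
rewrite /fejer_coef (eq_bigr (fun=> 1)); last first.
  move=> a _; rewrite (bigD1 a)//= subrr eqxx big1 ?addr0// => b ba.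
  by rewrite subr_eq0 (inj_eq (@box_pt_inj N)) eq_sym (negbTE ba).
rewrite sumr_const card_ffun !card_ord natrX mulVf//.
by rewrite gt_eqF// box_card_gt0.
Qed.

(* All a with a_i < N contribute: take b = a + e_i. *)
Lemma fejer_coef1 N (i : 'I_n) :
  1 - N.+1%:R^-1 <= fejer_coef N (- delta_mx ord0 i).
Proof.
rewrite /fejer_coef.
apply: (@le_trans _ _ ((box_card N)^-1 * \sum_(a : box N) (a i != ord_max)%:R)); last first.
  rewrite ler_wpM2l ?invr_ge0 ?(ltW (box_card_gt0 _))//.
  apply: ler_sum => a _; case: eqVneq => [_|ai]; first by rewrite sumr_ge0.
  pose b : box N := [ffun j => if j == i then inord (a j).+1 else a j].
  rewrite (bigD1 b)//= (_ : _ == _) ?lerDl ?sumr_ge0//.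
  apply/eqP/rowP => j; rewrite !mxE ffunE eqxx/=.
  case: eqVneq => [->|ij]/=; last by rewrite subrr oppr0.
  have aiN : (a i < N)%N.
    by rewrite ltn_neqAle -ltnS ltn_ord andbT -(inj_eq val_inj)/= in ai *.
  by rewrite inordK ?ltnS//; lia.
have -> : \sum_(a : box N) (a i != ord_max)%:R =
   \prod_(j < n) \sum_(x : 'I_N.+1) ((j == i) ==> (x != ord_max))%:R :> R.
  rewrite bigA_distr_bigA/=; apply: eq_bigr => a _.
  rewrite (bigD1 i)//= eqxx/= big1 ?mulr1// => j /negbTE ->//.
have sN : \sum_(x : 'I_N.+1) (x != ord_max)%:R = N%:R :> R.
  rewrite big_ord_recr/= eqxx addr0 (eq_bigr (fun=> 1)).
    by rewrite sumr_const card_ord.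
  move=> x _; rewrite (_ : _ != _)//; apply/eqP => /(congr1 val)/= xN.
  by have := ltn_ord x; rewrite xN ltnn.
rewrite (bigD1 i)//= eqxx/= sN (eq_bigr (fun=> N.+1%:R)); last first.
  move=> j /negbTE ->/=; by rewrite sumr_const card_ord.
rewrite prodr_const.
have n0 : (0 < n)%N by case: (n) i => [[]|].
have -> : #|[pred j | j != i]| = n.-1.
  by rewrite cardC1 card_ord.
rewrite /box_card -[X in _ ^+ X](prednK n0) exprS invfM.
rewrite mulrACA mulVf ?mulr1 ?expf_neq0//.
rewrite -subr_ge0; rewrite (_ : _ - _ = 0)// -[N.+1%:R in X in X - _]natr1.
by rewrite -natr1; field; rewrite natr1.
Qed.

(** The Fejer mean is evaluated on two characters, where it acts by a multiplier: the constant gives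
    the total mass, and one first-order character gives the cosine moment in direction i. *)
Lemma fejer_ker_moment N (w : T) :
  [/\ (haar R n).-integrable setT (fun v : T => (fejer_ker N (w - v))%:E),
      \int[haar R n]_v fejer_ker N (w - v) = 1 &
      forall i, \int[haar R n]_v (fejer_ker N (w - v) *
           (1 - cos (2 * pi * (w ord0 i - v ord0 i)))) <= N.+1%:R^-1].
Proof.
have m1 := cmeasurable_cst T (1 : C).
have b1 (v : T) : normc (1 : C) <= 1 by rewrite normc1.
have [i1 e1] := fejer_conv N w m1 b1.
have E1 : (fun _ : T => 1 : C) = echar 0 by apply/funext => v; rewrite echar0.
have I1 : (haar R n).-integrable setT (fun v : T => (fejer_ker N (w - v))%:E).
  by have [+ _] := i1; under eq_fun do rewrite mulr1.
have J1 : \int[haar R n]_v fejer_ker N (w - v) = 1.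
  move: e1; rewrite E1 fejer_echar fejer_coef0 echar0 mulr1 => /(congr1 (@complex.Re R)) /= ->.
  by apply: eq_Rintegral => v _; rewrite mulr1 mul0r subr0.
split=> // i.
(* With this l, e_(-l)(w) e_l(v) has real part cos(2 pi (w_i - v_i)), so multiplying the mean of e_l
   at w by e_(-l)(w) leaves the multiplier equal to the cosine moment. *)
pose l : Zn n := - delta_mx ord0 i.
have ml := cmeasurable_echar R l.
have bl (v : T) : normc (echar l v) <= 1 by rewrite normc_echar.
have [i2 e2] := fejer_conv N w ml bl.
have i3 := cintegrableZ (echar (- l) w) i2.
have e3 : cintegral (haar R n) (fun v => echar (- l) w * ((fejer_ker N (w - v))%:C * echar l v)) =
    (fejer_coef N l)%:C.
  by rewrite cintegralZ// -e2 fejer_echar mulrCA -echarD addNr echar0 mulr1.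
have dE (v : T) : Re (echar (- l) w * ((fejer_ker N (w - v))%:C * echar l v)) =
   fejer_ker N (w - v) * cos (2 * pi * (w ord0 i - v ord0 i)).
  rewrite mulrCA.
  have -> : echar l v = echar (- - l) v by rewrite opprK.
  rewrite -echarB cReM/= mul0r subr0; congr (_ * cos (_ * _)).
  by rewrite /l opprK dot_delta !mxE.
have [r3 _] := i3.
have r3' : (haar R n).-integrable setT (EFin \o (fun v : T =>
   fejer_ker N (w - v) * cos (2 * pi * (w ord0 i - v ord0 i)))).
  by move: r3; under eq_fun do rewrite dE.
under eq_Rintegral do rewrite mulrBr mulr1.
rewrite RintegralB//= J1 lerBlDr -lerBlDl.
rewrite (le_trans (fejer_coef1 N i))//.
have -> : fejer_coef N l = \int[haar R n]_v
    Re (echar (- l) w * ((fejer_ker N (w - v))%:C * echar l v)).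
  exact: esym (congr1 (@complex.Re R) e3).
by under eq_Rintegral do rewrite dE.
Qed.

End fejer.

(** * Uniform approximation with a rate depending only on a Lipschitz constant *)

Section fejer_approximation.
Context (R : realType) (n : nat).
Local Notation T := (Tn R n).
Local Notation C := R[i].
Implicit Types (f g : T -> C) (s : seq 'I_n).

Lemma cos2pi_int (x : R) (z : int) : cos (2 * pi * (x - z%:~R)) = cos (2 * pi * x).
Proof.
have : e2pi (x - z%:~R) = e2pi x by rewrite e2piD -rmorphN e2pi_int mulr1.
by move/(congr1 (@complex.Re R)).
Qed.

(* 1 - cos(2 pi x) vanishes only on Z, so it controls the distance to Z up to
   an arbitrarily small error. *)
Lemma near_int_cos (e : R) : 0 < e -> exists2 c : R, 0 <= c & forall x : R,
  exists z : int, `|x - z%:~R| <= e + c * (1 - cos (2 * pi * x)).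
Proof.
(* The cap at 1/2 keeps 2 pi e1 within [0, pi], where the cosine decreases. Beyond distance e1 from
   Z, the quantity 1 - cos is then bounded below by its value at e1, whose inverse is the constant
   c. *)
move=> e0; pose e1 := Num.min e 2^-1.
have e10 : 0 < e1 by rewrite lt_min e0/= invr_gt0.
have e12 : e1 <= 2^-1 by rewrite ge_min lexx orbT.
have e1e : e1 <= e by rewrite ge_min lexx.
have pi0 := pi_gt0 R.
have inI (t : R) : 0 <= t -> t <= 2^-1 -> 2 * pi * t \in `[0, pi].
  move=> t0 t1; rewrite in_itv/=; apply/andP; split.
    by rewrite !mulr_ge0// ltW.
  have pE : pi = 2 * pi * 2^-1 :> R by field.
  by rewrite [leRHS]pE ler_wpM2l// mulr_ge0// ltW.
have d0 : 0 < 1 - cos (2 * pi * e1).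
  have m0 : (0 : R) \in `[0, pi] by rewrite in_itv/= lexx ltW.
  have m1 : 2 * pi * e1 \in `[0, pi] by apply: inI => //; exact: ltW.
  by rewrite subr_gt0 -[ltRHS]cos0 ltr_cos// !mulr_gt0.
exists (1 - cos (2 * pi * e1))^-1; first by rewrite invr_ge0 ltW.
move=> x; exists (Num.floor (x + 2^-1)); set z := Num.floor _.
have /andP[z1 z2] := floor_itv (x + 2^-1).
rewrite -/z in z1 z2; rewrite intrD in z2.
rewrite -(cos2pi_int x z); set r := x - z%:~R.
have r2 : `|r| <= 2^-1 by rewrite ler_norml /r; apply/andP; split; lra.
have cE : cos (2 * pi * r) = cos (2 * pi * `|r|).
  by case: ger0P => r0 //; rewrite mulrN cosN.
have [re|re] := lerP `|r| e1.
  rewrite (le_trans re)// (le_trans e1e)// lerDl.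
  by apply: mulr_ge0; [rewrite invr_ge0 ltW|rewrite subr_ge0 cos_le1].
rewrite (le_trans r2)// (@le_trans _ _ 1)//; first by rewrite invf_le1// ler1n.
rewrite -[leLHS]add0r lerD ?(ltW e0)// mulrC ler_pdivlMr// mul1r.
rewrite lerB// cE ltW// ltr_cos.
- by rewrite ltr_pM2l// mulr_gt0.
- by apply: inI => //; exact: ltW.
- by apply: inI.
Qed.

(** Periodicity allows v - w to be reduced modulo Z^n to a vector of small coordinates before the
    Lipschitz bound is applied. The constant c is chosen before f. *)
Lemma smooth_modulus (e : R) : 0 < e -> exists2 c : R, 0 <= c &
  forall f (B : R), Tsmooth f -> Tperiodic f -> 0 <= B ->
  (forall i w, normc (partial i f w) <= B) -> forall w v,
  normc (f v - f w) <= B * (e + c * \sum_(i < n) (1 - cos (2 * pi * (w ord0 i - v ord0 i)))).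
Proof.
(* The error e' occurs once for each of the n coordinates and is doubled by [lipschitz_smooth]; n +
   1 keeps the denominator non-zero when n = 0. *)
move=> e0; pose e' := e / (2 * n.+1%:R).
have e'0 : 0 < e' by rewrite divr_gt0.
have [c c0 Hc] := near_int_cos e'0.
exists (2 * c); first by rewrite mulr_ge0.
move=> f B sf pf B0 fB w v.
have /choice[z Hz] : forall i : 'I_n, exists z : int,
   `|(v ord0 i - w ord0 i) - z%:~R| <= e' + c * (1 - cos (2 * pi * (w ord0 i - v ord0 i))).
  move=> i; have [z Hz] := Hc (v ord0 i - w ord0 i); exists z.
  by rewrite -[w ord0 i - _]opprB mulrN cosN.
pose k : Zn n := \row_i z i.
pose d : T := v - w - map_mx intr k.
have vE : f v = f (w + d).
  rewrite -(pf (w + d) k); congr f.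
  by rewrite /d addrA subrK addrC subrK.
rewrite vE (le_trans (lipschitz_smooth sf fB w d))//.
rewrite [2 * B]mulrC -[leLHS]mulrA ler_wpM2l//.
apply: (@le_trans _ _ (2 * \sum_(i < n) (e' + c * (1 - cos (2 * pi * (w ord0 i - v ord0 i)))))).
  rewrite ler_wpM2l//; apply: ler_sum => i _.
  by have := Hz i; rewrite /d !mxE.
rewrite big_split/= sumr_const card_ord -mulr_sumr mulrDr [2 * (c * _)]mulrA lerD//.
rewrite -[e' *+ n]mulr_natr (_ : 2 * (e' * n%:R) = e * (n%:R / n.+1%:R)); last first.
  by rewrite /e'; field; rewrite nat1r pnatr_eq0.
by rewrite ler_piMr ?ltW// ltr_pdivrMr// mul1r ltr_nat.
Qed.

(* Korovkin's argument: the modulus of continuity is dominated by the functions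
   1 - cos(2 pi x_i), whose means against the kernel are at most 1 / (N + 1). *)
Lemma fejer_approx (e : R) : 0 < e -> exists N : nat, forall f (A B : R),
  Tsmooth f -> Tperiodic f -> 0 <= B -> (forall w, normc (f w) <= A) ->
  (forall i w, normc (partial i f w) <= B) ->
  forall w, normc (fejer N f w - f w) <= e * B.
Proof.
move=> e0.
have e20 : 0 < e / 2 by rewrite divr_gt0.
have [c c0 Hc] := smooth_modulus e20.
(* N is fixed by e alone, before f, A and B. One N can therefore serve all rows and all derivatives
   of a Schwartz function at once. *)
have [N HN] : exists N : nat, c * n%:R * N.+1%:R^-1 <= e / 2.
  exists (Num.bound (c * n%:R / (e / 2))).
  rewrite ler_pdivrMr// -ler_pdivrMl// [leLHS]mulrC.
  apply: le_trans (ltW (archi_boundP _)) _; last by rewrite ler_nat.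
  by rewrite divr_ge0 ?mulr_ge0// ltW.
exists N => f A B sf pf B0 fA fB w.
have mf := Tsmooth_cmeasurable sf.
have [i1 ->] := fejer_conv N w mf fA.
have [I1 J1 M1] := fejer_ker_moment N w.
have iK : cintegrable (haar R n) (fun v => (fejer_ker N (w - v))%:C).
  by split=> //=; exact: integrable0.
have cK : cintegral (haar R n) (fun v => (fejer_ker N (w - v))%:C) = 1.
  by rewrite /cintegral/= J1 /Rintegral integral0.
have E : cintegral (haar R n) (fun v => (fejer_ker N (w - v))%:C * f v) - f w =
    cintegral (haar R n) (fun v => (fejer_ker N (w - v))%:C * (f v - f w)).
  under [RHS]eq_cintegral do rewrite mulrBr -mulrN [_ * - _]mulrC.
  rewrite cintegralD//; last exact: cintegrableZ.
  by rewrite cintegralZ// cK mulr1.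
rewrite {}E.
have iD : cintegrable (haar R n) (fun v => (fejer_ker N (w - v))%:C * (f v - f w)).
  have H v : (fejer_ker N (w - v))%:C * f v + (- f w) * (fejer_ker N (w - v))%:C =
     (fejer_ker N (w - v))%:C * (f v - f w) by rewrite mulrBr mulNr mulrC [_ * f w]mulrC; ring.
  by apply: (eq_cintegrable H); apply: cintegrableD => //; exact: cintegrableZ.
rewrite -lee_fin (le_trans (normc_cintegral iD))//.
pose D i v := 1 - cos (2 * pi * (w ord0 i - (v : T) ord0 i)).
pose G v := B * (e / 2) * fejer_ker N (w - v) +
   B * c * \sum_(i < n) fejer_ker N (w - v) * D i v.
have mK : measurable_fun setT (fun v : T => fejer_ker N (w - v)).
  by have [] := cmeasurable_fejer_ker N w.
have mD i : measurable_fun setT (D i).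
  apply: measurable_funB => //.
  apply: (@measurableT_comp _ _ _ _ _ _ (@cos R)).
    by apply: continuous_measurable_fun; exact: continuous_cos.
  apply: measurable_funM => //; apply: measurable_funB => //.
  exact: measurable_Tn_coord.
have D0 i v : 0 <= D i v by rewrite subr_ge0 cos_le1.
have D2 i v : D i v <= 2.
  by rewrite /D lerBlDr -lerBlDl (le_trans _ (cos_geN1 _))//; lra.
have iKD i : (haar R n).-integrable setT (EFin \o (fun v => fejer_ker N (w - v) * D i v)).
  apply: (@integrable_bounded _ _ _ _ _ (box_card R n N * 2)) => [|v].
    exact: measurable_funM.
  have KD0 : 0 <= fejer_ker N (w - v) * D i v by apply: mulr_ge0; [exact: fejer_ker_ge0|exact: D0].
  rewrite ger0_norm//; apply: ler_pM; [exact: fejer_ker_ge0|exact: D0| |exact: D2].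
  exact: fejer_ker_le.
have iS : (haar R n).-integrable setT
    (EFin \o (fun v => \sum_(i < n) fejer_ker N (w - v) * D i v)).
  rewrite (_ : _ \o _ = (fun v => \sum_(i < n) (fejer_ker N (w - v) * D i v)%:E)%E); last first.
    by apply/funext => v /=; rewrite sumEFin.
  by apply: integrable_sum => // i _; exact: iKD.
have iG : (haar R n).-integrable setT (EFin \o G).
  rewrite (_ : _ \o _ = ((EFin \o (fun v : T => (B * (e / 2) * fejer_ker N (w - v))%R)) \+
   (EFin \o (fun v : T => (B * c * \sum_(i < n) fejer_ker N (w - v) * D i v)%R)))%E)//.
  by apply: integrableD => //; exact: integrableEZl.
apply: (@le_trans _ _ (\int[haar R n]_v (G v)%:E)%E).
  apply: ge0_le_integral => //.
  - by move=> v _; rewrite lee_fin normc_ge0.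
  - by apply: cmeasurable_normcE; exact: cintegrable_meas iD.
  - by have /integrableP[] := iG.
  - move=> v _; rewrite lee_fin normcM normcR ger0_norm ?fejer_ker_ge0//.
    have := Hc f B sf pf B0 fB w v.
    move=> /(ler_wpM2l (fejer_ker_ge0 N (w - v)))/le_trans; apply.
    rewrite /G -mulr_sumr -/(D _ _) le_eqVlt; apply/orP; left; apply/eqP.
    rewrite (_ : \sum_(i < n) (1 - cos _) = \sum_(i < n) D i v)//; ring.
rewrite -[leLHS]fineK; last exact: integrable_fin_num.
rewrite lee_fin -[leLHS]/(\int[haar R n]_v G v).
rewrite /G RintegralD//; [|exact: integrableEZl..].
rewrite [X in X + _]RintegralZl// [X in _ + X]RintegralZl// J1 mulr1.
have -> : \int[haar R n]_v \sum_(i < n) fejer_ker N (w - v) * D i v =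
  \sum_(i < n) \int[haar R n]_v (fejer_ker N (w - v) * D i v).
  rewrite /Rintegral; under eq_integral do rewrite -sumEFin.
  rewrite integral_sum//.
  by rewrite -sum_fine// => i _; exact: integrable_fin_num (iKD i).
rewrite (@le_trans _ _ (B * (e / 2) + B * c * (n%:R * N.+1%:R^-1)))//.
  rewrite lerD2l ler_wpM2l ?mulr_ge0//.
  rewrite mulr_natl -[X in _ <= _ *+ X](@card_ord n) -sumr_const.
  by apply: ler_sum => i _; exact: M1.
rewrite -mulrA -mulrDr mulrC ler_wpM2r// mulrA.
by rewrite [leRHS](splitr e) lerD2l.
Qed.

End fejer_approximation.

(** * Density of trigonometric polynomials *)

Section schwartz.
Context (R : realType) (n : nat).
Local Notation Z := (Zn n).
Local Notation T := (Tn R n).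
Local Notation C := R[i].
Local Notation ZT := (Z * T)%type.
Implicit Types (phi psi : ZT -> C).

Lemma ZTboundP N phi B : ZTbound N phi B <->
  forall k, Tbound N (fun v => phi (k, v)) (B / weight R N k).
Proof.
split=> [H k s w sN|H s k w sN]; have W := weight_gt0 R N k.
  by rewrite ler_pdivlMr// mulrC; exact: H.
by rewrite mulrC -ler_pdivlMr//; exact: H.
Qed.

Lemma ZTbound_ge0 N phi B : ZTbound N phi B -> 0 <= B.
Proof.
move=> /(_ [::] 0 0 (leq0n _)); apply: le_trans.
by rewrite mulr_ge0 ?normc_ge0// ltW// weight_gt0.
Qed.

Lemma ZTbound_sup N phi B z : ZTbound N phi B -> normc (phi z) <= B.
Proof.
case: z => k w /(_ [::] k w (leq0n _)); apply: le_trans => /=.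
by rewrite ler_peMl ?normc_ge0// weight_ge1.
Qed.

Lemma ZTschwartz_bounded phi : ZTschwartz phi -> exists2 B, 0 <= B &
  forall z, normc (phi z) <= B.
Proof.
move=> [_ _ /(_ 0%N)[B hB]]; exists B; first exact: ZTbound_ge0 hB.
by move=> z; exact: ZTbound_sup hB.
Qed.

Lemma ZTbound_lin N a phi psi A B : ZTschwartz phi -> ZTschwartz psi ->
  ZTbound N phi A -> ZTbound N psi B ->
  ZTbound N (fun z => a * phi z + psi z) (normc a * A + B).
Proof.
move=> [_ s1 _] [_ s2 _] /ZTboundP hA /ZTboundP hB; apply/ZTboundP => k.
rewrite mulrDl -mulrA; apply: TboundD => //; first exact: TsmoothZ.
exact: TboundZ.
Qed.

Lemma ZTschwartz_lin a phi psi : ZTschwartz phi -> ZTschwartz psi ->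
  ZTschwartz (fun z => a * phi z + psi z).
Proof.
move=> h1 h2; have [p1 s1 b1] := h1; have [p2 s2 b2] := h2; split.
- by move=> k w j; rewrite p1 p2.
- by move=> k; apply: TsmoothD => //; exact: TsmoothZ.
- move=> N; have [A hA] := b1 N; have [B hB] := b2 N.
  by exists (normc a * A + B); exact: ZTbound_lin.
Qed.

Lemma ZTschwartz0 : ZTschwartz (fun _ : ZT => 0 : C).
Proof.
split=> [k w j //|k|N]; first exact: Tsmooth0.
by exists 0 => s k w sN; rewrite (partials0 R s) normc0 mulr0.
Qed.

Lemma ZTschwartzB phi psi : ZTschwartz phi -> ZTschwartz psi ->
  ZTschwartz (fun z => phi z - psi z).
Proof.
move=> h1 h2; have := ZTschwartz_lin (-1) h2 h1.
by under eq_fun do rewrite mulN1r addrC.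
Qed.

(** The test function at which [stftZT phi u] evaluates u, so that [u (tfmod m w xi k phi)] is the
    transform with window phi by conversion. It is antilinear in the window. *)
Definition tfmod (m : Z) (w xi : T) (k : Z) phi (z : ZT) : C :=
  e2pi (- dot xi z.1) * e2pi (- dot z.2 k) * (phi (z.1 - m, z.2 - w))^*.

Lemma tfmodE m w xi k phi j :
  (fun v => tfmod m w xi k phi (j, v)) =
  (fun v => e2pi (- dot xi j) * (echar (- k) v * (phi (j - m, v - w))^*)).
Proof. by apply/funext => v; rewrite /tfmod /= mulrA /echar dotNr. Qed.

Lemma Tsmooth_tfmod m w xi k phi j : (forall j, Tsmooth (fun v => phi (j, v))) ->
  Tsmooth (fun v => tfmod m w xi k phi (j, v)).
Proof.
move=> s; rewrite tfmodE; apply: TsmoothZ; apply: Tsmooth_mul_echar.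
apply: (@Tsmooth_shift _ _ (fun v => (phi (j - m, v))^*)).
by apply: TsmoothJ; exact: s.
Qed.

(** The constant involves m and k but neither w nor xi: torus translations and phases leave the
    seminorms unchanged. An error in the window thus stays controlled after integration over (w,
    xi). *)
Lemma ZTbound_tfmod N m w xi k phi B : (forall j, Tsmooth (fun v => phi (j, v))) ->
  ZTbound N phi B ->
  ZTbound N (tfmod m w xi k phi) (B * (weight R N m * freq_bound R (- k) ^+ N)).
Proof.
move=> s hB; have B0 := ZTbound_ge0 hB.
move/ZTboundP : hB => hB; apply/ZTboundP => j; rewrite tfmodE.
have sJ : Tsmooth (fun v => (phi (j - m, v))^*) by apply: TsmoothJ.
have sS : Tsmooth (fun v => (phi (j - m, v - w))^*).
  exact: (@Tsmooth_shift _ _ (fun v => (phi (j - m, v))^*)).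
have bS : Tbound N (fun v => (phi (j - m, v - w))^*) (B / weight R N (j - m)).
  move=> t v tN; rewrite (partials_shift t (fun v => (phi (j - m, v))^*)).
  by rewrite partialsJ// normc_conjc; exact: hB.
have := TboundZ (e2pi (- dot xi j)) (Tsmooth_mul_echar _ sS) (Tbound_mul_echar (- k) sS bS).
rewrite normc_e2pi mul1r => H t v tN; apply: le_trans (H t v tN) _.
rewrite [leRHS](_ : _ = B * (weight R N m / weight R N j) * freq_bound R (- k) ^+ N).
  rewrite ler_wpM2r//.
    by rewrite exprn_ge0// (le_trans ler01)// freq_bound_ge1.
  rewrite ler_wpM2l// ler_pdivlMr ?weight_gt0// mulrC ler_pdivrMr ?weight_gt0//.
  by rewrite -[X in weight R N X <= _](subrKC m); exact: weightD.
by rewrite mulrA mulrAC mulrA.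
Qed.

Lemma ZTschwartz_tfmod m w xi k phi : ZTschwartz phi ->
  ZTschwartz (tfmod m w xi k phi).
Proof.
move=> [p s b]; split.
- move=> j v l; have E := tfmodE m w xi k phi j; have Ex x := congr1 (@^~ x) E.
  rewrite /= in Ex; rewrite !Ex echar_periodic; congr (_ * (_ * _^*)).
  by rewrite addrAC p.
- by move=> j; exact: Tsmooth_tfmod.
- by move=> N; have [B hB] := b N; eexists; apply: ZTbound_tfmod hB.
Qed.

Lemma tfmod_lin m w xi k a phi psi z :
  tfmod m w xi k (fun z => a * phi z + psi z) z =
  a^* * tfmod m w xi k phi z + tfmod m w xi k psi z.
Proof. by rewrite /tfmod rmorphD rmorphM/=; ring. Qed.

Definition zt_basis (j l : Z) (z : ZT) : C := if z.1 == j then echar l z.2 else 0.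

Lemma ZTschwartz_single (j : Z) (f : T -> C) : Tperiodic f -> Tsmooth f ->
  (forall N, exists B, Tbound N f B) ->
  ZTschwartz (fun z : ZT => if z.1 == j then f z.2 else 0).
Proof.
move=> p s b; split=> [k|k|N].
- by move=> w l /=; case: (k == j) => //; exact: p.
- by rewrite /=; case: (k == j) => //; exact: Tsmooth0.
- have [B hB] := b N; exists (weight R N j * B) => t k w tN /=.
  case: eqVneq => [->|_]; last first.
    rewrite (partials0 R t) normc0 mulr0 mulr_ge0 ?(ltW (weight_gt0 _ _ _))//.
    by rewrite (le_trans (normc_ge0 _) (hB [::] w _)).
  by rewrite ler_wpM2l ?(ltW (weight_gt0 _ _ _))//; exact: hB.
Qed.

Lemma Tbound_echar N (l : Z) : Tbound N (echar l : T -> C) (freq_bound R l ^+ N).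
Proof.
have b1 : Tbound N (fun _ : T => 1 : C) 1.
  move=> s w sN; elim/last_ind: s {sN} => [|s i _].
    by rewrite -[normc _]/(normc (1 : C)) normc1.
  rewrite partials_rcons (_ : partial i _ = fun _ => 0).
    by rewrite (partials0 R s) normc0.
  by apply/funext => v; rewrite partial_cst.
have := Tbound_mul_echar l (@Tsmooth_cst R n 1) b1.
by rewrite mul1r; under eq_fun do rewrite mulr1.
Qed.

Lemma ZTschwartz_basis j l : ZTschwartz (zt_basis j l).
Proof.
apply: ZTschwartz_single; first exact: echar_periodic.
  exact: Tsmooth_echar.
by move=> N; eexists; exact: Tbound_echar.
Qed.

(** Time-frequency shifts permute the basis tensors up to a unimodular factor, a character in xi
    times a character in w. The conjugate in [tfmod] turns l into -l inside the tensor. *)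
Lemma tfmod_basis m w xi k j l z :
  tfmod m w xi k (zt_basis j l) z =
  e2pi (- dot xi (j + m)) * echar l w * zt_basis (j + m) (- k - l) z.
Proof.
rewrite /tfmod /zt_basis; rewrite /= subr_eq.
case: eqVneq => [->|_]; last by rewrite rmorph0 !mulr0.
rewrite -!mulrA; congr (_ * _).
rewrite -echarN echarB opprK echarD /echar !dotNr; ring.
Qed.

Definition tpoly (r : seq (Z * Z * C)) (z : ZT) : C :=
  \sum_(t <- r) t.2 * zt_basis t.1.1 t.1.2 z.

Lemma ZTschwartz_tpoly r : ZTschwartz (tpoly r).
Proof.
elim: r => [|t r IH].
  rewrite (_ : tpoly _ = fun _ => 0); first exact: ZTschwartz0.
  by apply/funext => z; rewrite /tpoly big_nil.
rewrite (_ : tpoly _ = fun z => t.2 * zt_basis t.1.1 t.1.2 z + tpoly r z).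
  by apply: ZTschwartz_lin => //; exact: ZTschwartz_basis.
by apply/funext => z; rewrite /tpoly big_cons.
Qed.

(** An existential form, so that nested finite sums are recognised without writing out their list of
    terms. *)
Definition is_tpoly (phi : ZT -> C) := exists r, forall z, phi z = tpoly r z.

Lemma is_tpoly_sum (I : Type) (s : seq I) (F : I -> ZT -> C) :
  (forall i, is_tpoly (F i)) -> is_tpoly (fun z => \sum_(i <- s) F i z).
Proof.
move=> H; elim: s => [|i s [r IH]].
  by exists [::] => z; rewrite /tpoly !big_nil.
have [r' H'] := H i; exists (r' ++ r) => z.
by rewrite big_cons H' IH /tpoly big_cat.
Qed.

Lemma is_tpoly_basis c j l : is_tpoly (fun z => c * zt_basis j l z).
Proof. by exists [:: (j, l, c)] => z; rewrite /tpoly big_seq1. Qed.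

(** A bound on the weight bounds every coordinate, and the list enumerates a cube. It supplies the
    finitely many rows kept in the approximation. *)
Lemma weight_finite (rho : R) : exists s : seq Z, forall k, weight R 1 k <= rho -> k \in s.
Proof.
pose r := Num.bound rho.
exists [seq (\row_i ((f i : int) - (r : int)) : Z) | f : {ffun 'I_n -> 'I_r.*2.+1}] => k kr.
have ki i : (`|k ord0 i| <= r)%N.
  have : `|(k ord0 i)%:~R : R| <= r%:R.
    apply: le_trans (ltW (archi_boundP _)); last first.
      by rewrite (le_trans _ kr)// ltW// weight_gt0.
    apply: le_trans kr; rewrite /weight expr1 (bigD1 i)//=.
    by rewrite addrCA lerDl addr_ge0// sumr_ge0.
  by rewrite -intr_norm -[r%:R]/((r : int)%:~R) ler_int -abszE lez_nat.
apply/mapP; exists [ffun i => inord (absz (k ord0 i + (r : int)))]; first by rewrite mem_enum.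
apply/rowP => i; rewrite mxE ffunE; have := ki i => kri.
rewrite inordK; last by rewrite ltnS -addnn; lia.
by move: kri; rewrite -[LHS]/(k ord0 i); move: (k ord0 i) => t; lia.
Qed.

Lemma Tperiodic_partials s (f : T -> C) : Tperiodic f -> Tperiodic (partials s f).
Proof.
move=> pf w k.
have E : f = (fun v => f (v - (- map_mx intr k))).
  by apply/funext => v; rewrite opprK pf.
by rewrite {2}E partials_shift opprK.
Qed.

Section fejer_partials.
Variables (f : T -> C).
Hypotheses (sf : Tsmooth f) (pf : Tperiodic f)
  (bf : forall t, exists B, forall w, normc (partials t f w) <= B).

Lemma coef_partials s l : coef (partials s f) l = (\prod_(i <- s) freq R l i) * coef f l.
Proof.
elim: s => [|i s IH]; first by rewrite big_nil mul1r.
have [A hA] := bf s; have [B hB] := bf (i :: s).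
rewrite [LHS](@coef_partial R n i (partials s f) l A B)//.
- by rewrite IH big_cons mulrA.
- exact: Tsmooth_partials.
- exact: Tperiodic_partials.
Qed.

(** Differentiating e_l produces the factor [freq R l i], and by integration by parts the same
    factor appears in the l-th coefficient of the derivative. *)
Lemma partials_fejer N s : partials s (fejer N f) = fejer N (partials s f).
Proof.
have sm l : Tsmooth (fun w : T => coef f l * echar l w).
  by apply: TsmoothZ; exact: Tsmooth_echar.
rewrite /fejer partialsZ; last by apply: Tsmooth_sum => a _; apply: Tsmooth_sum => b _.
apply/funext => w; congr (_ * _).
rewrite (@partials_sum R n _ _ _ (fun a w =>
  \sum_b coef f (box_pt a - box_pt b) * echar (box_pt a - box_pt b) w)); last first.
  by move=> a _; exact: Tsmooth_sum.
apply: eq_bigr => a _.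
rewrite (@partials_sum R n _ _ _ (fun b w =>
  coef f (box_pt a - box_pt b) * echar (box_pt a - box_pt b) w))//.
apply: eq_bigr => b _; rewrite partialsZ; last exact: Tsmooth_echar.
by rewrite partials_echar coef_partials mulrA [coef _ _ * _]mulrC.
Qed.

End fejer_partials.

Lemma ZTschwartz_partials_bounded phi j : ZTschwartz phi ->
  forall t, exists B, forall w, normc (partials t (fun v => phi (j, v)) w) <= B.
Proof.
move=> [_ _ b] t; have [B hB] := b (size t); exists B => w.
apply: le_trans (hB t j w (leqnn _)).
by rewrite ler_peMl ?normc_ge0// weight_ge1.
Qed.

(** Finitely many rows are replaced by their Fejer means and the others by 0. Decay makes the
    discarded rows small, and the uniform Fejer rate handles the kept ones together with their
    derivatives up to order M. *)
Lemma tpoly_dense phi M (e : R) : ZTschwartz phi -> 0 < e ->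
  exists r, ZTbound M (fun z => phi z - tpoly r z) e.
Proof.
move=> hphi e0; have [p s b] := hphi.
(* The seminorm of order M + 1 serves twice: its extra power of the weight gives smallness far out,
   and its extra derivative is the Lipschitz constant required by [fejer_approx]. *)
have [B hB] := b M.+1; have B0 := ZTbound_ge0 hB.
have B10 : 0 < B + 1 by rewrite ltr_wpDl.
have e'0 : 0 < e / (B + 1) by rewrite divr_gt0.
have [N HN] := fejer_approx n e'0.
(* Outside F the first-order weight exceeds (B + 1) / e, so the seminorm of order M of a discarded
   row is below e. B + 1 stands for B because B may be 0. *)
have [F HF] := weight_finite ((B + 1) / e).
pose P (z : ZT) := \sum_(j <- undup F) \sum_(a : {ffun 'I_n -> 'I_N.+1})
   \sum_(b : {ffun 'I_n -> 'I_N.+1})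
   ((box_card R n N)^-1%:C * coef (fun v => phi (j, v)) (box_pt a - box_pt b)) *
     zt_basis j (box_pt a - box_pt b) z.
have [r Hr] : is_tpoly P.
  apply: is_tpoly_sum => j; apply: is_tpoly_sum => a; apply: is_tpoly_sum => b'.
  exact: is_tpoly_basis.
have PE j : (fun v => P (j, v)) =
    if j \in F then fejer N (fun v => phi (j, v)) else (fun _ => 0).
  apply/funext => v; rewrite /P /zt_basis /=.
  have [jF|jF] := boolP (j \in F).
    rewrite (bigD1_seq j) ?undup_uniq ?mem_undup//= eqxx.
    rewrite [X in _ + X]big1 ?addr0; last first.
      move=> i ij; rewrite big1// => a _; rewrite big1// => b' _.
      by rewrite eq_sym (negbTE ij) mulr0.
    rewrite /fejer mulr_sumr; apply: eq_bigr => a _; rewrite mulr_sumr.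
    by apply: eq_bigr => b' _; rewrite mulrA.
  rewrite big_seq big1// => i; rewrite mem_undup => iF.
  rewrite big1// => a _; rewrite big1// => b' _.
  case: eqVneq => [ji|_]; last by rewrite mulr0.
  by move: jF; rewrite ji iF.
exists r.
have -> : (fun z => phi z - tpoly r z) = (fun z => phi z - P z).
  by apply/funext => z; rewrite Hr.
move=> t k w tM /=.
have sP : Tsmooth (fun v => P (k, v)).
  have [_ sr _] := ZTschwartz_tpoly r.
  by under eq_fun do rewrite Hr; exact: sr.
have W0 := weight_gt0 R M k.
have -> : partials t (fun v => phi (k, v) - P (k, v)) w =
   partials t (fun v => phi (k, v)) w - partials t (fun v => P (k, v)) w.
  rewrite (_ : (fun v => phi (k, v) - P (k, v)) = (fun v => phi (k, v) + (-1) * P (k, v))).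
    by rewrite partialsD//; [rewrite partialsZ// mulN1r|exact: TsmoothZ].
  by apply/funext => v; rewrite mulN1r.
rewrite PE; case: ifPn => [kF|kF]; last first.
  rewrite partials0 subr0.
  have := hB t k w (leqW tM).
  have : (B + 1) / e < weight R 1 k.
    by rewrite ltNge; apply: contra kF => /HF.
  rewrite ltr_pdivrMr// => HW.
  rewrite /weight exprS -mulrA => H1.
  have {HW} HW : B + 1 < (1 + \sum_(i < n) `|(k ord0 i)%:~R|) * e.
    by move: HW; rewrite /weight expr1.
  set x := 1 + _ in HW H1 *; set y := _ * normc _ in H1 *.
  rewrite leNgt; apply/negP => ey.
  have x0 : 0 < x by rewrite -(pmulr_lgt0 _ e0) (lt_trans B10).
  have : x * e < x * y by rewrite ltr_pM2l.
  by move=> xy; have := lt_trans HW (lt_le_trans xy H1); rewrite -subr_gt0; lra.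
rewrite partials_fejer//; last exact: ZTschwartz_partials_bounded.
rewrite -normcN opprB -ler_pdivlMl//.
have [A hA] := ZTschwartz_partials_bounded k hphi t.
have H := HN (partials t (fun v => phi (k, v))) A (B / weight R M k).
apply: le_trans (H _ _ _ hA _ w) _.
- exact: Tsmooth_partials.
- exact: Tperiodic_partials.
- by rewrite divr_ge0// ltW.
- move=> i v; rewrite ler_pdivlMr// mulrC.
  apply: le_trans (hB (i :: t) k v _) => //=.
  by rewrite ler_wpM2r ?normc_ge0// weight_le.
- rewrite mulrA [leRHS]mulrC ler_wpM2r ?invr_ge0 ?(ltW W0)//.
  by rewrite mulrAC ler_pdivrMr// ler_wpM2l// ?(ltW e0)// lerDl.
Qed.

(** Uniqueness of Fourier series: if all coefficients of a row vanished, so would its Fejer means,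
    and the uniform rate would make the row smaller than its own value at w. *)
Lemma coef_neq0 phi : ZTschwartz phi -> (exists z, phi z != 0) ->
  exists j l, coef (fun v => phi (j, v)) l != 0.
Proof.
move=> hphi [[j w] /= nz]; exists j; apply: contrapT => nc.
have c0 l : coef (fun v => phi (j, v)) l = 0.
  by apply: contrapT => /eqP h; apply: nc; exists l.
have [p s b] := hphi; have [B hB] := b 1%N; have B0 := ZTbound_ge0 hB.
have B10 : 0 < B + 1 by rewrite ltr_wpDl.
have nz' : 0 < normc (phi (j, w)) by rewrite normc_gt0.
have e0 : 0 < normc (phi (j, w)) / (B + 1) by rewrite divr_gt0.
have [N HN] := fejer_approx n e0.
have [A hA] := ZTschwartz_partials_bounded j hphi [::].
have := HN _ A B (s j) (p j) B0 hA _ w.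
rewrite {1}/fejer big1 ?mulr0; last first.
  by move=> a _; rewrite big1// => b' _; rewrite c0 mul0r.
rewrite sub0r normcN mulrAC ler_pdivlMr// ler_pM2l// => H.
suff : B + 1 <= B by lra.
apply: H => i v; apply: le_trans (hB [:: i] j v _) => //=.
by rewrite ler_peMl ?normc_ge0// weight_ge1.
Qed.

End schwartz.

(** * The symbol *)

Section symbol_coefficients.
Context (R : realType) (n : nat).
Local Notation Z := (Zn n).
Local Notation T := (Tn R n).
Local Notation C := R[i].
Local Notation ZT := (Z * T)%type.
Implicit Types (phi psi : ZT -> C).

Variable u : (ZT -> C) -> C.
Hypothesis hu : ZTtempered u.

Let u_lin a phi psi : ZTschwartz phi -> ZTschwartz psi ->
  u (fun z => a * phi z + psi z) = a * u phi + u psi.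
Proof. by case: hu => + _; apply. Qed.

Lemma tempered0 : u (fun _ => 0) = 0.
Proof.
have /(@esym _ _ _) := u_lin 1 (@ZTschwartz0 R n) (@ZTschwartz0 R n).
rewrite (_ : (fun _ => 1 * 0 + 0) = (fun _ => 0)); last first.
  by apply/funext => z; rewrite mulr0 addr0.
by rewrite mul1r => /eqP; rewrite -subr_eq0 addrK => /eqP.
Qed.

Lemma temperedB phi psi : ZTschwartz phi -> ZTschwartz psi ->
  u (fun z => phi z - psi z) = u phi - u psi.
Proof.
move=> h1 h2; have := u_lin (-1) h2 h1.
by under eq_fun do rewrite mulN1r addrC; rewrite mulN1r addrC.
Qed.

Lemma tempered_continuous : exists A N, 0 <= A /\ forall phi B,
  ZTschwartz phi -> ZTbound N phi B -> normc (u phi) <= A * B.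
Proof.
case: hu => _ [A [N H]]; exists `|A|, N; split=> // phi B h1 h2.
apply: le_trans (H phi B h1 h2) _; apply: ler_wpM2r; last exact: ler_norm.
exact: ZTbound_ge0 h2.
Qed.

(* The k-th Fourier coefficient of u(j, .), when u is a function. *)
Definition fcoef (j k : Z) : C := u (zt_basis j (- k)).

Lemma tempered_tpoly r : u (tpoly r) = \sum_(t <- r) t.2 * u (zt_basis t.1.1 t.1.2).
Proof.
elim: r => [|t r IH].
  rewrite big_nil -tempered0; congr u; apply/funext => z.
  by rewrite /tpoly big_nil.
rewrite big_cons -IH -u_lin; [|exact: ZTschwartz_basis|exact: ZTschwartz_tpoly].
by congr u; apply/funext => z; rewrite /tpoly big_cons.
Qed.

(** For such a window the transform is a finite trigonometric polynomial in (w, xi), obtained from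
    the linearity of u alone; its measurability and boundedness are then immediate. *)
Lemma tempered_tfmod_tpoly m w xi k r : u (tfmod m w xi k (tpoly r)) =
  \sum_(t <- r) t.2^* * fcoef (t.1.1 + m) (k + t.1.2) *
    (echar (- (t.1.1 + m)) xi * echar t.1.2 w).
Proof.
elim: r => [|t r IH].
  rewrite big_nil -tempered0; congr u; apply/funext => z.
  by rewrite /tfmod /tpoly big_nil rmorph0 mulr0.
have E : tfmod m w xi k (tpoly (t :: r)) = (fun z =>
   (t.2^* * (echar (- (t.1.1 + m)) xi * echar t.1.2 w)) *
      zt_basis (t.1.1 + m) (- (k + t.1.2)) z + tfmod m w xi k (tpoly r) z).
  apply/funext => z.
  rewrite (_ : tpoly _ = fun z => t.2 * zt_basis t.1.1 t.1.2 z + tpoly r z); last first.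
    by apply/funext => z'; rewrite /tpoly big_cons.
  rewrite tfmod_lin tfmod_basis [- (k + _)]opprD mulrA; congr (_ + _).
  by rewrite /echar dotNr !mulrA.
rewrite E u_lin; [|exact: ZTschwartz_basis|].
  by rewrite IH big_cons -/(fcoef _ _); congr (_ + _); rewrite mulrAC.
by apply: ZTschwartz_tfmod; exact: ZTschwartz_tpoly.
Qed.

Lemma coef_tpoly (r : seq (Z * Z * C)) (j l : Z) : coef (fun v : T => tpoly r (j, v)) l =
  \sum_(t <- r) t.2 * (if (t.1.1 == j) && (t.1.2 == l) then 1 else 0).
Proof.
rewrite /coef.
have I t : cintegrable (haar R n) (fun w : T => t * echar (- l) w).
  apply: (@cintegrable_bounded _ _ _ _ _ (normc t)) => [|w].
    by apply: cmeasurableM; [exact: cmeasurable_cst|exact: cmeasurable_echar].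
  by rewrite normcM normc_echar mulr1.
have I2 (t : Z * Z * C) : cintegrable (haar R n)
    (fun w : T => t.2 * (zt_basis t.1.1 t.1.2 (j, w) * echar (- l) w)).
  apply: cintegrableZ; rewrite /zt_basis /=; case: eqVneq => _.
    apply: (@cintegrable_coef _ _ _ 1) => [|w]; first exact: cmeasurable_echar.
    by rewrite normc_echar.
  by under eq_fun do rewrite mul0r; exact: cintegrable0.
under eq_cintegral do rewrite /tpoly mulr_suml.
under eq_cintegral do under eq_bigr do rewrite -mulrA.
rewrite cintegral_sum//; apply: eq_bigr => t _.
rewrite cintegralZ; last first.
  rewrite /zt_basis /=; case: eqVneq => _.
    apply: (@cintegrable_coef _ _ _ 1) => [|w]; first exact: cmeasurable_echar.
    by rewrite normc_echar.
  by under eq_fun do rewrite mul0r; exact: cintegrable0.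
congr (_ * _); rewrite /zt_basis /= eq_sym; case: eqVneq => [_|_] /=.
  exact: coef_echar.
by under eq_cintegral do rewrite mul0r; exact: cintegral0.
Qed.

(** Integrating the transform against e_(j+m) in xi and e_(-l) in w keeps exactly the terms of index
    (j, l). They share the factor [fcoef u (j + m) (k + l)], and the conjugates of their scalars add
    up to the conjugate of the (j, l) coefficient of the window. *)
Lemma coef_tpoly_le (r : seq (Z * Z * C)) (m k j l : Z) :
  ((normc (coef (fun v : T => tpoly r (j, v)) l) * normc (fcoef (j + m) (k + l)))%:E <=
  \int[haar R n]_w \int[haar R n]_xi (normc (u (tfmod m w xi k (tpoly r))))%:E)%E.
Proof.
pose V (z : T * T) : C := \sum_(t <- r) t.2^* * fcoef (t.1.1 + m) (k + t.1.2) *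
    (echar (- (t.1.1 + m)) z.2 * echar t.1.2 z.1).
have VE w xi : u (tfmod m w xi k (tpoly r)) = V (w, xi) by exact: tempered_tfmod_tpoly.
under eq_integral do under eq_integral do rewrite VE.
have mV : cmeasurable V.
  apply: cmeasurable_sum => t _; apply: cmeasurableM; first exact: cmeasurable_cst.
  apply: cmeasurableM.
    by apply: (@cmeasurable_comp _ _ _ _ _ snd) => //; exact: cmeasurable_echar.
  by apply: (@cmeasurable_comp _ _ _ _ _ fst) => //; exact: cmeasurable_echar.
have bV z : normc (V z) <= \sum_(t <- r) normc (t.2^* * fcoef (t.1.1 + m) (k + t.1.2)).
  rewrite (le_trans (normc_sum _ _ _))//; apply: ler_sum => t _.
  by rewrite normcM [normc (echar _ _ * _)]normcM !normc_echar !mulr1.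
(* The xi integral selects row j of the window and leaves a trigonometric polynomial in w. *)
pose W (w : T) := cintegral (haar R n) (fun xi => V (w, xi) * echar (j + m) xi).
have mVw w : cmeasurable (fun xi => V (w, xi)) by exact: cmeasurable_pair1.
have WE w : W w = \sum_(t <- r) (t.2^* * fcoef (t.1.1 + m) (k + t.1.2) *
    (if t.1.1 == j then 1 else 0)) * echar t.1.2 w.
  have E xi : V (w, xi) * echar (j + m) xi =
     \sum_(t <- r) (t.2^* * fcoef (t.1.1 + m) (k + t.1.2) * echar t.1.2 w) *
       echar (j - t.1.1) xi.
    rewrite /V mulr_suml; apply: eq_bigr => t _ /=.
    rewrite (_ : j - t.1.1 = j + m - (t.1.1 + m)); last by rewrite opprD addrACA subrr addr0.
    by rewrite [echar (j + m - _) _]echarD; ring.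
  have I a : cintegrable (haar R n) (fun w : T => echar a w).
    apply: (@cintegrable_bounded _ _ _ _ _ 1) => [|v]; first exact: cmeasurable_echar.
    by rewrite normc_echar.
  rewrite /W (eq_cintegral _ E) cintegral_sum; last by move=> t _; exact: cintegrableZ.
  apply: eq_bigr => t _; rewrite cintegralZ// haar_char subr_eq0 eq_sym.
  by rewrite mulrAC.
have mW : cmeasurable W.
  rewrite (funext WE).
  apply: cmeasurable_sum => t _; apply: cmeasurableM; first exact: cmeasurable_cst.
  exact: cmeasurable_echar.
have iVw w : cintegrable (haar R n) (fun xi => V (w, xi) * echar (j + m) xi).
  by apply: cintegrable_coef => // xi; exact: bV.
have WV w : ((normc (W w))%:E <= \int[haar R n]_xi (normc (V (w, xi)))%:E)%E.
  apply: le_trans (normc_cintegral (iVw w)) _.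
  rewrite le_eqVlt; apply/orP; left; apply/eqP; apply: eq_integral => xi _.
  by rewrite normcM normc_echar mulr1.
(* The w integral then selects frequency l. Indices may repeat in the list r, so the whole sum of
   their scalars is what appears. *)
have CW : coef W l = (coef (fun v : T => tpoly r (j, v)) l)^* * fcoef (j + m) (k + l).
  rewrite coef_tpoly /coef.
  have I a : cintegrable (haar R n) (fun w : T => echar a w * echar (- l) w).
    apply: (@cintegrable_coef _ _ _ 1) => [|v]; first exact: cmeasurable_echar.
    by rewrite normc_echar.
  have E w : W w * echar (- l) w = \sum_(t <- r) (t.2^* *
      fcoef (t.1.1 + m) (k + t.1.2) * (if t.1.1 == j then 1 else 0)) *
      (echar t.1.2 w * echar (- l) w).
    by rewrite WE mulr_suml; apply: eq_bigr => t _; rewrite -!mulrA.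
  rewrite (eq_cintegral _ E) cintegral_sum; last by move=> t _; exact: cintegrableZ.
  rewrite rmorph_sum/= mulr_suml; apply: eq_bigr => t _.
  rewrite cintegralZ// -/(coef _ l) coef_echar rmorphM/=.
  case: (eqVneq t.1.1 j) => [->|_]/=; last by rewrite rmorph0 !mulr0 !mul0r.
  case: (eqVneq t.1.2 l) => [->|_]/=; last by rewrite rmorph0 !mulr0 !mul0r.
  by rewrite rmorph1; ring.
rewrite -(normc_conjc (coef _ _)) -normcM -CW.
have iW : cintegrable (haar R n) (fun w => W w * echar (- l) w).
  apply: (@cintegrable_coef _ _ _ (\sum_(t <- r) normc (t.2^* *
    fcoef (t.1.1 + m) (k + t.1.2) * (if t.1.1 == j then 1 else 0)))) => // w.
  rewrite WE (le_trans (normc_sum _ _ _))//; apply: ler_sum => t _.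
  by rewrite normcM normc_echar mulr1.
apply: le_trans (normc_cintegral iW) _.
apply: ge0_le_integral => //.
- by move=> w _; rewrite lee_fin normc_ge0.
- by apply: cmeasurable_normcE; exact: cintegrable_meas iW.
- apply: (measurable_fun_fubini_tonelli_F (fun z => (normc (V z))%:E)).
    exact: cmeasurable_normcE.
  by move=> z; rewrite lee_fin normc_ge0.
- by move=> w _; rewrite normcM normc_echar mulr1.
Qed.

End symbol_coefficients.

(** * Absolute summability of the coefficients of the symbol *)

Section symbol.
Context (R : realType) (n : nat).
Local Notation Z := (Zn n).
Local Notation T := (Tn R n).
Local Notation C := R[i].
Local Notation ZT := (Z * T)%type.
Implicit Types (phi psi : ZT -> C).

Variable u : (ZT -> C) -> C.
Hypothesis hu : ZTtempered u.

Lemma tfmodB m w xi k phi psi z :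
  tfmod m w xi k (fun z => phi z - psi z) z =
  tfmod m w xi k phi z - tfmod m w xi k psi z.
Proof. by rewrite /tfmod rmorphB/=; ring. Qed.

Section window.
Variable G : ZT -> C.
Hypothesis hG : ZTschwartz G.
Hypothesis G_neq0 : exists z, G z != 0.
Hypothesis mV : cmeasurable (stftZT G u).
Hypothesis fV : (\int[(muZT R n \x muTZ R n)%E]_z (normc (stftZT G u z))%:E < +oo)%E.

Local Notation V m w xi k := (stftZT G u ((m, w), (xi, k))).

Let mV' m k : cmeasurable (fun z : T * T => V m z.1 z.2 k).
Proof.
apply: (@cmeasurable_comp _ _ _ _ _ (fun z : T * T => ((m, z.1), (z.2, k)))) => //.
by apply: measurable_fun_pair; exact: measurable_fun_pair.
Qed.

(* [coef_tpoly_le] passes to the limit in the window, by density. *)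
Lemma coef_window_le m k j l :
  ((normc (coef (fun v => G (j, v)) l) * normc (fcoef u (j + m) (k + l)))%:E <=
  \int[haar R n]_w \int[haar R n]_xi (normc (V m w xi k))%:E)%E.
Proof.
have [A [N [A0 HA]]] := tempered_continuous hu.
set c := normc (fcoef u (j + m) (k + l)).
have c0 : 0 <= c by exact: normc_ge0.
(* D bounds the effect on the transform of a window error, for all w and xi at once; c does the same
   for the coefficient on the left. The tolerance e / (D + c + 1) absorbs both, since [haar] has
   mass 1. *)
pose D := A * (weight R N m * freq_bound R (- k) ^+ N).
have D0 : 0 <= D.
  rewrite !mulr_ge0 ?(ltW (weight_gt0 _ _ _))// exprn_ge0//.
  by rewrite (le_trans ler01)// freq_bound_ge1.
apply/lee_addgt0Pr => e e0.
have K0 : 0 < D + c + 1 by rewrite ltr_wpDl// addr_ge0.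
pose e' := e / (D + c + 1).
have e'0 : 0 < e' by rewrite divr_gt0.
have [r hr] := tpoly_dense N hG e'0.
have hd : ZTschwartz (fun z => G z - tpoly r z).
  by apply: ZTschwartzB => //; exact: ZTschwartz_tpoly.
have H1 w xi : normc (u (tfmod m w xi k (tpoly r))) <= normc (V m w xi k) + D * e'.
  have -> : u (tfmod m w xi k (tpoly r)) =
     V m w xi k - u (tfmod m w xi k (fun z => G z - tpoly r z)).
    rewrite -(temperedB hu).
    - congr u; apply/funext => z; rewrite tfmodB.
      by rewrite -/(tfmod m w xi k G z) subKr.
    - exact: ZTschwartz_tfmod.
    - exact: ZTschwartz_tfmod.
  rewrite (le_trans (le_normcD _ _))// lerD2l normcN.
  apply: le_trans (HA _ _ (ZTschwartz_tfmod _ _ _ _ hd) (ZTbound_tfmod _ _ _ _ _ hr)) _.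
    by case: hd.
  by rewrite /D -[leRHS]mulrA ler_wpM2l// mulrC.
have H2 : normc (coef (fun v => G (j, v)) l) <= normc (coef (fun v : T => tpoly r (j, v)) l) + e'.
  have sd : Tsmooth (fun v => G (j, v) - tpoly r (j, v)) by case: hd => _ + _; apply.
  have sP : Tsmooth (fun v : T => tpoly r (j, v)) by have [_ + _] := ZTschwartz_tpoly r; apply.
  have [B B0 bG] := ZTschwartz_bounded hG.
  have [B' B'0 bP] := ZTschwartz_bounded (ZTschwartz_tpoly (R := R) r).
  have -> : coef (fun v => G (j, v)) l = coef (fun v : T => tpoly r (j, v)) l +
      coef (fun v => G (j, v) - tpoly r (j, v)) l.
    rewrite /coef -cintegralD.
    - by apply: eq_cintegral => v; ring.
    - exact: (cintegrable_coef _ (Tsmooth_cmeasurable sP) (fun v => bP (j, v))).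
    - apply: (cintegrable_coef _ (Tsmooth_cmeasurable sd) (B := e')) => v.
      exact: (ZTbound_sup (j, v) hr).
  rewrite (le_trans (le_normcD _ _))// lerD2l.
  apply: (normc_coef _ (Tsmooth_cmeasurable sd)) => v.
  exact: (ZTbound_sup (j, v) hr).
apply: (@le_trans _ _ ((normc (coef (fun v : T => tpoly r (j, v)) l) * c)%:E + (e' * c)%:E)%E).
  by rewrite -EFinD lee_fin -mulrDl ler_wpM2r.
apply: (@le_trans _ _ (\int[haar R n]_w \int[haar R n]_xi (normc (V m w xi k))%:E + (D * e')%:E + (e' * c)%:E)%E).
  rewrite leeD2r//.
  apply: le_trans (coef_tpoly_le hu r m k j l) _.
  have mP : cmeasurable (fun z : T * T => u (tfmod m z.1 z.2 k (tpoly r))).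
    under eq_fun do rewrite tempered_tfmod_tpoly//.
    apply: cmeasurable_sum => t _; apply: cmeasurableM; first exact: cmeasurable_cst.
    apply: cmeasurableM.
      by apply: (@cmeasurable_comp _ _ _ _ _ snd) => //; exact: cmeasurable_echar.
    by apply: (@cmeasurable_comp _ _ _ _ _ fst) => //; exact: cmeasurable_echar.
  have H3 (f g : T -> \bar R) (b : R) : measurable_fun setT f -> measurable_fun setT g ->
      (forall x, 0 <= f x)%E -> (forall x, 0 <= g x)%E -> 0 <= b ->
      (forall x, f x <= g x + b%:E)%E ->
      (\int[haar R n]_x f x <= \int[haar R n]_x g x + b%:E)%E.
    move=> mf mg f0 g0 b0 fg.
    apply: (@le_trans _ _ (\int[haar R n]_x (g x + b%:E)))%E.
      apply: ge0_le_integral => //.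
      by apply: emeasurable_funD => //; exact: measurable_cst.
    by rewrite ge0_integralD// integral_probability_cst.
  have nn (x : C) : (0 <= (normc x)%:E)%E by rewrite lee_fin normc_ge0.
  apply: (H3).
  - exact: (measurable_fun_fubini_tonelli_F (fun z : T * T =>
      (normc (u (tfmod m z.1 z.2 k (tpoly r))))%:E) (cmeasurable_normcE mP)).
  - exact: (measurable_fun_fubini_tonelli_F (fun z : T * T =>
      (normc (V m z.1 z.2 k))%:E) (cmeasurable_normcE (mV' m k))).
  - by move=> w; apply: integral_ge0.
  - by move=> w; apply: integral_ge0.
  - by rewrite mulr_ge0// ltW.
  move=> w; apply: H3 => //.
  - exact: cmeasurable_normcE (cmeasurable_pair1 w mP).
  - exact: cmeasurable_normcE (cmeasurable_pair1 w (mV' m k)).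
  - by rewrite mulr_ge0// ltW.
  - by move=> xi; rewrite -EFinD lee_fin.
rewrite -addeA leeD2l// -EFinD lee_fin mulrC -mulrDr.
rewrite /e' mulrAC ler_pdivrMr// ler_wpM2l ?(ltW e0)// lerDl//.
Qed.

(** Fix a non-zero coefficient (j, l) of the window and sum [coef_window_le] over m and k. By
    translation invariance the shifts j + m and k + l run over the whole lattice, and the right-hand
    sides add up to the L^1 norm of the transform. *)
Lemma fcoef_summable :
  (\int[countZ R n]_j \int[countZ R n]_k (normc (fcoef u j k))%:E < +oo)%E.
Proof.
have [j [l jl0]] := coef_neq0 hG G_neq0.
pose a := normc (coef (fun v => G (j, v)) l).
have a0 : 0 < a by rewrite normc_gt0.
have nonneg (x : C) : (0 <= (normc x)%:E)%E by rewrite lee_fin normc_ge0.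
suff H : (a%:E * \int[countZ R n]_j \int[countZ R n]_k (normc (fcoef u j k))%:E < +oo)%E.
  rewrite ltNge leye_eq; apply/negP => /eqP E; move: H.
  by rewrite E gt0_muley ?lte_fin.
apply: le_lt_trans fV.
have mVm m : cmeasurable (fun z : T * (T * Z) => stftZT G u ((m, z.1), z.2)).
  apply: (@cmeasurable_comp _ _ _ _ _ (fun z : T * (T * Z) => ((m, z.1), z.2))) => //.
  by apply: measurable_fun_pair; [exact: measurable_fun_pair|exact: measurable_snd].
have mN := cmeasurable_normcE mV.
rewrite (fubini_tonelli1 (fun z => (normc (stftZT G u z))%:E))// /fubini_F.
pose H1 (z : ZT) := (\int[muTZ R n]_y (normc (stftZT G u (z, y)))%:E)%E.
have mH1 : measurable_fun setT H1.
  exact: (measurable_fun_fubini_tonelli_F (fun z => (normc (stftZT G u z))%:E)).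
have H10 z : (0 <= H1 z)%E by apply: integral_ge0.
rewrite (fubini_tonelli1 H1)// /fubini_F.
rewrite -ge0_integralZl//; [|by move=> k _; apply: integral_ge0|by rewrite lee_fin ltW].
rewrite -(@integral_countZ_shift' R n j) ; last first.
  by move=> k; rewrite mule_ge0// ?lee_fin ?(ltW a0)//; apply: integral_ge0.
apply: ge0_le_integral => //.
- by move=> m _; rewrite mule_ge0// ?lee_fin ?(ltW a0)//; apply: integral_ge0.
move=> m _.
(* Tonelli moves the sum over k outside both torus integrals, the form in which [coef_window_le]
   applies for each m and k. *)
have -> : (\int[haar R n]_w H1 (m, w) =
   \int[countZ R n]_k \int[haar R n]_w \int[haar R n]_xi (normc (V m w xi k))%:E)%E.
  pose F3 (z : T * Z) := (\int[haar R n]_xi (normc (V m z.1 xi z.2))%:E)%E.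
  have mF3 : measurable_fun setT F3.
    apply: (measurable_fun_fubini_tonelli_F (fun z : (T * Z) * T =>
      (normc (V m z.1.1 z.2 z.1.2))%:E)) => //.
    apply: cmeasurable_normcE.
    apply: (@cmeasurable_comp _ _ _ _ _ (fun z : (T * Z) * T => (z.1.1, (z.2, z.1.2)))
      (fun y : T * (T * Z) => stftZT G u ((m, y.1), y.2))) => //.
    apply: measurable_fun_pair; first by apply: measurableT_comp.
    by apply: measurable_fun_pair => //; apply: measurableT_comp.
  rewrite -(fubini_tonelli F3)//; last by move=> z; apply: integral_ge0.
  apply: eq_integral => w _; rewrite /H1.
  rewrite (fubini_tonelli1 (fun z => (normc (stftZT G u ((m, w), z)))%:E))//; last first.
    exact: cmeasurable_normcE (cmeasurable_pair1 _ mV).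
  rewrite /fubini_F (fubini_tonelli (fun z => (normc (stftZT G u ((m, w), z)))%:E))//.
  exact: cmeasurable_normcE (cmeasurable_pair1 _ mV).
rewrite -(@integral_countZ_shift' R n l); last by move=> k.
rewrite -ge0_integralZl//; last by rewrite lee_fin ltW.
apply: ge0_le_integral => //.
- by move=> k _; rewrite mule_ge0// lee_fin ltW.
- by move=> k _; rewrite -EFinM [(l + k)%R]addrC; exact: coef_window_le.
Qed.

End window.

End symbol.

Section bounded_multiplier.
Context d (X : measurableType d) (R : realType).
Variable mu : {measure set X -> \bar R}.
Implicit Types f g : X -> R[i].

Lemma integral_mul_bounded f g (B : R) : cmeasurable f -> cmeasurable g ->
  0 <= B -> (forall x, normc (g x) <= B) ->
  (\int[mu]_x (normc (f x * g x))%:E <= B%:E * \int[mu]_x (normc (f x))%:E)%E.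
Proof.
move=> mf mg B0 gB; rewrite -ge0_integralZl//.
- apply: ge0_le_integral => //.
  + by move=> x _; rewrite lee_fin normc_ge0.
  + by apply: cmeasurable_normcE; exact: cmeasurableM.
  + by apply: measurable_funeM; exact: cmeasurable_normcE.
  + move=> x _; rewrite -EFinM lee_fin normcM mulrC.
    by rewrite ler_wpM2r ?normc_ge0.
- exact: cmeasurable_normcE.
- by move=> x _; rewrite lee_fin normc_ge0.
Qed.

Lemma cintegrable_mul_bounded f g (B : R) : cintegrable mu f -> cmeasurable g ->
  (forall x, normc (g x) <= B) -> cintegrable mu (fun x => f x * g x).
Proof.
move=> fi mg gB; have [mf ff] := (cintegrableP mu f).1 fi.
apply/cintegrableP; split; first exact: cmeasurableM.
have gB' x : normc (g x) <= Num.max B 0 by rewrite le_max gB.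
have B0 : 0 <= Num.max B 0 by rewrite le_max lexx orbT.
apply: le_lt_trans (integral_mul_bounded mf mg B0 gB') _.
have I0 : (0 <= \int[mu]_x (normc (f x))%:E)%E.
  by apply: integral_ge0 => x _; rewrite lee_fin normc_ge0.
by rewrite lte_mul_pinfty// lee_fin.
Qed.

End bounded_multiplier.

(** * From summable coefficients to a function representing the distribution *)

Section fourier_symbol.
Context (R : realType) (n : nat).
Local Notation Z := (Zn n).
Local Notation T := (Tn R n).
Local Notation C := R[i].
Local Notation ZT := (Z * T)%type.

Variable c : Z -> Z -> C.
Hypothesis csum : (\int[countZ R n]_j \int[countZ R n]_k (normc (c j k))%:E < +oo)%E.

Definition fsymbol (z : ZT) : C :=
  cintegral (countZ R n) (fun k => c z.1 k * echar k z.2).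

Let nn (x : C) : (0 <= (normc x)%:E)%E.
Proof. by rewrite lee_fin normc_ge0. Qed.

Lemma fsymbol_row j : (\int[countZ R n]_k (normc (c j k))%:E < +oo)%E.
Proof.
apply: le_lt_trans csum.
apply: (@le_integral_countZ R n (fun j => \int[countZ R n]_k (normc (c j k))%:E)%E).
by move=> k; apply: integral_ge0.
Qed.

Let cint_row j w : cintegrable (countZ R n) (fun k => c j k * echar k w).
Proof.
apply/cintegrableP; split; first exact: cmeasurable_Zn.
under eq_integral do rewrite normcM normc_echar mulr1.
exact: fsymbol_row.
Qed.

Lemma fsymbol_le j w :
  ((normc (fsymbol (j, w)))%:E <= \int[countZ R n]_k (normc (c j k))%:E)%E.
Proof.
apply: le_trans (normc_cintegral (cint_row j w)) _.
by under eq_integral do rewrite normcM normc_echar mulr1.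
Qed.

Lemma cmeasurable_fsymbol : cmeasurable fsymbol.
Proof.
apply: cmeasurable_ZnX => j.
apply: (@cmeasurable_param _ _ _ _ _ (countZ R n) (fun z : T * Z => c j z.2 * echar z.2 z.1)).
apply: (@cmeasurable_swap _ _ _ _ _ (fun z : Z * T => c j z.1 * echar z.1 z.2)).
apply: cmeasurable_ZnX => k /=; apply: cmeasurableM; first exact: cmeasurable_cst.
exact: cmeasurable_echar.
Qed.

Lemma integral_fsymbol : (\int[muZT R n]_z (normc (fsymbol z))%:E < +oo)%E.
Proof.
have mN := cmeasurable_normcE cmeasurable_fsymbol.
rewrite (fubini_tonelli1 (fun z => (normc (fsymbol z))%:E))// /fubini_F.
apply: le_lt_trans csum; apply: ge0_le_integral => //.
- by move=> j _; apply: integral_ge0.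
- move=> j _.
  apply: (@le_trans _ _ (\int[haar R n]_w (\int[countZ R n]_k (normc (c j k))%:E))%E).
    apply: ge0_le_integral => //.
    + exact: cmeasurable_normcE (cmeasurable_pair1 _ cmeasurable_fsymbol).
    + by move=> w _; exact: fsymbol_le.
  by rewrite integral_probability_cst.
Qed.

Lemma cintegrable_fsymbol : cintegrable (muZT R n) fsymbol.
Proof.
apply/cintegrableP; split; first exact: cmeasurable_fsymbol.
exact: integral_fsymbol.
Qed.

Lemma ZTschwartz_cmeasurable (phi : ZT -> C) : ZTschwartz phi -> cmeasurable phi.
Proof. by move=> [_ s _]; apply: cmeasurable_ZnX => k; exact: Tsmooth_cmeasurable. Qed.

Lemma cintegrable_fsymbol_mul (phi : ZT -> C) : ZTschwartz phi ->
  cintegrable (muZT R n) (fun z => fsymbol z * phi z).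
Proof.
move=> hphi; have [B _ hB] := ZTschwartz_bounded hphi.
apply: (cintegrable_mul_bounded _ _ hB); first exact: cintegrable_fsymbol.
exact: ZTschwartz_cmeasurable.
Qed.

(** The pairing of a distribution with a test function is bilinear, without conjugation, so e_l
    extracts the coefficient at -l; this explains the sign in [fcoef]. *)
Lemma cintegral_fsymbol_basis j l :
  cintegral (muZT R n) (fun z => fsymbol z * zt_basis j l z) = c j (- l).
Proof.
have I := cintegrable_fsymbol_mul (@ZTschwartz_basis R n j l).
have [_ <- _] := cfubini I.
rewrite (@cintegral_countZ_single R n j); last first.
  move=> i ij; rewrite /zt_basis /= (negbTE ij).
  by under eq_cintegral do rewrite mulr0; exact: cintegral0.
rewrite /zt_basis /= eqxx.
pose F (z : Z * T) := c j z.1 * echar z.1 z.2 * echar l z.2.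
have mF : cmeasurable F.
  apply: cmeasurable_ZnX => k; rewrite /F/=; apply: cmeasurableM; last exact: cmeasurable_echar.
  by apply: cmeasurableM; [exact: cmeasurable_cst|exact: cmeasurable_echar].
have iF : cintegrable (countZ R n \x haar R n)%E F.
  apply: cintegrable12 => //.
  apply: le_lt_trans (fsymbol_row j); apply: ge0_le_integral => //.
  - by move=> k _; apply: integral_ge0.
  - move=> k _; rewrite /F /=.
    under eq_integral do rewrite !normcM !normc_echar !mulr1.
    by rewrite integral_probability_cst.
have [_ e1 e2] := cfubini iF.
transitivity (cintegral (haar R n) (fun w => cintegral (countZ R n) (fun k => F (k, w)))).
  apply: eq_cintegral => w; rewrite /fsymbol mulrC -cintegralZ//.
  by apply: eq_cintegral => k; rewrite /F /= mulrC.
rewrite e2 -e1 (@cintegral_countZ_single R n (- l)).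
  have E w : F (- l, w) = c j (- l) by rewrite /F /= -mulrA -echarD addNr echar0 mulr1.
  by rewrite (eq_cintegral _ E) cintegral_cst.
move=> k kl; have E w : F (k, w) = c j k * echar (k + l) w.
  by rewrite /F /= -mulrA -echarD.
rewrite (eq_cintegral _ E) cintegralZ.
  by rewrite haar_char addr_eq0 (negbTE kl) mulr0.
apply: (@cintegrable_bounded _ _ _ _ _ 1) => [|v]; first exact: cmeasurable_echar.
by rewrite normc_echar.
Qed.

Lemma cintegral_fsymbol_tpoly r :
  cintegral (muZT R n) (fun z => fsymbol z * tpoly r z) =
  \sum_(t <- r) t.2 * c t.1.1 (- t.1.2).
Proof.
have I j l := cintegrable_fsymbol_mul (@ZTschwartz_basis R n j l).
have E z : fsymbol z * tpoly r z = \sum_(t <- r) t.2 * (fsymbol z * zt_basis t.1.1 t.1.2 z).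
  by rewrite /tpoly mulr_sumr; apply: eq_bigr => t _; rewrite mulrCA.
rewrite (eq_cintegral _ E) cintegral_sum; last by move=> t _; exact: cintegrableZ.
by apply: eq_bigr => t _; rewrite cintegralZ// cintegral_fsymbol_basis.
Qed.

Variable u : (ZT -> C) -> C.
Hypothesis hu : ZTtempered u.
Hypothesis uc : forall j k, c j k = fcoef u j k.

(** Both functionals agree on trigonometric polynomials. The first is controlled by a Schwartz
    seminorm and the second by the supremum of the test function, which that seminorm dominates, so
    density finishes. *)
Lemma represents_fsymbol : represents fsymbol u.
Proof.
split; first exact: cmeasurable_fsymbol.
move=> phi hphi; have Iphi := cintegrable_fsymbol_mul hphi; split=> //.
have [A [N [A0 HA]]] := tempered_continuous hu.
pose S := fine (\int[muZT R n]_z (normc (fsymbol z))%:E)%E.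
have S0 : 0 <= S by rewrite fine_ge0// integral_ge0.
have SE : (\int[muZT R n]_z (normc (fsymbol z))%:E)%E = S%:E.
  by rewrite fineK// ge0_fin_numE ?integral_fsymbol// integral_ge0.
set x := u phi; set y := cintegral _ _.
apply/eqP; rewrite -subr_eq0 -normc_eq0 eq_le normc_ge0 andbT.
apply/ler_addgt0Pr => e e0; rewrite add0r.
have K0 : 0 < A + S + 1 by rewrite ltr_wpDl// addr_ge0.
(* A is the continuity constant of u and S the L^1 norm of [fsymbol]; the two errors are at most A
   e' and S e'. *)
pose e' := e / (A + S + 1).
have e'0 : 0 < e' by rewrite divr_gt0.
have [r hr] := tpoly_dense N hphi e'0.
have hr' := ZTschwartz_tpoly (R := R) r.
have hd : ZTschwartz (fun z => phi z - tpoly r z) by exact: ZTschwartzB.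
have Id := cintegrable_fsymbol_mul hd.
have -> : x - y = u (fun z => phi z - tpoly r z) -
    cintegral (muZT R n) (fun z => fsymbol z * (phi z - tpoly r z)).
  have -> : cintegral (muZT R n) (fun z => fsymbol z * (phi z - tpoly r z)) =
     y - u (tpoly r).
    have -> : u (tpoly r) = cintegral (muZT R n) (fun z => fsymbol z * tpoly r z).
      rewrite cintegral_fsymbol_tpoly (tempered_tpoly hu); apply: eq_bigr => t _.
      by rewrite uc /fcoef opprK.
    rewrite -[LHS](addrK (cintegral (muZT R n) (fun z => fsymbol z * tpoly r z))).
    rewrite -cintegralD//; last exact: cintegrable_fsymbol_mul.
    by congr (_ - _); apply: eq_cintegral => z; ring.
  by rewrite (temperedB hu)// /x; ring.
rewrite (le_trans (le_normcD _ _))// normcN.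
have H1 : normc (u (fun z => phi z - tpoly r z)) <= A * e' by exact: HA.
have H2 : normc (cintegral (muZT R n) (fun z => fsymbol z * (phi z - tpoly r z))) <= e' * S.
  rewrite -lee_fin (le_trans (normc_cintegral Id))// EFinM -SE.
  apply: integral_mul_bounded => //.
  - exact: cmeasurable_fsymbol.
  - exact: ZTschwartz_cmeasurable.
  - exact: ltW.
  - by move=> z; exact: ZTbound_sup hr.
apply: (le_trans (lerD H1 H2)).
rewrite mulrC -mulrDr /e' mulrAC ler_pdivrMr// ler_wpM2l ?(ltW e0)//.
by rewrite lerDl.
Qed.

End fourier_symbol.

(** * Modulation spaces of the lattice *)

Section mixture.
Context (R : realType) (n : nat) d (X : measurableType d).
Variable mu : {sigma_finite_measure set X -> \bar R}.
Local Open Scope ereal_scope.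

Lemma le_poweR (x y : \bar R) (r : R) : (0 <= r)%R -> 0 <= x -> x <= y ->
  x `^ r <= y `^ r.
Proof.
move=> r0 x0 xy; apply: (gt0_ler_poweR r0) => //.
  by rewrite in_itv/= x0 leey.
by rewrite in_itv/= (le_trans x0)//= leey.
Qed.

(* Jensen for the weight a, then Tonelli; for a translation-invariant b this is
   Young's convolution inequality. *)
Lemma lp_mixture (p : R) (a : X -> R) (b : Zn n -> X -> R) (M : \bar R) :
  (1 < p)%R -> measurable_fun setT a -> (forall k, measurable_fun setT (b k)) ->
  (forall x, 0 <= a x)%R -> (forall k x, 0 <= b k x)%R ->
  \int[mu]_x (a x)%:E < +oo -> 0 <= M ->
  (forall x, \int[countZ R n]_k (b k x `^ p)%:E <= M) ->
  \int[countZ R n]_k (\int[mu]_x (a x * b k x)%:E) `^ p <=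
  (\int[mu]_x (a x)%:E) `^ (p - 1) * ((\int[mu]_x (a x)%:E) * M).
Proof.
move=> p1 ma mb a0 b0 afin M0 bM.
set A := \int[mu]_x (a x)%:E.
have mbp k : measurable_fun setT (fun x => (b k x `^ p)%R).
  exact: (measurableT_comp (measurable_powR p) (mb k)).
pose F (z : Zn n * X) := (a z.2 * b z.1 z.2 `^ p)%:E.
have mF : measurable_fun setT F.
  by apply: measurable_fun_ZnX => k; apply/measurable_EFinP; exact: (measurable_funM ma (mbp k)).
have F0 z : 0 <= F z by rewrite lee_fin mulr_ge0// powR_ge0.
apply: (@le_trans _ _ (\int[countZ R n]_k (A `^ (p - 1) * \int[mu]_x F (k, x)))).
  apply: ge0_le_integral => //.
  - by move=> k _; exact: poweR_ge0.
  - by move=> k _; exact: integral_mul_powR_le.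
rewrite ge0_integralZl//; last 2 first.
- by move=> k _; exact: integral_ge0.
- exact: poweR_ge0.
rewrite lee_wpmul2l// ?poweR_ge0//.
rewrite (fubini_tonelli F)//.
rewrite -ge0_integralZr//; last 2 first.
- exact/measurable_EFinP.
- by move=> x _; rewrite lee_fin.
apply: ge0_le_integral => //.
- by move=> x _; exact: integral_ge0.
- exact: (measurable_fun_fubini_tonelli_G F).
- by apply: emeasurable_funM => //; exact/measurable_EFinP.
- move=> x _; rewrite /F /=.
  under eq_integral do rewrite EFinM.
  rewrite ge0_integralZl//.
  + by rewrite lee_wpmul2l// lee_fin.
  + by move=> k _; rewrite lee_fin powR_ge0.
  + by rewrite lee_fin.
Qed.

End mixture.

Section modulation_lp.
Context (R : realType) (n : nat).
Local Notation Z := (Zn n).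
Local Notation T := (Tn R n).
Local Notation C := R[i].
Implicit Types (f g h : Z -> C).

Let nn (x : C) : (0 <= (normc x)%:E)%E.
Proof. by rewrite lee_fin normc_ge0. Qed.

(** The p-th power of the l^p norm, kept without the root because Tonelli, Jensen and the passage to
    the limit in finite sums all act on this sum. *)
Definition lpsum (p : R) f : \bar R :=
  (\int[countZ R n]_k (normc (f k) `^ p)%:E)%E.

Definition l1sum f : \bar R := (\int[countZ R n]_k (normc (f k))%:E)%E.

Lemma lpsum_ge0 p f : (0 <= lpsum p f)%E.
Proof. by apply: integral_ge0 => k _; rewrite lee_fin powR_ge0. Qed.

Lemma l1sum_ge0 f : (0 <= l1sum f)%E.
Proof. exact: integral_ge0. Qed.

Lemma lpsum_ptwise p f K : 0 < p -> (lpsum p f <= K%:E)%E ->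
  forall k, normc (f k) <= K `^ p^-1.
Proof.
move=> p0 fK k.
have H : normc (f k) `^ p <= K.
  rewrite -lee_fin; apply: le_trans fK.
  apply: (@le_integral_countZ R n (fun k => (normc (f k) `^ p)%:E)).
  by move=> j; rewrite lee_fin powR_ge0.
have := ge0_ler_powR (r := p^-1) _ _ _ H.
rewrite -powRrM divff ?gt_eqF// powRr1 ?normc_ge0//; apply.
- by rewrite invr_ge0 ltW.
- by rewrite nnegrE powR_ge0.
- by rewrite nnegrE (le_trans _ H)// powR_ge0.
Qed.

Lemma lpsum_bounded p f : 1 < p -> (lpsum p f < +oo)%E ->
  exists2 B, 0 <= B & forall k, normc (f k) <= B.
Proof.
move=> p1 fp; exists (fine (lpsum p f) `^ p^-1); first exact: powR_ge0.
apply: lpsum_ptwise; first by rewrite (lt_trans ltr01).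
by rewrite fineK// ge0_fin_numE// lpsum_ge0.
Qed.

(** S bounds the sum of the inverse weights of order 2n, the order for which [weight_summable]
    provides convergence. *)
Lemma Zbound_l1 : exists2 S : R, 0 <= S & forall (phi : Z -> C) B, Zbound n.*2 phi B ->
  (l1sum phi <= (B * S)%:E)%E.
Proof.
have [S HS] := weight_summable R n.
have S0 : 0 <= S.
  rewrite -lee_fin; apply: le_trans HS; apply: integral_ge0 => k _.
  by rewrite lee_fin invr_ge0 ltW// weight_gt0.
exists S => // phi B hB.
have B0 : 0 <= B.
  apply: le_trans (hB 0); rewrite mulr_ge0 ?normc_ge0//.
  by rewrite ltW// weight_gt0.
rewrite EFinM; apply: (@le_trans _ _ (\int[countZ R n]_k (B%:E * ((weight R n.*2 k)^-1)%:E))%E).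
  apply: ge0_le_integral => //.
  - by move=> k _; rewrite -EFinM lee_fin ler_pdivlMr ?weight_gt0// mulrC.
rewrite ge0_integralZl//; first by rewrite lee_wpmul2l// lee_fin.
by move=> k _; rewrite lee_fin invr_ge0 ltW// weight_gt0.
Qed.

Lemma Zschwartz_l1 (phi : Z -> C) : Zschwartz phi -> (l1sum phi < +oo)%E.
Proof.
have [S _ HS] := Zbound_l1.
by move=> /(_ n.*2)[B /HS]/le_lt_trans; apply; rewrite ltry.
Qed.

Lemma bounded_tempered f B : 0 <= B -> (forall k, normc (f k) <= B) -> Ztempered f.
Proof.
move=> B0 fB.
have I phi : (l1sum phi < +oo)%E -> cintegrable (countZ R n) (fun k => phi k * f k).
  move=> hp; apply: (cintegrable_mul_bounded _ _ fB); last exact: cmeasurable_Zn.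
  by apply/cintegrableP; split; first exact: cmeasurable_Zn.
split=> [phi /Zschwartz_l1/I|].
  by apply: eq_cintegrable => k; rewrite mulrC.
have [S S0 HS] := Zbound_l1.
exists (B * S), n.*2 => phi b /Zschwartz_l1 sphi /HS hb.
under eq_cintegral do rewrite mulrC.
rewrite -lee_fin (le_trans (normc_cintegral (I _ sphi)))//.
apply: (@le_trans _ _ (B%:E * l1sum phi)%E).
  by apply: integral_mul_bounded => //; exact: cmeasurable_Zn.
by rewrite -mulrA EFinM lee_wpmul2l ?lee_fin// [S * b]mulrC.
Qed.

(** Absolute convergence of the series of V_g f for every shift. It arises in three ways: a summable
    window with bounded f, conjugate exponents, or a Schwartz window with tempered f. *)
Definition paired g f := forall m, cintegrable (countZ R n) (fun k => f k * (g (k - m))^*).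

Lemma stftE g f m w : stft g f (m, w) =
  cintegral (countZ R n) (fun k => f k * (g (k - m))^* * echar (- k) w).
Proof.
apply: eq_cintegral => k; rewrite /tfshift /= rmorphM /= echarN.
by rewrite [_ * (g _)^*]mulrC mulrA.
Qed.

Lemma stft_integrable g f m w : paired g f ->
  cintegrable (countZ R n) (fun k => f k * (g (k - m))^* * echar (- k) w).
Proof.
move=> gf; apply: (@cintegrable_mul_bounded _ _ _ _ _ _ 1) => //.
by move=> k; rewrite normc_echar.
Qed.

Lemma stft_le g f m w : paired g f ->
  ((normc (stft g f (m, w)))%:E <= \int[countZ R n]_k (normc (g (k - m)) * normc (f k))%:E)%E.
Proof.
move=> gf; rewrite stftE (le_trans (normc_cintegral (stft_integrable m w gf)))//.
apply: ge0_le_integral => //.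
by move=> k _; rewrite lee_fin !normcM normc_echar mulr1 normc_conjc mulrC.
Qed.

Lemma cmeasurable_stft g f : cmeasurable (stft g f).
Proof.
pose F (z : (Z * T) * Z) := f z.2 * (tfshift z.1.1 z.1.2 g z.2)^*.
apply: (@cmeasurable_param _ _ _ _ _ (countZ R n) F).
apply: (@cmeasurable_swap _ _ _ _ _ (fun z : Z * (Z * T) => F (z.2, z.1))).
apply: cmeasurable_ZnX => k; rewrite /F /=.
apply: cmeasurable_ZnX => m /=.
apply: cmeasurableM; first exact: cmeasurable_cst.
apply: cmeasurableJ; apply: cmeasurableM; last exact: cmeasurable_cst.
exact: cmeasurable_echar.
Qed.

Definition mpsum (p : R) g f : \bar R :=
  (\int[muZT R n]_z (normc (stft g f z) `^ p)%:E)%E.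

Lemma mpsum_ge0 p g f : (0 <= mpsum p g f)%E.
Proof. by apply: integral_ge0 => k _; rewrite lee_fin powR_ge0. Qed.

Lemma modZ_normE p g f : modZ_norm g p%:E f = (mpsum p g f `^ p^-1)%E.
Proof.
rewrite /modZ_norm /Lp_norm Lnorm.unlock /mpsum.
by under eq_integral => z _ do rewrite /= ger0_norm ?normc_ge0//.
Qed.

Lemma l1_paired g f B : (l1sum g < +oo)%E -> (forall k, normc (f k) <= B) -> paired g f.
Proof.
move=> gs fB m.
rewrite (_ : (fun k => _) = (fun k => (g (k - m))^* * f k)); last first.
  by apply/funext => k; rewrite mulrC.
apply: (cintegrable_mul_bounded _ _ fB); last exact: cmeasurable_Zn.
apply: cintegrableJ; apply/cintegrableP; split; first exact: cmeasurable_Zn.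
by rewrite (@integral_countZ_shift R n m (fun k => (normc (g k))%:E)).
Qed.

Lemma measurable_powR_normc d (X : measurableType d) (F : X -> C) p :
  cmeasurable F -> measurable_fun setT (fun x => (normc (F x) `^ p)%:E).
Proof.
move=> mF; apply/measurable_EFinP.
exact: (measurableT_comp (measurable_powR p) (cmeasurable_normc mF)).
Qed.

Lemma mpsum_le p g f : 1 < p -> (l1sum g < +oo)%E -> (lpsum p f < +oo)%E ->
  (mpsum p g f <= l1sum g `^ (p - 1) * (l1sum g * lpsum p f))%E.
Proof.
move=> p1 gs fp; have p0 : 0 <= p by rewrite ltW// (lt_trans ltr01).
have [B B0 fB] := lpsum_bounded p1 fp.
have gf := l1_paired gs fB.
rewrite /mpsum (fubini_tonelli1 (fun z => (normc (stft g f z) `^ p)%:E))//; last 2 first.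
- by apply: measurable_powR_normc; exact: cmeasurable_stft.
- by move=> z; rewrite lee_fin powR_ge0.
rewrite /fubini_F.
(* The lattice is its own weight space: a = |g| and b m k = |f (k + m)|, whose p-th powers sum over
   m to [lpsum p f] for every k. The resulting bound on V_g f (m, w) does not depend on w. *)
have := @lp_mixture R n _ Z (countZ R n) p (fun k => normc (g k))
   (fun m k => normc (f (k + m))) (lpsum p f) p1.
move=> /(_ (measurable_fun_Zn _)) /(_ (fun _ => measurable_fun_Zn _)).
move=> /(_ (fun k => normc_ge0 _)) /(_ (fun k x => normc_ge0 _)) /(_ gs) /(_ (lpsum_ge0 _ _)).
have H x : (\int[countZ R n]_k (normc (f (x + k)%R) `^ p)%:E <= lpsum p f)%E.
  rewrite (@integral_countZ_shift' R n x (fun k => (normc (f k) `^ p)%:E))//.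
  by move=> k; rewrite lee_fin powR_ge0.
move=> /(_ H); apply: le_trans.
apply: ge0_le_integral => //.
- by move=> m _; apply: integral_ge0 => w _; rewrite lee_fin powR_ge0.
- move=> m _.
  set r := (X in (_ <= X)%E).
  apply: (@le_trans _ _ (\int[haar R n]_w r)%E).
    apply: ge0_le_integral => //.
    - by move=> w _; rewrite lee_fin powR_ge0.
    - apply: measurable_powR_normc; apply: cmeasurable_pair1; exact: cmeasurable_stft.
    - move=> w _ /=; rewrite -poweR_EFin; apply: le_poweR => //.
      apply: le_trans (stft_le m w gf) _.
      rewrite -(@integral_countZ_shift R n (- m) (fun k => (normc (g (k - m)%R) * normc (f k))%:E)).
        apply: ge0_le_integral => //.
          by move=> k _; rewrite lee_fin mulr_ge0 ?normc_ge0.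
        by move=> k _; rewrite opprK addrK.
      by move=> k; rewrite lee_fin mulr_ge0 ?normc_ge0.
  by rewrite integral_probability_cst.
Qed.

(** The recovered product f(k0 + m) g(k0)^* is a Haar mean of V_g f (m, .) times a character. Jensen
    for this probability measure bounds its p-th power by the mean of |V_g f (m, .)|^p, and the sum
    over m follows. *)
Lemma lpsum_le p g f k0 : 1 < p -> Zschwartz g -> Ztempered f ->
  ((normc (g k0) `^ p)%:E * lpsum p f <= mpsum p g f)%E.
Proof.
move=> p1 sg tf; have p0 : 0 <= p by rewrite ltW// (lt_trans ltr01).
have gf : paired g f.
  (* The conjugate translate of the window is a test function, its seminorms growing at most by the
     factor [weight R N m]; temperedness then gives convergence of the series. *)
  move=> m; case: tf => + _; apply => N.
  have [B hB] := sg N; exists (weight R N m * B) => k.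
  rewrite normc_conjc -[X in weight R N X](subrKC m k).
  apply: (@le_trans _ _ (weight R N m * weight R N (k - m) * normc (g (k - m)))).
    by rewrite ler_wpM2r ?normc_ge0// weightD.
  by rewrite -mulrA ler_wpM2l ?(ltW (weight_gt0 _ _ _)).
have step m : ((normc (g k0) `^ p * normc (f (k0 + m)) `^ p)%:E <=
    \int[haar R n]_w (normc (stft g f (m, w)) `^ p)%:E)%E.
  pose F (z : Z * T) := f z.1 * (g (z.1 - m))^* * echar (- z.1) z.2 * echar (k0 + m) z.2.
  have mF : cmeasurable F.
    apply: cmeasurable_ZnX => k; rewrite /F/=; apply: cmeasurableM; last exact: cmeasurable_echar.
    by apply: cmeasurableM; [exact: cmeasurable_cst|exact: cmeasurable_echar].
  have iF : cintegrable (countZ R n \x haar R n)%E F.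
    apply: cintegrable12 => //.
    have /cintegrableP[_ gfm] := gf m.
    apply: le_lt_trans gfm; apply: ge0_le_integral => //.
    - by move=> k _; apply: integral_ge0.
    - move=> k _; rewrite /F /=.
      under eq_integral do rewrite normcM normcM !normc_echar !mulr1.
      by rewrite integral_probability_cst.
  have [_ e1 e2] := cfubini iF.
  have E : cintegral (haar R n) (fun w => stft g f (m, w) * echar (k0 + m) w) =
     f (k0 + m) * (g k0)^*.
    transitivity (cintegral (haar R n) (fun w => cintegral (countZ R n) (fun k => F (k, w)))).
      apply: eq_cintegral => w; rewrite stftE mulrC -cintegralZ; last exact: stft_integrable.
      by apply: eq_cintegral => k; rewrite /F /= mulrC.
    have I a : cintegrable (haar R n) (fun w : T => echar a w).
      apply: (@cintegrable_bounded _ _ _ _ _ 1) => [|v]; first exact: cmeasurable_echar.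
      by rewrite normc_echar.
    have E1 k w : F (k, w) = f k * (g (k - m))^* * echar (k0 + m - k) w.
      by rewrite /F /= -!mulrA -echarD [- k + _]addrC.
    rewrite e2 -e1 (@cintegral_countZ_single R n (k0 + m)).
      rewrite (eq_cintegral _ (E1 _)) cintegralZ// haar_char subrr eqxx mulr1.
      by rewrite addrK.
    move=> k kk; rewrite (eq_cintegral _ (E1 _)) cintegralZ// haar_char subr_eq0.
    by rewrite eq_sym (negbTE kk) mulr0.
  rewrite -powRM ?normc_ge0// mulrC -(normc_conjc (g k0)) -normcM -E -poweR_EFin.
  have mst : cmeasurable (fun w => stft g f (m, w)).
    by apply: cmeasurable_pair1; exact: cmeasurable_stft.
  have iW : cintegrable (haar R n) (fun w => stft g f (m, w) * echar (k0 + m) w).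
    have /cintegrableP[_ gfm] := gf m.
    apply: (@cintegrable_coef _ _ _ (fine (\int[countZ R n]_k (normc (f k * (g (k - m)%R)^*))%:E)%E)) => //.
    move=> w; rewrite -lee_fin fineK; last by rewrite ge0_fin_numE// integral_ge0.
    apply: le_trans (stft_le m w gf) _; apply: ge0_le_integral => //.
      by move=> k _; rewrite lee_fin mulr_ge0 ?normc_ge0.
    by move=> k _; rewrite lee_fin normcM normc_conjc mulrC.
  apply: le_trans (le_poweR p0 (nn _) (normc_cintegral iW)) _.
  (* Jensen with constant weight 1, whose integral is 1. *)
  have := @integral_mul_powR_le _ _ _ (haar R n) p (cst 1) (fun w => normc (stft g f (m, w))) p1.
  move=> /(_ (measurable_cst _) (cmeasurable_normc mst)).
  move=> /(_ (fun _ => ler01) (fun _ => normc_ge0 _)).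
  have H1 : (\int[haar R n]_x (cst (1 : R) x)%:E = 1)%E.
    by rewrite -[RHS](integral_probability_cst (haar R n)); exact: eq_integral.
  rewrite H1 poweR1r mul1e.
  move=> /(_ (ltry _)).
  under eq_integral do rewrite mul1r.
  under [X in (_ <= X -> _)%E]eq_integral do rewrite mul1r.
  apply: le_trans.
  rewrite le_eqVlt; apply/orP; left; apply/eqP; congr (_ `^ _)%E.
  by apply: eq_integral => w _; rewrite normcM normc_echar mulr1.
rewrite /mpsum (fubini_tonelli1 (fun z => (normc (stft g f z) `^ p)%:E))//; last 2 first.
- by apply: measurable_powR_normc; exact: cmeasurable_stft.
- by move=> z; rewrite lee_fin powR_ge0.
rewrite /fubini_F /lpsum -(@integral_countZ_shift' R n k0); last first.
  by move=> k; rewrite lee_fin powR_ge0.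
rewrite -ge0_integralZl//; last 2 first.
- by move=> k _; rewrite lee_fin powR_ge0.
- by rewrite lee_fin powR_ge0.
apply: ge0_le_integral => //.
- by move=> k _; rewrite mule_ge0// lee_fin powR_ge0.
by move=> m _; exact: step.
Qed.

End modulation_lp.

(** * The localization operator *)

Section operator.
Context (R : realType) (n : nat).
Local Notation Z := (Zn n).
Local Notation T := (Tn R n).
Local Notation C := R[i].
Local Notation ZT := (Z * T)%type.
Implicit Types (f g h : Z -> C).

Let nn (x : C) : (0 <= (normc x)%:E)%E.
Proof. by rewrite lee_fin normc_ge0. Qed.

Lemma lpsum_fin (p : R) f : (lpsum p f < +oo)%E -> lpsum p f \is a fin_num.
Proof. by move=> fp; rewrite (ge0_fin_numE (lpsum_ge0 _ _)). Qed.

Lemma EFin_fineD (x y : \bar R) : x \is a fin_num -> y \is a fin_num ->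
  ((fine x + fine y)%:E = x + y)%E.
Proof. by move=> xf yf; rewrite EFinD !fineK. Qed.

Lemma mule_lty (x y : \bar R) : (0 <= x -> x < +oo -> y < +oo -> x * y < +oo)%E.
Proof. by move=> x0 xy yy; rewrite lte_mul_pinfty// ge0_fin_numE. Qed.

(** Young's inequality term by term, with the factors 1/p and 1/p' bounded by 1. The bound is
    uniform in the shift m, hence gives a bound on V_g f over all of Z^n x T^n. *)
Lemma lp_paired (p p' : R) g f : 1 < p -> 1 < p' -> p^-1 + p'^-1 = 1 ->
  (lpsum p f < +oo)%E -> (lpsum p' g < +oo)%E ->
  paired g f /\
  forall m, (\int[countZ R n]_k (normc (g (k - m)) * normc (f k))%:E <=
    lpsum p f + lpsum p' g)%E.
Proof.
move=> p1 p1' pp' fp gp'.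
have p0 : 0 < p by rewrite (lt_trans ltr01).
have p0' : 0 < p' by rewrite (lt_trans ltr01).
have H m : (\int[countZ R n]_k (normc (g (k - m)) * normc (f k))%:E <=
    lpsum p f + lpsum p' g)%E.
  rewrite /lpsum -(@integral_countZ_shift R n m (fun k => (normc (g k) `^ p')%:E)); last first.
    by move=> k; rewrite lee_fin powR_ge0.
  rewrite -ge0_integralD//; [|by move=> k _; rewrite lee_fin powR_ge0..].
  apply: ge0_le_integral => //.
    by move=> k _; rewrite lee_fin mulr_ge0 ?normc_ge0.
  move=> k _; rewrite -EFinD lee_fin mulrC.
  rewrite (le_trans (conjugate_powR (normc_ge0 _) (normc_ge0 _) p0 p0' pp'))//.
  by rewrite lerD// ler_piMr ?powR_ge0// invf_le1// ltW.
split=> // m; apply/cintegrableP; split; first exact: cmeasurable_Zn.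
apply: le_lt_trans (lte_add_pinfty fp gp').
apply: le_trans (H m); apply: ge0_le_integral => //.
by move=> k _; rewrite normcM normc_conjc mulrC.
Qed.

Lemma lp_stft_bounded (p p' : R) g f : 1 < p -> 1 < p' -> p^-1 + p'^-1 = 1 ->
  (lpsum p f < +oo)%E -> (lpsum p' g < +oo)%E ->
  forall z, normc (stft g f z) <= fine (lpsum p f) + fine (lpsum p' g).
Proof.
move=> p1 p1' pp' fp gp' [m w]; have [gf H] := lp_paired p1 p1' pp' fp gp'.
rewrite -lee_fin (EFin_fineD (lpsum_fin fp) (lpsum_fin gp')).
exact: le_trans (stft_le m w gf) (H m).
Qed.

Variables (p p' : R).
Hypotheses (p1 : 1 < p) (p1' : 1 < p') (pp' : p^-1 + p'^-1 = 1).
Let pp'C : p'^-1 + p^-1 = 1. Proof. by rewrite addrC. Qed.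

Variables (sigma : ZT -> C) (g1 g2 : Z -> C).
Hypotheses (isigma : cintegrable (muZT R n) sigma)
  (hg1 : (lpsum p' g1 < +oo)%E) (hg2 : (lpsum p g2 < +oo)%E).

Let L := locop sigma g1 g2.

Let g2_bounded := lpsum_bounded p1 hg2.

Lemma cintegrable_sigma_stft f : (lpsum p f < +oo)%E ->
  cintegrable (muZT R n) (fun z => sigma z * stft g1 f z).
Proof.
move=> fp; apply: (cintegrable_mul_bounded isigma (cmeasurable_stft _ _)).
exact: lp_stft_bounded fp hg1.
Qed.

Lemma cmeasurable_tfshift k : cmeasurable (fun z : ZT => tfshift z.1 z.2 g2 k).
Proof.
apply: cmeasurable_ZnX => m /=; apply: cmeasurableM; last exact: cmeasurable_cst.
exact: cmeasurable_echar.
Qed.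

Lemma normc_tfshift m (w : T) k : normc (tfshift m w g2 k) = normc (g2 (k - m)).
Proof. by rewrite normcM normc_e2pi mul1r. Qed.

Lemma cintegrable_locop f k : (lpsum p f < +oo)%E ->
  cintegrable (muZT R n) (fun z => sigma z * stft g1 f z * tfshift z.1 z.2 g2 k).
Proof.
move=> fp; have [B _ hB] := g2_bounded.
apply: (cintegrable_mul_bounded (cintegrable_sigma_stft fp) (cmeasurable_tfshift k) (B := B)).
by move=> z; rewrite normc_tfshift.
Qed.

Definition locop_mass f : \bar R :=
  (\int[muZT R n]_z (normc (sigma z * stft g1 f z))%:E)%E.

(** [lp_mixture] with weight |sigma V_g1 f| on Z^n x T^n and the translates of |g2|, which all have
    the same l^p sum. The mass of the weight is kept in the estimate because compactness rests on
    its convergence to 0. *)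
Lemma lpsum_locop f : (lpsum p f < +oo)%E ->
  (lpsum p (L f) <= locop_mass f `^ (p - 1) * (locop_mass f * lpsum p g2))%E.
Proof.
move=> fp; have p0 : 0 <= p by rewrite ltW// (lt_trans ltr01).
have [ms fs] := (cintegrableP _ _).1 (cintegrable_sigma_stft fp).
have := @lp_mixture R n _ ZT (muZT R n) p (fun z => normc (sigma z * stft g1 f z))
  (fun k z => normc (g2 (k - z.1))) (lpsum p g2) p1 (cmeasurable_normc ms).
have mb k : measurable_fun setT (fun z : ZT => normc (g2 (k - z.1))).
  by apply: measurable_fun_ZnX => m /=; exact: measurable_cst.
move=> /(_ mb) /(_ (fun _ => normc_ge0 _)) /(_ (fun _ _ => normc_ge0 _)) /(_ fs).
move=> /(_ (lpsum_ge0 _ _)).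
have H (z : ZT) : (\int[countZ R n]_k (normc (g2 (k - z.1)%R) `^ p)%:E <= lpsum p g2)%E.
  rewrite (@integral_countZ_shift R n z.1 (fun k => (normc (g2 k) `^ p)%:E))//.
  by move=> k; rewrite lee_fin powR_ge0.
move=> /(_ H); apply: le_trans; apply: ge0_le_integral => //.
- by move=> k _; rewrite lee_fin powR_ge0.
move=> k _; rewrite -poweR_EFin; apply: le_poweR => //.
  apply: le_trans (normc_cintegral (cintegrable_locop k fp)) _.
  rewrite le_eqVlt; apply/orP; left; apply/eqP.
  by apply: eq_integral => z _; rewrite normcM normc_tfshift.
Qed.

Lemma lpsum_locop_fin f : (lpsum p f < +oo)%E -> (lpsum p (L f) < +oo)%E.
Proof.
move=> fp; apply: le_lt_trans (lpsum_locop fp) _.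
have [_ fs] := (cintegrableP _ _).1 (cintegrable_sigma_stft fp).
have A0 : (0 <= \int[muZT R n]_z (normc (sigma z * stft g1 f z))%:E)%E.
  exact: integral_ge0.
exact: mule_lty (poweR_ge0 _ _) (poweR_lty _ fs) (mule_lty A0 fs hg2).
Qed.

Lemma locop_lin a f h : (lpsum p f < +oo)%E -> (lpsum p h < +oo)%E ->
  L (fun k => a * f k + h k) = (fun k => a * L f k + L h k).
Proof.
move=> fp hp; apply/funext => k; rewrite /L /locop.
have stftL z : stft g1 (fun k => a * f k + h k) z = a * stft g1 f z + stft g1 h z.
  case: z => m w.
  have [gf _] := lp_paired p1 p1' pp' fp hg1.
  have [gh _] := lp_paired p1 p1' pp' hp hg1.
  rewrite !stftE -cintegralZ; last exact: stft_integrable.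
  rewrite -cintegralD; [|apply: cintegrableZ; exact: stft_integrable|exact: stft_integrable].
  by apply: eq_cintegral => j; ring.
rewrite -cintegralZ; last exact: cintegrable_locop.
rewrite -cintegralD; [|by apply: cintegrableZ; exact: cintegrable_locop|exact: cintegrable_locop].
by apply: eq_cintegral => z; rewrite stftL; ring.
Qed.

(** Fubini for the sum over k against the symbol integral. For fixed (m, w) the sum of |g2(k - m)
    h(k)| is bounded uniformly, and sigma V_g1 f is integrable. *)
Lemma locop_weak f h : (lpsum p f < +oo)%E -> (lpsum p' h < +oo)%E ->
  [/\ cintegrable (countZ R n) (fun k => L f k * (h k)^*),
      cintegrable (muZT R n) (fun z => sigma z * stft g1 f z * (stft g2 h z)^*) &
      pairing (L f) h =
      cintegral (muZT R n) (fun z => sigma z * stft g1 f z * (stft g2 h z)^*)].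
Proof.
move=> fp hp.
have [+ _] := lp_paired p1 p1' pp' (lpsum_locop_fin fp) hp.
move=> /(_ 0) i1.
have [g2h H2] := lp_paired p1' p1 pp'C hp hg2.
have I := cintegrable_sigma_stft fp.
have [mI fI] := (cintegrableP _ _).1 I.
split.
- by move: i1; under eq_fun do rewrite subr0.
- apply: (cintegrable_mul_bounded I).
    by apply: cmeasurableJ; exact: cmeasurable_stft.
  move=> z; rewrite normc_conjc; exact: lp_stft_bounded p1' p1 pp'C hp hg2 z.
pose F (x : Z * ZT) := sigma x.2 * stft g1 f x.2 * tfshift x.2.1 x.2.2 g2 x.1 * (h x.1)^*.
have mF : cmeasurable F.
  apply: cmeasurable_ZnX => k; rewrite /F /=; apply: cmeasurableM; last exact: cmeasurable_cst.
  by apply: cmeasurableM => //; exact: cmeasurable_tfshift.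
pose S := fine (lpsum p' h) + fine (lpsum p g2).
have S0 : 0 <= S by rewrite addr_ge0// fine_ge0// lpsum_ge0.
have iF : cintegrable (countZ R n \x muZT R n)%E F.
  apply: cintegrable21 => //.
  apply: (@le_lt_trans _ _ (\int[muZT R n]_z ((normc (sigma z * stft g1 f z))%:E * S%:E))%E).
    apply: ge0_le_integral => //.
    - by move=> z _; apply: integral_ge0.
    - apply: (measurable_fun_fubini_tonelli_G (fun x => (normc (F x))%:E)) => //.
      exact: cmeasurable_normcE.
    - by apply: emeasurable_funM => //; exact: cmeasurable_normcE.
    - move=> z _; rewrite /F /=.
      under eq_integral do rewrite -mulrA normcM EFinM.
      rewrite ge0_integralZl// lee_wpmul2l//.
      under eq_integral do rewrite normcM normc_conjc normc_tfshift.
      apply: le_trans (H2 z.1) _.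
      by rewrite (EFin_fineD (lpsum_fin hp) (lpsum_fin hg2)).
  rewrite ge0_integralZr//; last exact: cmeasurable_normcE.
  by rewrite lte_mul_pinfty// ?integral_ge0// ?ltry// ge0_fin_numE// integral_ge0.
have [_ e1 e2] := cfubini iF.
transitivity (cintegral (countZ R n) (fun k => cintegral (muZT R n) (fun z => F (k, z)))).
  apply: eq_cintegral => k; rewrite /L /locop /F /= mulrC -cintegralZ; last exact: cintegrable_locop.
  by apply: eq_cintegral => z; rewrite mulrC.
rewrite e1 -e2; apply: eq_cintegral => -[m w]; rewrite /F /=.
have iS : cintegrable (countZ R n) (fun k => h k * (tfshift m w g2 k)^*).
  have := stft_integrable m w g2h.
  apply: eq_cintegrable => k; rewrite /tfshift rmorphM/= echarN.
  by rewrite -mulrA [_ * (echar _ _)^*]mulrC.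
rewrite -[stft g2 h _]/(cintegral _ (fun k => h k * (tfshift m w g2 k)^*)).
rewrite -cintegralJ// -cintegralZ; last exact: cintegrableJ.
by apply: eq_cintegral => k; rewrite rmorphM/= conjCK; ring.
Qed.

End operator.

(** * Compactness *)

Lemma nbhs_forall_fin (T : topologicalType) (x : T) (I : finType) (P : I -> set T) :
  (forall i, nbhs x (P i)) -> nbhs x [set y | forall i, P i y].
Proof. by move=> H; exact: filter_forall. Qed.

Section subsequence.
Context (R : realType) (n : nat).
Local Notation Z := (Zn n).
Local Notation C := R[i].
Implicit Types (f g h : Z -> C).

(* A cluster point exists by Tychonoff; as Z^n is countable, countably many
   conditions suffice to extract a subsequence. *)
Lemma pointwise_subsequence (u : nat -> Z -> C) (B : R) :
  (forall i k, normc (u i k) <= B) ->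
  exists s : nat -> nat, {homo s : i j / (i < j)%N} /\
  exists f, forall k, (fun i => normc (u (s i) k - f k)) @ \oo --> (0 : R).
Proof.
move=> uB; pose K := (Z * bool)%type.
(* Real and imaginary parts become separate coordinates, [true] marking the real one, so that the
   sequence lives in a product of segments of R. *)
pose x (i : nat) : prod_topology (fun _ : K => R) :=
  fun q => if q.2 then Re (u i q.1) else Im (u i q.1).
pose A : set (prod_topology (fun _ : K => R)) := [set a | forall q, `[- B, B]%classic (a q)].
have cA : compact A := @tychonoff K (fun _ => R) (fun _ => `[- B, B]%classic) (fun _ => @segment_compact R (- B) B).
have xA i : A (x i).
  move=> q; rewrite /x /= in_itv/= -ler_norml; case: q.2.
    exact: le_trans (Re_le_normc _) (uB _ _).
  exact: le_trans (Im_le_normc _) (uB _ _).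
have FA : (x @ \oo) A by exists 0%N => // i _; exact: xA.
have [p [_ clp]] := cA (x @ \oo) _ FA.
(* Closeness 1 / (N + 1) on the points of code at most N. Only finitely many coordinates are
   constrained, so this is a neighbourhood in the product topology, and each fixed k is eventually
   included. *)
pose Q N : set (prod_topology (fun _ : K => R)) :=
  [set a | forall q : K, (pickle q.1 <= N)%N -> `|p q - a q| < N.+1%:R^-1].
have nQ N : nbhs p (Q N).
  pose P (jb : 'I_N.+1 * bool) : set (prod_topology (fun _ : K => R)) :=
    fun a => if unpickle jb.1 is Some k then `|p (k, jb.2) - a (k, jb.2)| < N.+1%:R^-1 else true.
  have H jb : nbhs p (P jb).
    case: jb => j b; rewrite /P /=.
    case: (unpickle j) => [k|]; last by apply: filterS filterT.
    have N0 : 0 < N.+1%:R^-1 :> R by rewrite invr_gt0.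
    exact: (@proj_continuous K (fun _ => R) (k, b) p
      (ball (p (k, b)) N.+1%:R^-1) (nbhsx_ballx (p (k, b) : R) _ N0)).
  have := @nbhs_forall_fin (prod_topology (fun _ : K => R)) p _ P H.
  apply: filterS => a Ha [k b] /= kN.
  by have := Ha (Ordinal (kN : (pickle k < N.+1)%N), b); rewrite /P /= pickleK.
have ex N m : exists j, (m < j)%N /\ Q N (x j).
  have Fm : (x @ \oo) [set x j | j in [set j | (m < j)%N]].
    by exists m.+1 => // j /= mj; exists j.
  have [_ [[j mj <-] Qj]] := clp _ _ Fm (nQ N).
  by exists j.
have /choice[c Hc] : forall Nm : nat * nat, exists j, (Nm.2 < j)%N /\ Q Nm.1 (x j).
  by move=> [N m]; exact: ex.
(* The choice function returns an index beyond its second argument, so s increases strictly, while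
   the stage number sets the precision. *)
pose s := fix s i := if i is j.+1 then c (i, s j) else c (0%N, 0%N).
have sQ i : Q i (x (s i)).
  by case: i => [|i]; [have [] := Hc (0, 0)%N|have [] := Hc (i.+1, s i)].
exists s; split.
  apply: homo_ltn => [a b d|i]; first exact: ltn_trans.
  by have [] := Hc (i.+1, s i).
exists (fun k => p (k, true) +i* p (k, false)) => k.
apply/cvgrPdist_lt => e e0; near=> i.
rewrite sub0r normrN ger0_norm ?normc_ge0//.
apply: le_lt_trans (normc_le_ReIm _) _.
have ki : (pickle k <= i)%N by near: i; exact: nbhs_infty_ge.
have H1 := sQ i (k, true) ki; have H2 := sQ i (k, false) ki.
have ie : i.+1%:R^-1 < e / 2 by near: i; apply: near_infty_natSinv_lt (PosNum _); rewrite divr_gt0.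
rewrite [e]splitr; apply: ltrD.
  apply: lt_trans ie; move: H1; rewrite /x/= distrC.
  by case: (u (s i) k).
apply: lt_trans ie; move: H2; rewrite /x/= distrC.
by case: (u (s i) k).
Unshelve. all: by end_near.
Qed.

(** At a positive limit, continuity comes from differentiability of the power; the limit 0 is
    treated by hand, since for p < 1 the power is not differentiable there. *)
Lemma powR_cvg (x : nat -> R) (l p : R) : 0 < p -> (forall i, 0 <= x i) ->
  x @ \oo --> l -> (fun i => x i `^ p) @ \oo --> l `^ p.
Proof.
move=> p0 x0 xl.
have : 0 <= l.
  by apply: (cvgr_to_ge xl); exact: nearW.
rewrite le_eqVlt => /predU1P[l0|l0].
  rewrite -l0 powR0 ?gt_eqF//; rewrite -l0 in xl.
  apply/cvgrPdist_lt => e e0.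
  have e'0 : 0 < e `^ p^-1 by exact: powR_gt0.
  near=> i.
  have : `|0 - x i| < e `^ p^-1 by near: i; exact: ((cvgrPdist_lt _ _).1 xl).
  rewrite !sub0r !normrN !ger0_norm ?powR_ge0// => xe.
  rewrite -[e]powRr1 ?ltW// -[X in _ < _ `^ X](mulVf (lt0r_neq0 p0)) powRrM.
  by apply: gt0_ltr_powR => //; rewrite nnegrE ?powR_ge0.
have /derivable1_diffP/differentiable_continuous cp : derivable (fun a : R => a `^ p) l 1.
  by apply: derivable_powR; rewrite in_itv/= andbT.
exact: (continuous_cvg _ cp xl).
Unshelve. all: by end_near.
Qed.

(** From |a - b| <= 2 max(|a|, |b|), the maximum being one of the two terms on the right; hence the
    constant 2^p. *)
Lemma powR_normcB (p : R) (a b : C) : 0 <= p ->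
  normc (a - b) `^ p <= 2 `^ p * (normc a `^ p + normc b `^ p).
Proof.
move=> p0; have H x y : normc y <= normc x ->
    normc (a - b) <= normc x + normc y -> normc (a - b) `^ p <= 2 `^ p * (normc x `^ p + normc y `^ p) :> R.
  move=> yx ab.
  apply: (@le_trans _ _ ((2 * normc x) `^ p)).
    apply: ge0_ler_powR => //; rewrite ?nnegrE ?normc_ge0 ?mulr_ge0 ?normc_ge0//.
    by apply: le_trans ab _; rewrite mulr_natl mulr2n lerD2l.
  by rewrite powRM ?normc_ge0// ler_wpM2l ?powR_ge0// lerDl powR_ge0.
have ab : normc (a - b) <= normc a + normc b.
  by rewrite (le_trans (le_normcD _ _))// normcN.
have [ba|ba] := leP (normc b) (normc a); first exact: H.
by rewrite [normc a `^ p + _]addrC; apply: H; [exact: ltW|rewrite [normc b + _]addrC].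
Qed.

Lemma lpsumB (p : R) f g : 0 <= p ->
  (lpsum p (fun k => f k - g k)%R <= (2 `^ p)%:E * (lpsum p f + lpsum p g))%E.
Proof.
move=> p0; have P0 (h : Z -> C) k : (0 <= (normc (h k) `^ p)%:E)%E by rewrite lee_fin powR_ge0.
rewrite /lpsum -ge0_integralD// -ge0_integralZl//; last by move=> k _; rewrite adde_ge0.
apply: ge0_le_integral => //.
  by move=> k _; exact: (P0 (fun k => f k - g k)).
by move=> k _; rewrite -EFinD -EFinM lee_fin powR_normcB.
Qed.

(** Fatou on the lattice: the l^p sum is a supremum of finite sums, and in each of these the limit
    can be taken term by term. *)
Lemma lpsum_fatou (p K : R) (u : nat -> Z -> C) f : 0 < p ->
  (forall k, (fun i => normc (u i k - f k)) @ \oo --> (0 : R)) ->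
  (forall i, lpsum p (u i) <= K%:E)%E -> (lpsum p f <= K%:E)%E.
Proof.
move=> p0 uf uK.
have nf k : (fun i => normc (u i k)) @ \oo --> normc (f k).
  apply/cvgrPdist_le => e e0; near=> i.
  have : `|0 - normc (u i k - f k)| <= e by near: i; exact: ((cvgrPdist_le _ _).1 (uf k)).
  rewrite sub0r normrN ger0_norm ?normc_ge0// => de.
  have H1 : normc (u i k) <= normc (u i k - f k) + normc (f k).
    by rewrite {1}(_ : u i k = (u i k - f k) + f k); [exact: le_normcD|rewrite subrK].
  have H2 : normc (f k) <= normc (u i k - f k) + normc (u i k).
    by rewrite -(normcN (u i k - f k)) opprB {1}(_ : f k = (f k - u i k) + u i k); [exact: le_normcD|rewrite subrK].
  by rewrite ler_norml; apply/andP; split; lra.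
rewrite /lpsum integral_countZ; last by move=> k; rewrite lee_fin powR_ge0.
apply: ge_ereal_sup => _ [A [finA _] <-].
rewrite fsbig_finite//=; set S : seq Z := finmap.enum_fset (fset_set A).
rewrite sumEFin lee_fin.
have cS : (fun i => \sum_(k <- S) normc (u i k) `^ p) @ \oo --> \sum_(k <- S) normc (f k) `^ p.
  elim: S => [|k S IH].
    by under eq_fun do rewrite big_nil; rewrite big_nil; exact: cvg_cst.
  under eq_fun do rewrite big_cons; rewrite big_cons.
  apply: cvgD => //; apply: powR_cvg => // i; exact: normc_ge0.
apply: (cvgr_to_le cS); apply: nearW => i.
rewrite -lee_fin; apply: le_trans (uK i).
rewrite /lpsum integral_countZ; last by move=> k; rewrite lee_fin powR_ge0.
apply: esum_ge; exists A; first by split.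
by rewrite fsbig_finite//= -sumEFin.
Unshelve. all: by end_near.
Qed.

End subsequence.

Section compactness.
Context (R : realType) (n : nat).
Local Notation Z := (Zn n).
Local Notation T := (Tn R n).
Local Notation C := R[i].
Local Notation ZT := (Z * T)%type.
Implicit Types (f g h : Z -> C).

Lemma dominated_cvg0 d (X : measurableType d) (mu : {measure set X -> \bar R})
    (F : nat -> X -> R) (G : X -> R) :
  (forall i, measurable_fun setT (F i)) -> measurable_fun setT G ->
  (forall i x, 0 <= F i x) -> (forall i x, F i x <= G x) ->
  (\int[mu]_x (G x)%:E < +oo)%E ->
  (forall x, (fun i => F i x) @ \oo --> (0 : R)) ->
  (fun i => \int[mu]_x (F i x)%:E)%E @ \oo --> 0%E.
Proof.
move=> mF mG F0 FG Gfin Fc.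
have G0 x : 0 <= G x by exact: le_trans (F0 0%N x) (FG 0%N x).
have [|||||_ _] := @dominated_convergence _ _ _ mu setT measurableT
  (fun i x => (F i x)%:E) (cst 0%E) (fun x => (G x)%:E).
- by move=> i; exact/measurable_EFinP.
- exact: measurable_cst.
- by apply: aeW => x _; apply: cvg_EFin; [exact: nearW|exact: Fc].
- apply/integrableP; split; first exact/measurable_EFinP.
  by under eq_integral do rewrite /= ger0_norm//.
- by apply: aeW => x i _; rewrite /= lee_fin ger0_norm.
by rewrite integral_cst// mul0e.
Qed.

(* Young's inequality for (t a) (b / t) with t^p = e p. *)
Lemma young_eps (p p' e : R) : 0 < p -> 0 < p' -> p^-1 + p'^-1 = 1 -> 0 < e ->
  exists2 c, 0 <= c & forall a b, 0 <= a -> 0 <= b ->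
    b * a <= e * a `^ p + c * b `^ p'.
Proof.
move=> p0 p0' pp' e0; pose t := (e * p) `^ p^-1.
have ep : 0 < e * p by exact: mulr_gt0.
have t0 : 0 < t by exact: powR_gt0.
exists ((t^-1) `^ p' / p'); first by rewrite divr_ge0 ?powR_ge0// ltW.
move=> a b a0 b0.
have := conjugate_powR (mulr_ge0 (ltW t0) a0) (mulr_ge0 _ b0) p0 p0' pp'.
move=> /(_ t^-1); rewrite invr_ge0 (ltW t0) => /(_ erefl).
rewrite (_ : t * a * (t^-1 * b) = b * a); last by field; rewrite gt_eqF.
move=> /le_trans; apply.
rewrite !powRM// ?invr_ge0 ?(ltW t0)// {1}/t -powRrM mulVf ?gt_eqF// powRr1 ?(ltW ep)//.
rewrite lerD//; first by rewrite le_eqVlt; apply/orP; left; apply/eqP; field; rewrite gt_eqF.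
by rewrite le_eqVlt; apply/orP; left; apply/eqP; field; rewrite gt_eqF.
Qed.

Variables (p p' : R).
Hypotheses (p1 : 1 < p) (p1' : 1 < p') (pp' : p^-1 + p'^-1 = 1).

(** Bounded pointwise convergence in l^p is weak convergence, tested here against the translates of
    g. The part of |g v_i| above a multiple of |g|^p' is absorbed by d |v_i|^p, whose sum is small
    because K is uniform in i. *)
Lemma stft_cvg0 (K : R) g (v : nat -> Z -> C) : (lpsum p' g < +oo)%E ->
  (forall i, lpsum p (v i) <= K%:E)%E ->
  (forall k, (fun i => normc (v i k)) @ \oo --> (0 : R)) ->
  forall z, (fun i => normc (stft g (v i) z)) @ \oo --> (0 : R).
Proof.
move=> gp' vK v0 [m w].
have p0 : 0 < p by rewrite (lt_trans ltr01).
have p0' : 0 < p' by rewrite (lt_trans ltr01).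
have K0 : 0 <= K by rewrite -lee_fin; exact: le_trans (lpsum_ge0 p (v 0%N)) (vK 0%N).
have vfin i : (lpsum p (v i) < +oo)%E by rewrite (le_lt_trans (vK i))// ltry.
have K10 : 0 < K + 1 by rewrite ltr_wpDl.
(* Chosen so that d K <= e / 2; K + 1 avoids dividing by a K equal to 0. *)
apply/cvgrPdist_lt => e e0; pose d := e / 2 / (K + 1).
have d0 : 0 < d by rewrite !divr_gt0.
have [c c0 hc] := young_eps p0 p0' pp' d0.
(* [F] is dominated by a multiple of |g|^p', and |g v_i| <= d |v_i|^p + F i. *)
pose F i k := Num.min (normc (g (k - m)) * normc (v i k)) (c * normc (g (k - m)) `^ p').
have F0 i k : 0 <= F i k.
  by rewrite le_min !mulr_ge0 ?normc_ge0 ?powR_ge0.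
have Fc : (fun i => \int[countZ R n]_k (F i k)%:E)%E @ \oo --> 0%E.
  apply: (@dominated_cvg0 _ _ _ F (fun k => c * normc (g (k - m)) `^ p')) => //.
  - by move=> i k; rewrite /F ge_min lexx orbT.
  - under eq_integral do rewrite EFinM.
    rewrite ge0_integralZl//; last by move=> k _; rewrite lee_fin powR_ge0.
    rewrite (@integral_countZ_shift R n m (fun k => (normc (g k) `^ p')%:E)); last first.
      by move=> k; rewrite lee_fin powR_ge0.
    by apply: mule_lty => //; rewrite ltry.
  - move=> k; apply: (@squeeze_cvgr _ _ _ _ (cst 0) (fun i => normc (g (k - m)) * normc (v i k))).
    + by apply: nearW => i; rewrite F0 /F ge_min lexx.
    + exact: cvg_cst.
    + by rewrite -(mulr0 (normc (g (k - m)))); apply: cvgMr; exact: v0.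
have [Ffin /cvgrPdist_lt Fe] := (fine_cvgP _ _).1 Fc.
have e20 : 0 < e / 2 by rewrite divr_gt0.
near=> i.
have Fi : (\int[countZ R n]_k (F i k)%:E)%E \is a fin_num by near: i.
have Fie : `|0 - fine (\int[countZ R n]_k (F i k)%:E)%E| < e / 2 by near: i; exact: Fe.
rewrite sub0r normrN ger0_norm ?normc_ge0// -lte_fin.
have [gf _] := lp_paired p1 p1' pp' (vfin i) gp'.
apply: le_lt_trans (stft_le m w gf) _.
apply: (@le_lt_trans _ _ (d%:E * lpsum p (v i) + \int[countZ R n]_k (F i k)%:E)%E).
  rewrite /lpsum -ge0_integralZl//; last 2 first.
  - by move=> k _; rewrite lee_fin powR_ge0.
  - by rewrite lee_fin ltW.
  rewrite -ge0_integralD//; last 2 first.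
  - by move=> k _; rewrite mule_ge0// lee_fin ?powR_ge0// ltW.
  - by move=> k _; rewrite lee_fin F0.
  apply: ge0_le_integral => //.
  - by move=> k _; rewrite lee_fin mulr_ge0 ?normc_ge0.
  - move=> k _; rewrite -EFinM -EFinD lee_fin -lerBlDl /F le_min lerBlDl lerDr mulr_ge0 ?powR_ge0 ?(ltW d0)//=.
    by rewrite lerBlDl hc ?normc_ge0.
rewrite -[X in (_ + X)%E]fineK// [e]splitr EFinD; apply: lee_ltD; first by rewrite fin_numM// (lpsum_fin (vfin i)).
  apply: (@le_trans _ _ (d%:E * K%:E)%E); first by rewrite lee_wpmul2l// lee_fin ltW.
  by rewrite -EFinM lee_fin /d mulrAC ler_pdivrMr// ler_pM2l// lerDl.
rewrite lte_fin; apply: le_lt_trans Fie.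
by rewrite sub0r normrN ler_norm.
Unshelve. all: by end_near.
Qed.

Variables (sigma : ZT -> C) (g1 g2 : Z -> C).
Hypotheses (isigma : cintegrable (muZT R n) sigma)
  (hg1 : (lpsum p' g1 < +oo)%E) (hg2 : (lpsum p g2 < +oo)%E).

Lemma locop_mass_cvg0 (K : R) (v : nat -> Z -> C) :
  (forall i, lpsum p (v i) <= K%:E)%E ->
  (forall k, (fun i => normc (v i k)) @ \oo --> (0 : R)) ->
  (fun i => locop_mass sigma g1 (v i)) @ \oo --> 0%E.
Proof.
move=> vK v0.
have vfin i : (lpsum p (v i) < +oo)%E by rewrite (le_lt_trans (vK i))// ltry.
have K0 : 0 <= K by rewrite -lee_fin; exact: le_trans (lpsum_ge0 p (v 0%N)) (vK 0%N).
have [ms fs] := (cintegrableP _ _).1 isigma.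
pose S := K + fine (lpsum p' g1).
have S0 : 0 <= S by rewrite addr_ge0// fine_ge0// lpsum_ge0.
apply: (@dominated_cvg0 _ _ _ (fun i z => normc (sigma z * stft g1 (v i) z)) (fun z => normc (sigma z) * S)).
- by move=> i; apply: cmeasurable_normc; apply: cmeasurableM => //; exact: cmeasurable_stft.
- by apply: measurable_funM => //; exact: cmeasurable_normc.
- by move=> i z; exact: normc_ge0.
- move=> i z; rewrite normcM ler_wpM2l ?normc_ge0//.
  apply: le_trans (lp_stft_bounded p1 p1' pp' (vfin i) hg1 z) _.
  by rewrite lerD2r -lee_fin (fineK (lpsum_fin (vfin i))).
- under eq_integral do rewrite EFinM.
  rewrite ge0_integralZr//.
  + by apply: mule_lty => //; [apply: integral_ge0 => z _; rewrite lee_fin normc_ge0|rewrite ltry].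
  + exact: cmeasurable_normcE.
  + by move=> z _; rewrite lee_fin normc_ge0.
- move=> z; under eq_fun do rewrite normcM.
  by rewrite -(mulr0 (normc (sigma z))); apply: cvgMr; exact: stft_cvg0 hg1 vK v0 z.
Qed.

End compactness.

(** * Transfer from l^p to the modulation norm *)

Section modulation_spaces.
Context (R : realType) (n : nat).
Local Notation Z := (Zn n).
Local Notation T := (Tn R n).
Local Notation C := R[i].
Local Notation ZT := (Z * T)%type.
Implicit Types (f g h : Z -> C).

Variable gamma : Z -> C.
Hypotheses (hgamma : Zschwartz gamma) (gamma_neq0 : exists k, gamma k != 0).

Lemma modZ_norm_ge0 (p : R) f : (0 <= modZ_norm gamma p%:E f)%E.
Proof. by rewrite modZ_normE poweR_ge0. Qed.

(** K is chosen before f, so a norm-bounded sequence becomes one with a common l^p bound. *)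
Lemma modZ_norm_bound (p : R) : 1 < p -> forall B : R, exists K : R, forall f,
  Ztempered f -> (modZ_norm gamma p%:E f <= B%:E)%E -> (lpsum p f <= K%:E)%E.
Proof.
move=> p1 B; have p0 : 0 < p by rewrite (lt_trans ltr01).
have [k0 k00] := gamma_neq0.
have c0 : 0 < normc (gamma k0) `^ p by rewrite powR_gt0// normc_gt0.
exists ((normc (gamma k0) `^ p)^-1 * B `^ p) => f tf fB.
rewrite EFinM lee_pdivlMl//; apply: le_trans (lpsum_le k0 p1 hgamma tf) _.
rewrite -[mpsum _ _ _](poweRe1 (mpsum_ge0 _ _ _)) -[X in (_ `^ X)%E](mulVf (lt0r_neq0 p0)) poweRrM.
rewrite -modZ_normE -poweR_EFin.
exact: (le_poweR (ltW p0) (modZ_norm_ge0 _ _) fB).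
Qed.

Lemma modZ_lpsum (p : R) f : 1 < p -> modZ gamma p%:E f -> (lpsum p f < +oo)%E.
Proof.
move=> p1 [tf [_ fp]].
have [K HK] := modZ_norm_bound p1 (fine (modZ_norm gamma p%:E f)).
apply: (@le_lt_trans _ _ K%:E); last exact: ltry.
apply: HK => //; rewrite fineK//.
by rewrite (ge0_fin_numE (modZ_norm_ge0 _ _)).
Qed.

Lemma lpsum_modZ (p : R) f : 1 < p -> (lpsum p f < +oo)%E -> modZ gamma p%:E f.
Proof.
move=> p1 fp; have gs := Zschwartz_l1 hgamma; split.
  by have [B B0 fB] := lpsum_bounded p1 fp; exact: bounded_tempered fB.
split; first exact: cmeasurable_stft.
rewrite -[Lp_norm _ _ _]/(modZ_norm gamma p%:E f) modZ_normE; apply: poweR_lty.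
apply: le_lt_trans (mpsum_le p1 gs fp) _.
exact: mule_lty (poweR_ge0 _ _) (poweR_lty _ gs) (mule_lty (l1sum_ge0 _) gs fp).
Qed.

Variables (p p' : R).
Hypotheses (p1 : 1 < p) (p1' : 1 < p') (pp' : p^-1 + p'^-1 = 1).
Variables (sigma : ZT -> C) (g1 g2 : Z -> C).
Hypotheses (isigma : cintegrable (muZT R n) sigma)
  (hg1 : (lpsum p' g1 < +oo)%E) (hg2 : (lpsum p g2 < +oo)%E).

Lemma modZ_norm_locop_cvg0 (K : R) (v : nat -> Z -> C) :
  (forall i, lpsum p (v i) <= K%:E)%E ->
  (forall k, (fun i => normc (v i k)) @ \oo --> (0 : R)) ->
  (fun i => modZ_norm gamma p%:E (locop sigma g1 g2 (v i))) @ \oo --> 0%E.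
Proof.
move=> vK v0; have p0 : 0 < p by rewrite (lt_trans ltr01).
have vfin i : (lpsum p (v i) < +oo)%E by rewrite (le_lt_trans (vK i))// ltry.
have gs := Zschwartz_l1 hgamma.
pose s := fine (l1sum gamma); pose t := fine (lpsum p g2).
have Es : l1sum gamma = s%:E by rewrite fineK// (ge0_fin_numE (l1sum_ge0 _)).
have Et : lpsum p g2 = t%:E by rewrite fineK// lpsum_fin.
have [mfin mc] := (fine_cvgP _ _).1 (locop_mass_cvg0 p1 p1' pp' isigma hg1 vK v0).
pose m i := fine (locop_mass sigma g1 (v i)).
have m0 i : 0 <= m i by rewrite fine_ge0// integral_ge0// => z _; rewrite lee_fin normc_ge0.
(* The p-th root of the bound of [mpsum_le] composed with that of [lpsum_locop]. It tends to 0 with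
   the mass m i, since p - 1 > 0. *)
pose b i := (s `^ (p - 1) * (s * (m i `^ (p - 1) * (m i * t)))) `^ p^-1.
have bc : b @ \oo --> (0 : R).
  rewrite -[X in _ --> X](@powR0 _ p^-1) ?invr_neq0 ?gt_eqF//.
  apply: powR_cvg; first by rewrite invr_gt0.
    move=> i; rewrite !mulr_ge0 ?powR_ge0//.
      by rewrite -lee_fin -Es l1sum_ge0.
    by rewrite -lee_fin -Et lpsum_ge0.
  rewrite [X in _ --> X](_ : 0 = s `^ (p - 1) * (s * (0 `^ (p - 1) * (0 * t)))); last by rewrite mul0r !mulr0.
  do 2!apply: cvgMr.
  apply: cvgM; last exact: cvgMl.
  by apply: powR_cvg => //; rewrite subr_gt0.
apply: (@squeeze_cvge _ _ _ _ (cst 0%E) _ (fun i => (b i)%:E)); last 2 first.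
- exact: cvg_cst.
- by apply: cvg_EFin; [exact: nearW|exact: bc].
near=> i; rewrite modZ_norm_ge0/= modZ_normE -poweR_EFin.
have mi : locop_mass sigma g1 (v i) = (m i)%:E.
  by rewrite fineK//; near: i.
have Lfin := lpsum_locop_fin p1 p1' pp' isigma hg1 hg2 (vfin i).
apply: le_poweR; first by rewrite invr_ge0 ltW.
  exact: mpsum_ge0.
apply: le_trans (mpsum_le p1 gs Lfin) _.
have := lpsum_locop p1 p1' pp' isigma hg1 hg2 (vfin i).
rewrite Es Et mi !poweR_EFin -!EFinM => HL.
rewrite 2!EFinM lee_wpmul2l ?lee_fin ?powR_ge0// lee_wpmul2l//.
by rewrite -Es l1sum_ge0.
Unshelve. all: by end_near.
Qed.

Local Notation L := (locop sigma g1 g2).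

Lemma compact_locop :
  compact_operator (modZ gamma p%:E) (modZ_norm gamma p%:E) (locop sigma g1 g2).
Proof.
have p0 : 0 < p by rewrite (lt_trans ltr01).
have Lfin f : (lpsum p f < +oo)%E -> (lpsum p (L f) < +oo)%E.
  exact: (lpsum_locop_fin p1 p1' pp' isigma hg1 hg2).
split.
- by move=> f /(modZ_lpsum p1) /Lfin; exact: lpsum_modZ.
- move=> a f h /(modZ_lpsum p1) fp /(modZ_lpsum p1) hp.
  exact: (locop_lin p1 p1' pp' isigma hg1 hg2 a fp hp).
move=> u Mu [B uB]; have [K HK] := modZ_norm_bound p1 B.
have uK i : (lpsum p (u i) <= K%:E)%E by apply: HK => //; have [] := Mu i.
have ufin i : (lpsum p (u i) < +oo)%E by rewrite (le_lt_trans (uK i))// ltry.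
have [s [homo_s [f sf]]] := @pointwise_subsequence R n u (K `^ p^-1) (fun i k => lpsum_ptwise p0 (uK i) k).
exists s; split=> //.
have fK : (lpsum p f <= K%:E)%E by exact: (lpsum_fatou p0 sf (fun i => uK (s i))).
have ffin : (lpsum p f < +oo)%E by rewrite (le_lt_trans fK)// ltry.
exists (L f); first exact: (lpsum_modZ p1 (Lfin _ ffin)).
(* The subsequence and its limit both have l^p sums at most K, so [lpsumB] bounds those of the
   differences by this constant. Linearity with scalar -1 then turns L of a difference into a
   difference of images. *)
have := @modZ_norm_locop_cvg0 (2 `^ p * (K + K)) (fun i k => u (s i) k - f k) _ sf.
rewrite (_ : (fun i => modZ_norm _ _ (locop _ _ _ _)) =
    (fun i => modZ_norm gamma p%:E (fun k => L (u (s i)) k - L f k))).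
  apply=> i; apply: le_trans (lpsumB _ _ (ltW p0)) _.
  by rewrite EFinM EFinD lee_wpmul2l ?lee_fin ?powR_ge0//; exact: (leeD (uK (s i)) fK).
apply/funext => i; congr (modZ_norm _ _ _).
have := locop_lin p1 p1' pp' isigma hg1 hg2 (-1) ffin (ufin (s i)).
rewrite (_ : (fun k => -1 * f k + u (s i) k) = (fun k => u (s i) k - f k)).
  by move=> ->; apply/funext => k; rewrite mulN1r addrC.
by apply/funext => k; rewrite mulN1r addrC.
Qed.

End modulation_spaces.

Theorem theorem4p15 (R : realType) (n : nat) (p p' : R)
  (hp : 1 < p) (hpp' : p^-1 + p'^-1 = 1)
  (gamma : Zn n -> R[i]) (hgamma : Zschwartz gamma)
  (gamma_neq0 : exists k, gamma k != 0)
  (Gamma : Zn n * Tn R n -> R[i]) (hGamma : ZTschwartz Gamma)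
  (Gamma_neq0 : exists z, Gamma z != 0)
  (varsigma : (Zn n * Tn R n -> R[i]) -> R[i])
  (hvarsigma : modZT Gamma 1%E varsigma)
  (g1 g2 : Zn n -> R[i])
  (hg1 : modZ gamma p'%:E g1) (hg2 : modZ gamma p%:E g2) :
  exists2 sigma : Zn n * Tn R n -> R[i],
    represents sigma varsigma &
    locop_well_defined sigma g1 g2 (modZ gamma p%:E) (modZ gamma p'%:E) /\
    compact_operator (modZ gamma p%:E) (modZ_norm gamma p%:E)
      (locop sigma g1 g2).
Proof.
(* p' is known only through its inverse, which equals 1 - 1/p and lies strictly between 0 and 1. *)
have hp' : 1 < p'.
  have p0 : 0 < p by rewrite (lt_trans ltr01).
  have p'E : p'^-1 = 1 - p^-1 by rewrite -hpp' addrAC subrr add0r.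
  have p'V : 0 < p'^-1 by rewrite p'E subr_gt0 invf_lt1.
  by rewrite -[p']invrK invf_gt1// p'E ltrBlDr ltrDl invr_gt0.
have l1 := modZ_lpsum hgamma gamma_neq0 hp' hg1.
have l2 := modZ_lpsum hgamma gamma_neq0 hp hg2.
have [tu [mV fV]] := hvarsigma.
rewrite /Lp_norm Lnorm1 in fV.
have fV1 : (\int[(muZT R n \x muTZ R n)%E]_z (normc (stftZT Gamma varsigma z))%:E < +oo)%E.
  by apply: le_lt_trans fV; rewrite le_eqVlt; apply/orP; left; apply/eqP;
    apply: eq_integral => z _; rewrite gee0_abs// lee_fin normc_ge0.
have csum := fcoef_summable tu hGamma Gamma_neq0 mV fV1.
have isigma := cintegrable_fsymbol csum.
exists (fsymbol (fcoef varsigma)); first exact: (represents_fsymbol csum tu).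
split; last exact: (compact_locop hgamma gamma_neq0 hp hp' hpp' isigma l1 l2).
move=> f /(modZ_lpsum hgamma gamma_neq0 hp) fp; split=> [k|h].
  exact: (cintegrable_locop hp hp' hpp' isigma l1 l2 k fp).
move=> /(modZ_lpsum hgamma gamma_neq0 hp') hlp.
exact: (locop_weak hp hp' hpp' isigma l1 l2 fp hlp).
Qed.
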